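(* Let $X$ be a quasi-normed lattice of function sequences satisfying Assumption II for some Carleson-type measure $\nu$. Let $s\in(0,\infty)$ and $r\in\mathbb N$ with $r>s$, and assume the regularity $L$ of the Daubechies wavelet system satisfies $L>s$ and $L\ge r-1$. Then, for any $f\in\Lambda_s$, $$\mathrm{dist}\left(f,\Lambda_X^s\right)_{\Lambda_s}\sim\varepsilon_{X,\nu}f+\inf\left\{\varepsilon\in(0,\infty):\nu\Big(\bigcup_{I\in V_0(s,f,\varepsilon)}T(I)\Big)<\infty\right\}$$ with positive equivalence constants independent of $f$.
   Context: Notation. For $h\in\mathbb R^n$, $\Delta_hf(x):=f(x+h/2)-f(x-h/2)$, $\Delta_h^{k+1}:=\Delta_h^k\Delta_h$; $\Delta_kf(x,y):=\sup_{|h|=y}|\Delta_h^kf(x)|$. $\Lambda_s$ ($s>0$): bounded continuous $f$ on $\mathbb R^n$ with $\|f\|_{\Lambda_s}:=\|f\|_{L^\infty}+\sup_{x\in\mathbb R^n,y\in(0,1]}\Delta_{\lfloor s\rfloor+1}f(x,y)/y^s<\infty$. $\mathrm{dist}(f,V)_{\Lambda_s}:=\inf_{g\in V\cap\Lambda_s}\|f-g\|_{\Lambda_s}$. $S_{r,j}(s,f,\varepsilon):=\{(x,y)\in\mathbb R^n\times(0,\infty):\Delta_rf(x,y)/y^s>\varepsilon,\ y\in(2^{-j-1},2^{-j}]\}$. Dyadic cubes $\mathcal D_j=\{2^{-j}(k+[0,1)^n):k\in\mathbb Z^n\}$, $\mathcal D=\bigcup_{j\ge0}\mathcal D_j$;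 $\ell(I)$ is the side length; $T(I):=I\times(\ell(I)/2,\ell(I)]$. Daubechies wavelet system of regularity $L$: $\varphi,\psi_\ell\in C^L_c$, $\ell=1,\dots,2^n-1$, $\psi_\ell$ with vanishing moments of all orders $\le L$, such that $\{\varphi(\cdot-k)\}\cup\{2^{jn/2}\psi_\ell(2^j\cdot-k)\}$ ($j\in\mathbb Z_+$, $k\in\mathbb Z^n$) is an orthonormal basis of $L^2$. Indexed by $\Omega=\{0\}\times\mathcal D_0\cup\{1,\dots,2^n-1\}\times\mathcal D$: $\psi_{(0,k+[0,1)^n)}=\varphi(\cdot-k)$, $\psi_{(\ell,2^{-j}(k+[0,1)^n))}=2^{jn/2}\psi_\ell(2^j\cdot-k)$, $I_{(\ell,I)}=I$. $V_0(s,f,\varepsilon):=\{I\in\mathcal D_0:|\int f\psi_{(0,I)}|>\varepsilon\}$. Quasi-normed lattice of function sequences: a quasi-norm $\|\cdot\|_X$ on sequences $\mathbf F=\{f_j\}_{j\in\mathbb Z_+}$ of a.e. finite measurable functions, with values in $[0,\infty]$, monotone ($|f_j|\le|g_j|$ a.e. $\forall j\Rightarrow\|\mathbf F\|_X\le\|\mathbf G\|_X$), bounded under the shifts $\{f_{j+1}\}_j$ and $\{f_{j-1}\}_j$ ($f_{-1}=0$) by $C\|\mathbf F\|_X$, and with $\{f,0,0,\dots\}$ of finite quasi-norm for every bounded compactly supported $f$. $\Lambda^s_X$: all $f\in\Lambda_s$ with $\|\{\sum_{\omega:I_\omega\in\mathcal D_j}|I_\omega|^{-s/n-1/2}|\langle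 f,\psi_\omega\rangle|\mathbf 1_{I_\omega}\}_{j}\|_X<\infty$. Hyperbolic metric on $\mathbb R^{n+1}_+$: $\rho(\mathbf x,\mathbf y):=\operatorname{arccosh}\big(1+\frac{|\mathbf x-\mathbf y|^2}{2x_{n+1}y_{n+1}}\big)$; $B_\rho(\mathbf z,t):=\{\mathbf y:\rho(\mathbf z,\mathbf y)<t\}$; for $A\subset\mathbb R^{n+1}_+$, $A_R:=\{\mathbf x:\inf_{\mathbf y\in A}\rho(\mathbf x,\mathbf y)<R\}$. $|\cdot|$ is Lebesgue measure. Carleson-type measure: a map $\nu$ from sequences $\{A_j\}_{j\in\mathbb Z_+}$ of measurable subsets of $\mathbb R^{n+1}_+$ to $[0,\infty]$ such that (i) $A_j\subset B_j\ \forall j$ implies $\nu(\{A_j\})\le\nu(\{B_j\})$; (ii) $\nu(\{A_j\cup B_j\})\le C[\nu(\{A_j\})+\nu(\{B_j\})]$; (iii) if there are $\delta,\delta'\in(0,1/10)$ independent of $j$ with $|B_\rho(\mathbf z,\delta)\cap A_j|\ge\delta'|B_\rho(\mathbf z,\delta)|$ for all $j$ and $\mathbf z\in A_j$, then for every $R>0$, $\nu(\{(A_j)_R\}_j)$ and $\nu(\{A_j\}_j)$ are finite or infinite simultaneously; (iv) $\nu(\{A_{j+1}\}_j)\le C\nu(\{A_j\}_j)$ and $\nu(\{A_{j-1}\}_j)\le C\nu(\{A_j\}_j)$ with $A_{-1}=\emptyset$. For a single set $A$, $\nu(A):=\nu(\{A,\emptyset,\emptyset,\dots\})$. Assumption II: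 there is a Carleson-type measure $\nu$ such that for every $\mathcal A\subset\mathcal D$, $\|\{\sum_{I\in\mathcal A\cap\mathcal D_j}\mathbf 1_I\}_j\|_X$ and $\nu(\{\bigcup_{I\in\mathcal A\cap\mathcal D_j}T(I)\}_j)$ are finite or infinite simultaneously. $\varepsilon_{X,\nu}f:=\inf\{\varepsilon\in(0,\infty):\nu(\{S_{r,j}(s,f,\varepsilon)\}_{j\in\mathbb Z_+})<\infty\}$. *)

(* Defs.v *)
(* Everything is over an abstract
   R : realType; points of R^n are row vectors 'rV[R]_n, points of the upper
   half-space R^{n+1}_+ are pairs (x, t) : 'rV[R]_n * R with t > 0. *)
From mathcomp Require Import all_boot all_order all_algebra.
From mathcomp Require Import all_classical all_reals all_analysis measurable_realfun.
Import Order.TTheory GRing.Theory Num.Theory.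
Import numFieldNormedType.Exports.
Set Implicit Arguments. Unset Strict Implicit. Unset Printing Implicit Defensive.
Local Open Scope classical_set_scope.
Local Open Scope ring_scope.

Section Defs.
Variable R : realType.

Definition enorm n (x : 'rV[R]_n) : R := Num.sqrt (\sum_(i < n) x ord0 i ^+ 2).

Definition ebasis n (i : 'I_n) : 'rV[R]_n := \row_(j < n) (i == j)%:R.

Definition zvec n (k : 'rV[int]_n) : 'rV[R]_n := map_mx (fun z : int => z%:~R) k.

(* ---------- measurability (Borel sets of R^n via the tuple sigma-algebra) ---- *)
Definition rowt n (t : n.-tuple R) : 'rV[R]_n := \row_(i < n) tnth t i.

Definition rmeasurable n (A : set 'rV[R]_n) : Prop :=
  measurable [set t : n.-tuple R | A (rowt t)].

Definition rmeasurable_fun n (f : 'rV[R]_n -> \bar R) : Prop :=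
  forall B : set (\bar R), measurable B -> rmeasurable (f @^-1` B).

Definition rmeasurable_rfun n (f : 'rV[R]_n -> R) : Prop :=
  rmeasurable_fun (fun x => (f x)%:E).

Definition hmeasurable n (A : set ('rV[R]_n * R)) : Prop :=
  measurable [set p : n.-tuple R * R | A (rowt p.1, p.2)].

(* ---------- Lebesgue integral / measure on R^n (iterated, Tonelli/Fubini) ---- *)
Fixpoint intn (n : nat) : ('rV[R]_n -> \bar R) -> \bar R :=
  match n return ('rV[R]_n -> \bar R) -> \bar R with
  | 0 => fun f => f 0
  | n'.+1 => fun f =>
      (\int[lebesgue_measure]_x
          intn (fun y : 'rV[R]_n' => f (row_mx (const_mx x : 'rV[R]_1) y)))%E
  end.

Definition lebn n (A : set 'rV[R]_n) : \bar R := intn (fun x => (\1_A x)%:E).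

Definition lebh n (A : set ('rV[R]_n * R)) : \bar R :=
  (\int[lebesgue_measure]_t lebn [set x | A (x, t)])%E.

Definition ae n (P : 'rV[R]_n -> Prop) : Prop :=
  exists N, rmeasurable N /\ lebn N = 0%E /\ forall x, ~ N x -> P x.

Fixpoint Ck (k : nat) n (f : 'rV[R]_n -> R) : Prop :=
  continuous f /\
  match k with
  | 0 => True
  | k'.+1 => forall i : 'I_n,
      (forall x, derivable f x (ebasis i)) /\ Ck k' ('D_(ebasis i) f)
  end.

Definition compact_support n (f : 'rV[R]_n -> R) : Prop :=
  exists M : R, forall x, M < enorm x -> f x = 0.

Definition CLc (L : nat) n (f : 'rV[R]_n -> R) : Prop := Ck L f /\ compact_support f.

(* the dyadic cube 2^{-j}(k + [0,1)^n), I in D_j, encoded by (j, k) *)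
Definition cube n (j : nat) (k : 'rV[int]_n) : set 'rV[R]_n :=
  [set x | forall i : 'I_n,
      (k ord0 i)%:~R / 2 ^+ j <= x ord0 i < (k ord0 i + 1)%:~R / 2 ^+ j].

Definition side (j : nat) : R := (2 ^+ j)^-1.

Definition tent n (j : nat) (k : 'rV[int]_n) : set ('rV[R]_n * R) :=
  [set p | cube j k p.1 /\ side j / 2 < p.2 <= side j].

(* wavelet indices omega = (l, (j, k)) : l = 0 (then j = 0) is the scaling
   function, 1 <= l <= 2^n - 1 the wavelets *)
Definition windex n := (nat * (nat * 'rV[int]_n))%type.

Definition in_Omega n (w : windex n) : Prop :=
  (w.1 = 0%N /\ w.2.1 = 0%N) \/ (1 <= w.1 < 2 ^ n)%N.

Definition psiw n (phi : 'rV[R]_n -> R) (psi : nat -> 'rV[R]_n -> R)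
    (w : windex n) : 'rV[R]_n -> R :=
  fun x => if w.1 == 0%N then phi (x - zvec w.2.2)
           else Num.sqrt (2 ^+ (w.2.1 * n)) *
                psi w.1 ((2 ^+ w.2.1) *: x - zvec w.2.2).

Definition monom n (alpha : 'I_n -> nat) (x : 'rV[R]_n) : R :=
  \prod_(i < n) x ord0 i ^+ alpha i.

Definition daubechies (L : nat) n (phi : 'rV[R]_n -> R)
    (psi : nat -> 'rV[R]_n -> R) : Prop :=
  [/\ CLc L phi,
      (forall l, (1 <= l < 2 ^ n)%N -> CLc L (psi l)),
      (forall l, (1 <= l < 2 ^ n)%N -> forall alpha : 'I_n -> nat,
          (\sum_(i < n) alpha i <= L)%N ->
          intn (fun x => (monom alpha x * psi l x)%:E) = 0%E),
      (forall w w' : windex n, in_Omega w -> in_Omega w' ->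
          intn (fun x => (psiw phi psi w x * psiw phi psi w' x)%:E)
          = (if w == w' then 1 else 0)%:E) &
      (forall g : 'rV[R]_n -> R, rmeasurable_rfun g ->
          (intn (fun x => (g x ^+ 2)%:E) < +oo)%E ->
          (forall w, in_Omega w -> intn (fun x => (g x * psiw phi psi w x)%:E) = 0%E) ->
          ae (fun x => g x = 0))].

Definition diff1 n (h : 'rV[R]_n) (f : 'rV[R]_n -> R) : 'rV[R]_n -> R :=
  fun x => f (x + (2^-1) *: h) - f (x - (2^-1) *: h).

Fixpoint diffk (k : nat) n (h : 'rV[R]_n) (f : 'rV[R]_n -> R) : 'rV[R]_n -> R :=
  match k with 0 => f | k'.+1 => diffk k' h (diff1 h f) end.

Definition Delta (k : nat) n (f : 'rV[R]_n -> R) (x : 'rV[R]_n) (y : R) : \bar R :=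
  ereal_sup [set (`|diffk k h f x|)%:E | h in [set h : 'rV[R]_n | enorm h = y]].

Definition Lnorm_s (s : R) n (f : 'rV[R]_n -> R) : \bar R :=
  (ereal_sup [set (`|f x|)%:E | x in [set: 'rV[R]_n]] +
   ereal_sup [set (Delta (Num.truncn s).+1 f p.1 p.2 * ((powR p.2 s)^-1)%:E)%E
               | p in [set p : 'rV[R]_n * R | (0 < p.2 <= 1)%R]])%E.

Definition in_Lambda (s : R) n (f : 'rV[R]_n -> R) : Prop :=
  [/\ continuous f, (exists M : R, forall x, `|f x| <= M) & (Lnorm_s s f < +oo)%E].

Definition distL (s : R) n (f : 'rV[R]_n -> R) (V : set ('rV[R]_n -> R)) : \bar R :=
  ereal_inf [set Lnorm_s s (f \- g) | g in [set g | V g /\ in_Lambda s g]].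

Definition fseq n := nat -> 'rV[R]_n -> \bar R.

Definition adm n (F : fseq n) : Prop :=
  forall j, rmeasurable_fun (F j) /\ ae (fun x => F j x \is a fin_num).

Definition quasi_norm n (X : fseq n -> \bar R) : Prop :=
  [/\ (forall F, adm F -> (0 <= X F)%E),
      (forall F, adm F -> X F = 0%E <-> forall j, ae (fun x => F j x = 0%E)),
      (forall F (c : R), adm F -> X (fun j x => (c%:E * F j x)%E) = (`|c|%:E * X F)%E) &
      (exists K : R, 1 <= K /\ forall F G, adm F -> adm G ->
          (X (fun j x => F j x + G j x) <= K%:E * (X F + X G))%E)].

Definition qnormed_lattice n (X : fseq n -> \bar R) : Prop :=
  [/\ quasi_norm X,
      (forall F G, adm F -> adm G ->
          (forall j, ae (fun x => `|F j x| <= `|G j x|)%E) -> (X F <= X G)%E),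
      (exists C : R, 0 < C /\ forall F, adm F ->
          (X (fun j => F j.+1) <= C%:E * X F)%E /\
          (X (fun j => if j is j'.+1 then F j' else fun _ => 0%E) <= C%:E * X F)%E) &
      (forall f : 'rV[R]_n -> R, rmeasurable_rfun f -> (exists M : R, forall x, `|f x| <= M) ->
          compact_support f ->
          (X (fun j x => if j == 0%N then (f x)%:E else 0%E) < +oo)%E)].

Definition upper n : set ('rV[R]_n * R) := [set p | 0 < p.2].

Definition arccosh (w : R) : R := ln (w + Num.sqrt (w ^+ 2 - 1)).

Definition rho n (p q : 'rV[R]_n * R) : R :=
  arccosh (1 + (enorm (p.1 - q.1) ^+ 2 + (p.2 - q.2) ^+ 2) / (2 * p.2 * q.2)).

Definition hball n (z : 'rV[R]_n * R) (t : R) : set ('rV[R]_n * R) :=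
  [set y | upper y /\ rho z y < t].

Definition hnbhd n (A : set ('rV[R]_n * R)) (t : R) : set ('rV[R]_n * R) :=
  [set x | upper x /\ ereal_inf [set (rho x y)%:E | y in A] < t%:E]%E.

Definition hseq n (A : nat -> set ('rV[R]_n * R)) : Prop :=
  forall j, A j `<=` @upper n /\ hmeasurable (A j).

Definition single n (A : set ('rV[R]_n * R)) : nat -> set ('rV[R]_n * R) :=
  fun j => if j == 0%N then A else set0.

Definition carleson_type n (nu : (nat -> set ('rV[R]_n * R)) -> \bar R) : Prop :=
  [/\ (forall A, hseq A -> (0 <= nu A)%E),
      (forall A B, hseq A -> hseq B -> (forall j, A j `<=` B j) -> (nu A <= nu B)%E),
      (exists C : R, 0 < C /\ forall A B, hseq A -> hseq B ->
          (nu (fun j => A j `|` B j) <= C%:E * (nu A + nu B))%E),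
      (forall A (d d' : R), hseq A -> 0 < d < 10^-1 -> 0 < d' < 10^-1 ->
          (forall j z, A j z ->
              (d'%:E * lebh (hball z d) <= lebh (hball z d `&` A j))%E) ->
          forall t : R, 0 < t ->
            ((nu (fun j => hnbhd (A j) t) < +oo)%E <-> (nu A < +oo)%E)) &
      (exists C : R, 0 < C /\ forall A, hseq A ->
          (nu (fun j => A j.+1) <= C%:E * nu A)%E /\
          (nu (fun j => if j is j'.+1 then A j' else set0) <= C%:E * nu A)%E)].

(* Assumption II; a family of dyadic cubes is a set of pairs (j, k) *)
Definition assumptionII n (X : fseq n -> \bar R)
    (nu : (nat -> set ('rV[R]_n * R)) -> \bar R) : Prop :=
  forall cA : set (nat * 'rV[int]_n),
    (X (fun j x => \esum_(k in [set k | cA (j, k)]) (\1_(cube j k) x)%:E) < +oo)%E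
    <-> (nu (fun j => \bigcup_(k in [set k | cA (j, k)]) tent j k) < +oo)%E.

Definition wcoef n phi psi (f : 'rV[R]_n -> R) (w : windex n) : \bar R :=
  intn (fun x => (f x * psiw phi psi w x)%:E).

Definition wseq (s : R) n phi psi (f : 'rV[R]_n -> R) : fseq n :=
  fun j x => \esum_(w in [set w : windex n | in_Omega w /\ w.2.1 = j])
     ((powR (2 ^+ (j * n))^-1 (- s / n%:R - 2^-1))%:E
      * `|wcoef phi psi f w| * (\1_(cube j w.2.2) x)%:E)%E.

Definition LambdaX n (X : fseq n -> \bar R) (s : R) (phi : 'rV[R]_n -> R)
    (psi : nat -> 'rV[R]_n -> R) : set ('rV[R]_n -> R) :=
  [set f | in_Lambda s f /\ (X (wseq s phi psi f) < +oo)%E].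

Definition Srj (r j : nat) (s : R) n (f : 'rV[R]_n -> R) (eps : R) : set ('rV[R]_n * R) :=
  [set p | (Delta r f p.1 p.2 * ((powR p.2 s)^-1)%:E > eps%:E)%E /\
           side j / 2 < p.2 <= side j].

Definition eps_Xnu n (nu : (nat -> set ('rV[R]_n * R)) -> \bar R) (r : nat) (s : R)
    (f : 'rV[R]_n -> R) : \bar R :=
  ereal_inf [set e%:E | e in [set e : R | 0 < e /\ (nu (fun j => Srj r j s f e) < +oo)%E]].

(* V_0(s, f, eps): k encodes the cube k + [0,1)^n in D_0 *)
Definition V0 n phi psi (f : 'rV[R]_n -> R) (eps : R) : set 'rV[int]_n :=
  [set k | (`|wcoef phi psi f (0%N, (0%N, k))| > eps%:E)%E].

Definition eps_V0 n (nu : (nat -> set ('rV[R]_n * R)) -> \bar R) phi psi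
    (f : 'rV[R]_n -> R) : \bar R :=
  ereal_inf [set e%:E | e in [set e : R | 0 < e /\
     (nu (single (\bigcup_(k in V0 phi psi f e) tent 0 k)) < +oo)%E]].

End Defs.

(* Main.v *)
(** The wavelet coefficients of [f] and its differences of order [r] control each
    other locally.  If all differences [diffk r h f u] with [u] near a cube and [h] at
    most its side are small, then so are the coefficients on that cube: the wavelets
    have vanishing moments, and a local Whitney theorem (Lagrange interpolation on
    dyadic lattices, with Kemperman's identity reducing mixed differences to pure
    ones) approximates [f] by a polynomial.  Conversely, a difference at scale
    [2 ^- j] is a sum over all wavelets whose terms decay geometrically in the
    distance to the level [j], so it is small when the coefficients near the point
    and near the level [j] are.  Completeness of the system turns this into the
    identity [f = syn (coef f)] on [Lambda_s].

    Upper bound: remove from [f] the synthesis of its small coefficients; the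
    remainder only has coefficients on cubes whose tents lie in a hyperbolic
    neighbourhood of the superlevel sets [Srj], which a Carleson-type measure does
    not distinguish from the (thickened) superlevel sets, and Assumption II puts the
    remainder in [LambdaX].  Lower bound: for [g] in [LambdaX] the cubes carrying a
    large coefficient have tents of finite measure by Assumption II, every superlevel
    set of [g] lies in a hyperbolic neighbourhood of those tents, and [f - g]
    contributes at most a multiple of its norm. *)
Require Import Defs.
From mathcomp Require Import all_boot all_order all_algebra.
From mathcomp Require Import all_classical all_reals all_analysis measurable_realfun.
From mathcomp Require Import ring lra zify.
Import Order.TTheory GRing.Theory Num.Theory.
Import numFieldNormedType.Exports.
Set Implicit Arguments. Unset Strict Implicit. Unset Printing Implicit Defensive.
Local Open Scope classical_set_scope.
Local Open Scope ring_scope.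

(** Two obstacles shape the proof. First, a function of [Lambda_s] is in general not in L^2, so
    completeness of the system does not apply to it directly. Completeness is used for compactly
    supported Lipschitz functions only; a continuous function with vanishing coefficients is then
    tested against small tent functions, whose expansions converge uniformly. Second, a large
    coefficient must produce a large difference at a scale comparable with its cube, although
    Whitney's hypothesis ranges over all steps up to the side. It is therefore applied with exponent
    s/2: at relative length Y the threshold is of size Y^(s/2), the [Lambda_s] norm allows only Y^s,
    and both can hold only for Y bounded below. A similar splitting recurs in the series: a rate of
    decay is replaced by its square root, one half makes remote levels small and the other half sums
    them. The iterated integral is linear only on good functions, so real integrals are taken of
    continuous functions vanishing off a ball. Smoothness of the wavelets is used to order k =
    floor(s) + 1, the order in the [Lambda_s] norm; differences of order r >= k inherit its
    bounds. *)

(** * Continuity and norms on R^n *)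

Section Norms.
Variable R : realType.

Lemma contD (T : topologicalType) (f g : T -> R) :
  continuous f -> continuous g -> continuous (fun x => f x + g x).
Proof. by move=> cf cg x; exact: (continuousD (cf x) (cg x)). Qed.

Lemma contM (T : topologicalType) (f g : T -> R) :
  continuous f -> continuous g -> continuous (fun x => f x * g x).
Proof. by move=> cf cg x; exact: (continuousM (cf x) (cg x)). Qed.

Lemma cont_cst (T : topologicalType) (a : R) : continuous (fun _ : T => a).
Proof. by move=> x; exact: cvg_cst. Qed.

Lemma contZ (T : topologicalType) (a : R) (f : T -> R) :
  continuous f -> continuous (fun x => a * f x).
Proof. by move=> cf; apply: contM => //; exact: cont_cst. Qed.

Lemma contN (T : topologicalType) (f : T -> R) :
  continuous f -> continuous (fun x => - f x).
Proof. by move=> cf x; exact: (continuousN (cf x)). Qed.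

Lemma contB (T : topologicalType) (f g : T -> R) :
  continuous f -> continuous g -> continuous (fun x => f x - g x).
Proof. by move=> cf cg; apply: contD => //; exact: contN. Qed.

Lemma cont_norm (T : topologicalType) (f : T -> R) :
  continuous f -> continuous (fun x => `|f x|).
Proof.
by move=> cf x; apply: (@continuous_comp _ _ _ f (fun y : R => `|y|)); [exact: cf|exact: norm_continuous].
Qed.

Lemma cont_sum (T : topologicalType) (I : Type) (s : seq I) (f : I -> T -> R) :
  (forall i, continuous (f i)) -> continuous (fun x => \sum_(i <- s) f i x).
Proof.
move=> cf; elim: s => [|i s IH].
  by under eq_fun do rewrite big_nil; exact: cont_cst.
by under eq_fun do rewrite big_cons; exact: contD.
Qed.

Lemma continuous_epsP (V W : normedModType R) (f : V -> W) :
  continuous f <-> forall x (e : R), 0 < e ->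
    exists2 d : R, 0 < d & forall y, `|x - y| < d -> `|f x - f y| < e.
Proof.
split=> [cf x e e0|H x].
  have /cvgrPdist_lt /(_ e e0) /nbhs_normP[d /= d0 Hd] := cf x.
  by exists d.
apply/cvgrPdist_lt => e e0; have [d d0 Hd] := H x e e0.
by apply/nbhs_normP; exists d.
Qed.

Lemma cont_affine (V : normedModType R) (f : V -> R) (a : R) (b : V) :
  continuous f -> continuous (fun x => f (a *: x + b)).
Proof.
move=> /continuous_epsP cf; apply/continuous_epsP => x e e0.
have [d d0 Hd] := cf (a *: x + b) e e0.
have a10 : 0 < `|a| + 1 by rewrite ltr_wpDl.
exists (d / (`|a| + 1)); first by rewrite divr_gt0.
move=> y xy; apply: Hd; rewrite opprD addrACA subrr addr0 -scalerBr normrZ.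
rewrite ltr_pdivlMr // in xy; apply: le_lt_trans xy.
by rewrite mulrC ler_wpM2l // lerDl.
Qed.

(** The second point may leave [K]. This is what makes a compactly supported function uniformly
    continuous on the whole space in [Cc_uniform]. *)
Lemma continuous_compact_uniform (V : normedModType R) (f : V -> R) (K : set V) :
  continuous f -> compact K -> forall e : R, 0 < e ->
  exists2 d : R, 0 < d & forall x y, K x -> `|x - y| < d -> `|f x - f y| < e.
Proof.
move=> /continuous_epsP cf /compact_near_coveringP cK e e0.
have := cK _ ((0:R)^'+) (fun d x => forall y, `|x - y| < d -> `|f x - f y| < e) _.
case.
  move=> x Kx; have [d d0 Hd] := cf x (e / 2) ltac:(by rewrite divr_gt0).
  exists (ball x (d / 2), [set t | t < d / 2]) => /=.
    split; first by apply: nbhsx_ballx; rewrite divr_gt0.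
    by apply: nbhs_right_lt; rewrite divr_gt0.
  move=> [x' t] /= [+ td] y x'y; rewrite -ball_normE /= => xx'.
  have xy : `|x - y| < d.
    by rewrite -[x - y](subrKA x') (le_lt_trans (ler_normD _ _)) //; lra.
  have xx'd : `|x - x'| < d by lra.
  have := Hd _ xy; have := Hd _ xx'd; move=> h1 h2.
  rewrite -[f x' - f y](subrKA (f x)) (le_lt_trans (ler_normD _ _)) //.
  by rewrite distrC; lra.
move=> d /= d0 Hd; exists (d / 2); first by rewrite divr_gt0.
move=> x y Kx xy; apply: (Hd (d / 2)) => //=.
- by rewrite sub0r normrN gtr0_norm ?divr_gt0 //; lra.
- by rewrite divr_gt0.
Qed.

(** The library norm on row vectors is the maximum norm, while steps of differences are measured by
    [enorm]; both occur below and cost a factor [n] to exchange. *)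
Lemma rV_normP n (x : 'rV[R]_n) (M : R) : 0 <= M ->
  (`|x| <= M <-> forall i, `|x ord0 i| <= M).
Proof.
move=> M0; split=> [xM i|H].
  apply: le_trans xM; rewrite [leRHS]mx_normrE.
  by rewrite (@le_bigmax _ _ _ _ (fun ij : 'I_1 * 'I_n => `|x ij.1 ij.2|) (ord0, i)).
rewrite [leLHS]mx_normrE; apply/bigmax_leP; split => // -[i j] _ /=.
by rewrite ord1.
Qed.

Lemma coord_le_norm n (x : 'rV[R]_n) i : `|x ord0 i| <= `|x|.
Proof. exact: (rV_normP x (normr_ge0 x)).1 (lexx _) i. Qed.

Lemma coord_le_enorm n (x : 'rV[R]_n) i : `|x ord0 i| <= enorm x.
Proof.
rewrite /enorm -sqrtr_sqr ler_wsqrtr // (bigD1 i) //= lerDl.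
by apply: sumr_ge0 => j _; rewrite sqr_ge0.
Qed.

Lemma enorm_ge0 n (x : 'rV[R]_n) : 0 <= enorm x.
Proof. exact: sqrtr_ge0. Qed.

Lemma norm_le_enorm n (x : 'rV[R]_n) : `|x| <= enorm x.
Proof. by apply/rV_normP => [|i]; rewrite ?enorm_ge0 ?coord_le_enorm. Qed.

Lemma enorm_le_norm n (x : 'rV[R]_n) : enorm x <= n%:R * `|x|.
Proof.
have n0 : 0 <= n%:R * `|x| by rewrite mulr_ge0.
rewrite -(ger0_norm n0) -sqrtr_sqr ler_wsqrtr //.
apply: (@le_trans _ _ (\sum_(i < n) `|x| ^+ 2)).
  apply: ler_sum => i _; rewrite -[x ord0 i ^+ 2]ger0_norm ?sqr_ge0 // normrX.
  by rewrite lerXn2r ?nnegrE ?coord_le_norm ?normr_ge0.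
rewrite sumr_const card_ord exprMn -[_ *+ n]mulr_natl ler_wpM2r ?sqr_ge0 //.
by rewrite -natrX ler_nat; case: n {x n0} => // n; rewrite -mulnn leq_pmulr.
Qed.

Lemma enormZ n (a : R) (x : 'rV[R]_n) : enorm (a *: x) = `|a| * enorm x.
Proof.
rewrite /enorm -[`|a|]ger0_norm // -sqrtr_sqr -sqrtrM ?sqr_ge0 //.
rewrite real_normK ?num_real // mulr_sumr; congr Num.sqrt.
by apply: eq_bigr => i _; rewrite mxE exprMn.
Qed.

Lemma closed_ball_compact n (M : R) : compact [set x : 'rV[R]_n | `|x| <= M].
Proof.
apply: bounded_closed_compact.
  by exists M; split; rewrite ?num_real // => y My x /= xM; rewrite (le_trans xM) // ltW.
apply: (@closed_comp _ _ (fun x : 'rV[R]_n => `|x|) [set y | y <= M]).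
  by move=> x _; exact: norm_continuous.
exact: closed_le.
Qed.

End Norms.

(** * The iterated integral of continuous compactly supported functions *)

Section Integral.
Variable R : realType.
Notation mu := (@lebesgue_measure R).

(** A class stable under slicing on which all inner integrals are finite and continuous in the outer
    variable, so that the iterated integral is linear. *)
Definition Cc n (M : R) (f : 'rV[R]_n -> R) :=
  continuous f /\ forall x, M < `|x| -> f x = 0.

(** [fine] would send an infinite value to 0; [intn_rint] shows that the value is finite on [Cc]. *)
Definition rint n (f : 'rV[R]_n -> R) : R := fine (intn (fun x => (f x)%:E)).

Lemma continuous_bounded_ball n (M : R) (f : 'rV[R]_n -> R) : continuous f ->
  exists2 B, 0 <= B & forall x, `|x| <= M -> `|f x| <= B.
Proof.
move=> /continuous_epsP cf.
have /compact_near_coveringP cK := @closed_ball_compact R n M.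
have [|B [Br HB]] := cK _ (+oo%R : set_system R) (fun B x => `|f x| < B) _.
  move=> x _; have [d d0 Hd] := cf x 1 ltr01.
  exists (ball x d, [set t | `|f x| + 1 < t]) => /=.
    split; first exact: nbhsx_ballx.
    by apply: nbhs_pinfty_gt; rewrite num_real.
  move=> [y t] /= [+ ft]; rewrite -ball_normE => /= /Hd fxy; apply: lt_trans ft.
  rewrite -(subrK (f x) (f y)) (le_lt_trans (ler_normD _ _)) //.
  by rewrite distrC addrC ltrD2l.
exists (`|B| + 1); first by rewrite addr_ge0.
by move=> x xM; apply/ltW/(HB (`|B| + 1)) => //=; have := ler_norm B; lra.
Qed.

Lemma Cc_bounded n (M : R) (f : 'rV[R]_n -> R) : Cc M f ->
  exists2 B, 0 <= B & forall x, `|f x| <= B.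
Proof.
move=> [cf f0]; have [B B0 HB] := continuous_bounded_ball M cf.
exists B => // x; have [xM|Mx] := leP `|x| M; first exact: HB.
by rewrite f0 // normr0.
Qed.

Lemma Cc_uniform n (M : R) (f : 'rV[R]_n -> R) : Cc M f -> forall e : R, 0 < e ->
  exists2 d : R, 0 < d & forall x y, `|x - y| < d -> `|f x - f y| < e.
Proof.
move=> [cf f0] e e0.
have [d d0 Hd] := continuous_compact_uniform cf (@closed_ball_compact R n M) e0.
exists d => // x y xy; have [xM|Mx] := leP `|x| M; first exact: Hd.
have [yM|My] := leP `|y| M; last by rewrite !f0 // subrr normr0.
by rewrite distrC; apply: Hd; rewrite // distrC.
Qed.

Lemma Cc_le n (M M' : R)  (f : 'rV[R]_n -> R) : M <= M' -> Cc M f -> Cc M' f.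
Proof. by move=> MM' [cf f0]; split => // x Mx; rewrite f0 // (le_lt_trans MM'). Qed.

Lemma CcD n (M : R) (f g : 'rV[R]_n -> R) a : Cc M f -> Cc M g ->
  Cc M (fun x => a * f x + g x).
Proof.
move=> [cf f0] [cg g0]; split; last by move=> x Mx; rewrite f0 // g0 // mulr0 addr0.
by apply: contD => //; exact: contZ.
Qed.

Lemma CcMl n (M : R) (f g : 'rV[R]_n -> R) : continuous f -> Cc M g ->
  Cc M (fun x => f x * g x).
Proof.
move=> cf [cg g0]; split; last by move=> x Mx; rewrite g0 // mulr0.
exact: contM.
Qed.

Lemma norm_row_mx1 n (x : R) (y : 'rV[R]_n) M : 0 <= M ->
  (`|row_mx (const_mx x : 'rV[R]_1) y| <= M) = (`|x| <= M) && (`|y| <= M).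
Proof.
move=> M0; apply/idP/andP => [/(rV_normP _ M0) H|[xM yM]].
  split; first by have := H (lshift n ord0); rewrite row_mxEl mxE.
  by apply/rV_normP => // i; have := H (rshift 1 i); rewrite row_mxEr.
apply/rV_normP => // i; case: (split_ordP i) => j ->.
  by rewrite row_mxEl mxE.
by rewrite row_mxEr; apply: le_trans yM; exact: coord_le_norm.
Qed.

Lemma row_mx1B n (x x' : R) (y y' : 'rV[R]_n) :
  row_mx (const_mx x : 'rV[R]_1) y - row_mx (const_mx x') y' =
  row_mx (const_mx (x - x')) (y - y').
Proof. by rewrite opp_row_mx add_row_mx; congr row_mx; apply/rowP => i; rewrite !mxE. Qed.

Definition slice n (f : 'rV[R]_n.+1 -> R) (x : R) : 'rV[R]_n -> R :=
  fun y => f (row_mx (const_mx x : 'rV[R]_1) y).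

Lemma Cc_slice n (M : R) (f : 'rV[R]_n.+1 -> R) x : 0 <= M -> Cc M f -> Cc M (slice f x).
Proof.
move=> M0 [/continuous_epsP cf f0]; split.
  apply/continuous_epsP => y e e0.
  have [d d0 Hd] := cf (row_mx (const_mx x : 'rV[R]_1) y) e e0.
  exists d => // y' yy'; apply: Hd; rewrite row_mx1B subrr.
  have d20 : 0 <= Num.max 0 `|y - y'| by rewrite le_max lexx.
  apply: (@le_lt_trans _ _ (Num.max 0 `|y - y'|)); last by rewrite gt_max d0.
  by rewrite norm_row_mx1 // normr0 d20 le_max lexx orbT.
move=> y My; apply: f0; rewrite ltNge norm_row_mx1 //.
by rewrite [_ <= M]leNgt [`|y| <= M]leNgt My andbF.
Qed.

Lemma slice0 n (M : R) (f : 'rV[R]_n.+1 -> R) x y : 0 <= M -> Cc M f -> M < `|x| ->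
  slice f x y = 0.
Proof.
move=> M0 [_ f0] Mx; apply: f0; rewrite ltNge norm_row_mx1 //.
by rewrite [`|x| <= M]leNgt Mx.
Qed.

Lemma Cc_itv_integrable (M : R) (F : R -> R) : continuous F ->
  mu.-integrable `[- M, M]%classic (EFin \o F).
Proof.
move=> cF; apply: continuous_compact_integrable; first exact: segment_compact.
exact: continuous_subspaceT.
Qed.

Lemma integral_Cc1 (M : R) (F : R -> R) : continuous F -> (forall x, M < `|x| -> F x = 0) ->
  (\int[mu]_x (F x)%:E)%E = (\int[mu]_(x in `[- M, M]) F x)%:E.
Proof.
move=> cF F0.
have -> : (\int[mu]_x (F x)%:E = \int[mu]_(x in `[(- M)%R, M]) (F x)%:E)%E.
  rewrite [RHS]integral_mkcond; apply: eq_integral => x _; rewrite patchE.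
  case: ifPn => // /negP xM; rewrite F0 // ltNge; apply/negP => xM'.
  by apply: xM; rewrite inE /= in_itv /= -ler_norml.
rewrite /Rintegral fineK //.
have := Cc_itv_integrable M cF => /(@integrable_fin_num _ _ _ _ _).
by apply; exact: measurable_itv.
Qed.

Lemma Rintegral_bound (M B : R) (F : R -> R) : 0 <= M -> continuous F ->
  (forall x, `|F x| <= B) -> `|\int[mu]_(x in `[- M, M]) F x| <= B * (2 * M).
Proof.
move=> M0 cF FB.
have mI : measurable (`[- M, M]%classic : set (measurableTypeR R)) by exact: measurable_itv.
apply: le_trans (le_normr_Rintegral mI (Cc_itv_integrable M cF)) _.
have -> : B * (2 * M) = \int[mu]_(x in `[- M, M]) B.
  have := @lebesgue_measure_itv R `[- M, M]; rewrite /= lte_fin => muE.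
  rewrite Rintegral_cst //; move: muE; rewrite /= => ->.
  case: ifPn => [_|]; first by rewrite /=; congr (_ * _); lra.
  by rewrite -leNgt => MM /=; congr (_ * _); lra.
apply: le_Rintegral => //.
  by apply: Cc_itv_integrable; exact: cont_norm.
by apply: Cc_itv_integrable; exact: cont_cst.
Qed.

(** The bound and the linearity in dimension [n] are hypotheses because the lemma serves inside the
    induction of [rint_props]. By uniform continuity two close slices differ by a uniformly small
    function, to which the bound applies. *)
Lemma rint_slice_continuous_aux n (M : R) (f : 'rV[R]_n.+1 -> R) :
  (forall (B : R) (g : 'rV[R]_n -> R), Cc M g -> (forall x, `|g x| <= B) ->
    `|rint g| <= B * (2 * M) ^+ n) ->
  (forall (a : R) (g h : 'rV[R]_n -> R), Cc M g -> Cc M h ->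
    rint (fun x => a * g x + h x) = a * rint g + rint h) ->
  0 <= M -> Cc M f -> continuous (fun x => rint (slice f x)).
Proof.
move=> IH2 IH3 M0 cf; apply/continuous_epsP => x e e0.
have e'0 : 0 < e / ((2 * M) ^+ n + 1).
  by rewrite divr_gt0 // ltr_wpDl // exprn_ge0 // mulr_ge0.
have [d d0 Hd] := Cc_uniform cf e'0.
exists d => // x' xx'.
have -> : rint (slice f x) - rint (slice f x') =
    rint (fun y => -1 * slice f x' y + slice f x y).
  by rewrite IH3 ?mulN1r 1?addrC //; exact: Cc_slice.
apply: (@le_lt_trans _ _ (e / ((2 * M) ^+ n + 1) * (2 * M) ^+ n)).
  apply: IH2 => //; first by apply: CcD; exact: Cc_slice.
  move=> y; rewrite mulN1r addrC; apply/ltW/Hd; rewrite row_mx1B subrr.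
  rewrite (@le_lt_trans _ _ `|x - x'|) // norm_row_mx1 // lexx normr0 /=.
  by rewrite normr_ge0.
rewrite mulrAC ltr_pdivrMr; last by rewrite ltr_wpDl // exprn_ge0 // mulr_ge0.
by rewrite mulrDr mulr1 ltrDl.
Qed.

(** The three facts need one induction: finiteness in dimension n + 1 uses continuity of the
    integrals of the slices, which rests on the bound and the linearity in dimension n. *)
Lemma rint_props n : [/\
  forall (M : R) (f : 'rV[R]_n -> R), 0 <= M -> Cc M f ->
    intn (fun x => (f x)%:E) = (rint f)%:E,
  forall (M B : R) (f : 'rV[R]_n -> R), 0 <= M -> Cc M f -> (forall x, `|f x| <= B) ->
    `|rint f| <= B * (2 * M) ^+ n &
  forall (M a : R) (f g : 'rV[R]_n -> R), 0 <= M -> Cc M f -> Cc M g ->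
    rint (fun x => a * f x + g x) = a * rint f + rint g].
Proof.
elim: n => [|n [IH1 IH2 IH3]].
  by split => //= M B f M0 _ fB; rewrite expr0 mulr1 /rint /=.
have sliceint (M : R) (f : 'rV[R]_n.+1 -> R) : 0 <= M -> Cc M f ->
    intn (fun x => (f x)%:E) = (\int[mu]_x (rint (slice f x))%:E)%E.
  move=> M0 cf /=; apply: eq_integral => x _.
  by rewrite -(IH1 M) //; exact: Cc_slice.
have cont (M : R) (f : 'rV[R]_n.+1 -> R) : 0 <= M -> Cc M f ->
    continuous (fun x => rint (slice f x)).
  by move=> M0; apply: rint_slice_continuous_aux => // *; [exact: IH2|exact: (IH3 M)].
have zero (M : R) (f : 'rV[R]_n.+1 -> R) : 0 <= M -> Cc M f ->
    forall x, M < `|x| -> rint (slice f x) = 0.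
  move=> M0 cf x Mx; apply/normr0_eq0/eqP; rewrite eq_le normr_ge0 andbT.
  rewrite -(mul0r ((2 * M) ^+ n)); apply: IH2 => //; first exact: Cc_slice.
  by move=> y; rewrite (slice0 y M0 cf Mx) normr0.
have E (M : R) (f : 'rV[R]_n.+1 -> R) : 0 <= M -> Cc M f ->
    intn (fun x => (f x)%:E) = (\int[mu]_(x in `[- M, M]) rint (slice f x))%:E.
  by move=> M0 cf; rewrite (sliceint M) // (integral_Cc1 (cont _ _ M0 cf) (zero _ _ M0 cf)).
have E' (M : R) (f : 'rV[R]_n.+1 -> R) : 0 <= M -> Cc M f ->
    rint f = \int[mu]_(x in `[- M, M]) rint (slice f x).
  by move=> M0 cf; rewrite {1}/rint (E M).
split.
- by move=> M f M0 cf; rewrite (E M) // (E' M).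
- move=> M B f M0 cf fB; rewrite (E' M) // exprSr mulrA; apply: Rintegral_bound => //.
    exact: cont cf.
  by move=> x; apply: IH2 => //; [exact: Cc_slice|move=> y; exact: fB].
- move=> M a f g M0 cf cg; rewrite (E' M) //; last exact: CcD.
  rewrite (E' M f) // (E' M g) //.
  have mI : measurable (`[- M, M]%classic : set (measurableTypeR R)) by exact: measurable_itv.
  have if_ := Cc_itv_integrable M (cont M f M0 cf).
  have ig := Cc_itv_integrable M (cont M g M0 cg).
  rewrite -RintegralZl // -RintegralD //.
    apply: eq_Rintegral => x _; rewrite -(IH3 M) //; exact: Cc_slice.
  by apply: Cc_itv_integrable; apply: contZ; exact: cont cf.
Qed.

Lemma intn_rint n (M : R) (f : 'rV[R]_n -> R) : 0 <= M -> Cc M f ->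
  intn (fun x => (f x)%:E) = (rint f)%:E.
Proof. by have [H _ _] := rint_props n; exact: H. Qed.

Lemma rint_bound n (M B : R)  (f : 'rV[R]_n -> R) : 0 <= M -> Cc M f ->
  (forall x, `|f x| <= B) -> `|rint f| <= B * (2 * M) ^+ n.
Proof. by have [_ H _] := rint_props n; exact: H. Qed.

Lemma rintD n (M a : R)  (f g : 'rV[R]_n -> R) : 0 <= M -> Cc M f -> Cc M g ->
  rint (fun x => a * f x + g x) = a * rint f + rint g.
Proof. by have [_ _ H] := rint_props n; exact: H. Qed.

Lemma rint_ext n (f g : 'rV[R]_n -> R) : f =1 g -> rint f = rint g.
Proof. by move=> /funext ->. Qed.

Lemma rint0 n : rint (fun _ : 'rV[R]_n => 0) = 0.
Proof.
have c0 : Cc 0 (fun _ : 'rV[R]_n => 0 : R) by split => //; exact: cont_cst.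
apply/normr0_eq0/eqP; rewrite eq_le normr_ge0 andbT.
by rewrite (le_trans (rint_bound (B := 0) _ c0 _)) ?mul0r // => x; rewrite normr0.
Qed.

Lemma rintZ n (M a : R)  (f : 'rV[R]_n -> R) : 0 <= M -> Cc M f ->
  rint (fun x => a * f x) = a * rint f.
Proof.
move=> M0 cf; have c0 : Cc M (fun _ : 'rV[R]_n => 0 : R) by split => //; exact: cont_cst.
have := rintD a M0 cf c0; rewrite rint0 addr0 => <-.
by apply: rint_ext => x; rewrite addr0.
Qed.

Lemma rint_sum n (M : R) (I : Type) (s : seq I) (a : I -> R) (f : I -> 'rV[R]_n -> R) :
  0 <= M -> (forall i, Cc M (f i)) ->
  Cc M (fun x => \sum_(i <- s) a i * f i x) /\
  rint (fun x => \sum_(i <- s) a i * f i x) = \sum_(i <- s) a i * rint (f i).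
Proof.
move=> M0 cf; elim: s => [|i s [IH1 IH2]].
  have -> : (fun x => \sum_(i <- [::]) a i * f i x) = (fun=> 0).
    by apply/funext => x; rewrite big_nil.
  by rewrite rint0 big_nil; split => //; split => //; exact: cont_cst.
have -> : (fun x => \sum_(j <- i :: s) a j * f j x) =
          (fun x => a i * f i x + \sum_(j <- s) a j * f j x).
  by apply/funext => x; rewrite big_cons.
split; first exact: CcD.
by rewrite (rintD _ M0) // IH2 big_cons.
Qed.

End Integral.

(** * Affine changes of variables, boxes and monotonicity *)

Section Integral2.
Variable R : realType.
Notation mu := (@lebesgue_measure R).

Lemma integral_itv_support (p q : R) (F : R -> R) :
  (forall x, ~~ (p <= x <= q) -> F x = 0) ->
  (\int[mu]_x (F x)%:E)%E = (\int[mu]_(x in `[p, q]) (F x)%:E)%E.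
Proof.
move=> F0; rewrite [RHS]integral_mkcond; apply: eq_integral => x _; rewrite patchE.
case: ifPn => // /negP xM; rewrite F0 //; apply/negP => xM'.
by apply: xM; rewrite inE /= in_itv.
Qed.

Lemma integral_affine1 (M a b : R) (F : R -> R) : 0 <= M -> 0 < a -> continuous F ->
  (forall x, M < `|x| -> F x = 0) ->
  (\int[mu]_x (F (a * x - b) * a)%:E)%E = (\int[mu]_x (F x)%:E)%E.
Proof.
move=> M0 a0 cF F0.
pose G x : R := a * x - b.
have dG (x : R) : is_derive x (1 : R) G a.
  have -> : G = a \*: (@id R) - cst b by [].
  by apply: is_derive_eq; rewrite subr0 /GRing.scale /= mulr1.
have cG : continuous G.
  by rewrite /G; apply: contB; [apply: contZ => x; exact: cvg_id|exact: cont_cst].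
have dGE : (G^`())%classic = (fun=> a).
  by apply/funext => x; rewrite derive1E; exact: derive_val.
(* The preimages of -M and M: outside [p, q] the substituted integrand vanishes, so the substitution
   takes place on a segment. *)
set p := (- M + b) / a; set q := (M + b) / a.
have Gp : G p = - M by rewrite /G /p mulrC divfK ?gt_eqF // addrK.
have Gq : G q = M by rewrite /G /q mulrC divfK ?gt_eqF // addrK.
have GM x : ~~ (p <= x <= q) -> F (G x) = 0.
  move=> xpq; apply: F0; rewrite ltNge; apply: contra xpq; rewrite ler_norml.
  move=> /andP[h1 h2]; rewrite /p /q ler_pdivrMr // ler_pdivlMr //.
  by move: h1 h2; rewrite /G mulrC => h1 h2; apply/andP; split; lra.
have FM x : ~~ (G p <= x <= G q) -> F x = 0.
  by rewrite Gp Gq -ler_norml -ltNge; exact: F0.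
rewrite (integral_itv_support FM).
rewrite (@integral_itv_support p q); last by move=> x /GM xpq; rewrite xpq mul0r.
have pq : p <= q by rewrite /p /q ler_pM2r ?invr_gt0 //; lra.
rewrite (@integration_by_substitution_increasing R G F p q pq).
- by apply: eq_integral => x _; rewrite dGE.
- by move=> x y _ _ xy; rewrite /G ltrD2r ltr_pM2l.
- by rewrite dGE => x _; exact: cont_cst.
- by rewrite dGE; apply: is_cvg_cst.
- by rewrite dGE; apply: is_cvg_cst.
- split; first by move=> x _; exact: ex_derive.
    by apply: cvg_at_right_filter; exact: cG.
  by apply: cvg_at_left_filter; exact: cG.
- exact: continuous_subspaceT.
Qed.

Lemma row_mx1S n (a x : R) (b y : 'rV[R]_n) (b0 : R) :
  a *: row_mx (const_mx x : 'rV[R]_1) y - row_mx (const_mx b0) b =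
  row_mx (const_mx (a * x - b0)) (a *: y - b).
Proof.
rewrite scale_row_mx opp_row_mx add_row_mx; congr row_mx.
by apply/rowP => i; rewrite !mxE.
Qed.

Lemma row_mx1_ex n (b : 'rV[R]_n.+1) :
  exists b0 b', b = row_mx (const_mx b0 : 'rV[R]_1) b'.
Proof.
exists (b ord0 ord0), (rsubmx (b : 'rV[R]_(1 + n))).
have <- : lsubmx (b : 'rV[R]_(1 + n)) = const_mx (b ord0 ord0).
  by apply/rowP => i; rewrite !mxE; congr (b _ _); apply/val_inj => /=; rewrite ord1.
by rewrite (@hsubmxK _ 1 1 n).
Qed.

Lemma Cc_affine n (M a : R) (b : 'rV[R]_n) (f : 'rV[R]_n -> R) : 0 <= M -> 0 < a ->
  Cc M f -> Cc ((M + `|b|) / a) (fun x => f (a *: x - b)).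
Proof.
move=> M0 a0 [cf f0]; split.
  exact: cont_affine.
move=> x; rewrite ltr_pdivrMr // => Mx; apply: f0.
have : `|a *: x| <= `|a *: x - b| + `|b|.
  by rewrite -{1}(subrK b (a *: x)) ler_normD.
rewrite normrZ (gtr0_norm a0) => h; move: Mx; rewrite mulrC; lra.
Qed.

Lemma rint_affine n (M a : R) (b : 'rV[R]_n) (f : 'rV[R]_n -> R) : 0 <= M -> 0 < a ->
  Cc M f -> rint (fun x => f (a *: x - b)) = a ^- n * rint f.
Proof.
move=> M0 a0; elim: n b f => [|n IH] b f cf.
  by rewrite expr0 invr1 mul1r; congr rint; apply/funext => x; congr f; apply/rowP => -[].
have [b0 [b' bE]] := row_mx1_ex b.
have M'0 : 0 <= (M + `|b|) / a by rewrite divr_ge0 ?addr_ge0 // ltW.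
have E m (N : R) (g : 'rV[R]_m.+1 -> R) : 0 <= N -> Cc N g ->
    (rint g)%:E = (\int[mu]_x (rint (slice g x))%:E)%E.
  move=> N0 cg; rewrite -(intn_rint N0 cg) /=; apply: eq_integral => x _.
  by rewrite -(intn_rint N0) //; exact: Cc_slice.
have cont N (g : 'rV[R]_n.+1 -> R) : 0 <= N -> Cc N g ->
    continuous (fun x => rint (slice g x)) /\
    forall x, N < `|x| -> rint (slice g x) = 0.
  move=> N0 cg; split; last first.
    move=> x Nx; rewrite (@rint_ext _ _ _ (fun=> 0)) ?rint0 // => y.
    exact: slice0 cg Nx.
  by apply: rint_slice_continuous_aux cg => // *; [exact: rint_bound|exact: (rintD _ N0)].
have [cF F0] := cont _ _ M0 cf.
apply: EFin_inj; rewrite (E _ _ _ M'0 (Cc_affine b M0 a0 cf)).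
(* One factor [a] is split off a^-n to act as the derivative in the one-dimensional substitution. *)
have -> : (\int[mu]_x (rint (slice (fun x => f (a *: x - b)) x))%:E =
  \int[mu]_x (a ^- n.+1 * rint (slice f (a * x - b0)) * a)%:E)%E.
  apply: eq_integral => x _; congr EFin.
  rewrite (@rint_ext _ _ _ (fun y => slice f (a * x - b0) (a *: y - b'))).
    rewrite IH; last exact: Cc_slice.
    rewrite exprSr invfM; field; by rewrite expf_neq0 gt_eqF // gt_eqF.
  by move=> y; rewrite /slice bE row_mx1S.
rewrite (@integral_affine1 M a b0 (fun y => a ^- n.+1 * rint (slice f y))) //.
- rewrite EFinM (E _ _ _ M0 cf).
  have intF : mu.-integrable setT (EFin \o (fun x => rint (slice f x))).
    have := Cc_itv_integrable M cF => /integrable_mkcond.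
    move=> /(_ (measurable_itv _)).
    congr (mu.-integrable _ _); apply/funext => x; rewrite patchE.
    case: ifPn => // /negP xM; rewrite /= F0 // ltNge; apply/negP => xM'.
    by apply: xM; rewrite inE /= in_itv /= -ler_norml.
  by rewrite -integralZl.
- exact: contZ.
- by move=> x Mx; rewrite F0 // mulr0.
Qed.

(** No measurability is assumed, since the slices of arbitrary sets in [lebn] and [lebh] may lack
    it: a nonnegative integral is a supremum over simple functions below the integrand. *)
Lemma integral_mono d (T : measurableType d) (m : {measure set T -> \bar R})
  (f g : T -> \bar R) :
  (forall x, 0 <= f x)%E -> (forall x, f x <= g x)%E ->
  (\int[m]_x f x <= \int[m]_x g x)%E.
Proof.
move=> f0 fg; rewrite !ge0_integralTE //; last by move=> x; exact: le_trans (fg x).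
apply: le_ereal_sup => _ [h hf <-] /=.
by exists h => // x; exact: le_trans (fg x).
Qed.

Lemma intn_ge0 n (f : 'rV[R]_n -> \bar R) : (forall x, 0 <= f x)%E -> (0 <= intn f)%E.
Proof.
elim: n f => [|n IH] f f0 /=; first exact: f0.
by apply: integral_ge0 => x _; apply: IH.
Qed.

Lemma intn_mono n (f g : 'rV[R]_n -> \bar R) :
  (forall x, 0 <= f x)%E -> (forall x, f x <= g x)%E -> (intn f <= intn g)%E.
Proof.
elim: n f g => [|n IH] f g f0 fg /=; first exact: fg.
apply: integral_mono => x; first by apply: intn_ge0.
by apply: IH.
Qed.

Lemma row_mx1_0 n (x : R) (y : 'rV[R]_n) :
  (row_mx (const_mx x : 'rV[R]_1) y : 'rV[R]_n.+1) ord0 ord0 = x.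
Proof.
have -> : (ord0 : 'I_n.+1) = lshift n (ord0 : 'I_1) by apply/val_inj.
by rewrite (@row_mxEl _ 1 1 n) mxE.
Qed.

Lemma row_mx1_S n (x : R) (y : 'rV[R]_n) i :
  (row_mx (const_mx x : 'rV[R]_1) y : 'rV[R]_n.+1) ord0 (lift ord0 i) = y ord0 i.
Proof.
have -> : lift ord0 i = rshift 1 i by apply/val_inj.
by rewrite (@row_mxEr _ 1 1 n).
Qed.

Definition box n (a b : 'rV[R]_n) : set 'rV[R]_n :=
  [set x | forall i, a ord0 i <= x ord0 i < b ord0 i].

Lemma integral_indic_itv (k a b : R) : a <= b ->
  (\int[mu]_x (k * (a <= x < b)%R%:R)%:E)%E = (k * (b - a))%:E.
Proof.
move=> ab; have -> : (\int[mu]_x (k * (a <= x < b)%R%:R)%:E =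
    \int[mu]_(x in `[a, b[) k%:E)%E.
  rewrite [RHS]integral_mkcond; apply: eq_integral => x _; rewrite patchE.
  rewrite (_ : (x \in _) = (a <= x < b)); last first.
    by apply/idP/idP; rewrite inE /= in_itv.
  by case: ifPn => _; rewrite ?mulr1 ?mulr0.
rewrite integral_cst; last exact: measurable_itv.
have := @lebesgue_measure_itv R `[a, b[; rewrite /= lte_fin => ->.
case: ifPn => [_|]; first by rewrite -EFinM.
by rewrite -leNgt => ba; rewrite mule0 (_ : b - a = 0) ?mulr0 //; lra.
Qed.

(** The factor [c] makes the induction go through: the indicator of the first side becomes part of
    the factor of the slice. *)
Lemma intn_box n (c : R) (a b : 'rV[R]_n) : (forall i, a ord0 i <= b ord0 i) ->
  intn (fun x => (c * \1_(box a b) x)%:E) = (c * \prod_i (b ord0 i - a ord0 i))%:E.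
Proof.
elim: n c a b => [|n IH] c a b ab.
  rewrite /= big_ord0; congr ((_ * _)%:E); rewrite indicE mem_set // => -[].
  by [].
have [a0 [a' aE]] := row_mx1_ex a; have [b0 [b' bE]] := row_mx1_ex b.
have ab0 : a0 <= b0 by have := ab ord0; rewrite aE bE !row_mx1_0.
have ab' i : a' ord0 i <= b' ord0 i.
  by have := ab (lift ord0 i); rewrite aE bE !row_mx1_S.
have E x y : \1_(box a b) (row_mx (const_mx x : 'rV[R]_1) y) =
    (a0 <= x < b0)%R%:R * \1_(box a' b') y :> R.
  rewrite !indicE -natrM mulnb; congr (_%:R); congr nat_of_bool.
  apply/idP/andP.
    rewrite !inE /= => H; split.
      by have := H ord0; rewrite aE bE !row_mx1_0.
    by move=> i; have := H (lift ord0 i); rewrite aE bE !row_mx1_S.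
  rewrite !inE => -[H0 H] i; case: (unliftP ord0 i) => [j|] ->.
    by rewrite aE bE !row_mx1_S.
  by rewrite aE bE !row_mx1_0.
rewrite /=; under eq_integral => x _.
  under eq_fun => y do rewrite E mulrA.
  rewrite IH //; over.
have -> : \prod_i (b ord0 i - a ord0 i) = (b0 - a0) * \prod_i (b' ord0 i - a' ord0 i).
  rewrite big_ord_recl; congr (_ * _).
    by rewrite aE bE !row_mx1_0.
  by apply: eq_bigr => i _; rewrite aE bE !row_mx1_S.
rewrite [in RHS]mulrA mulrAC -integral_indic_itv //.
by apply: eq_integral => x _; rewrite mulrAC.
Qed.

Lemma lebn_ge_box n (A : set 'rV[R]_n) (a b : 'rV[R]_n) :
  (forall i, a ord0 i <= b ord0 i) -> box a b `<=` A ->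
  ((\prod_i (b ord0 i - a ord0 i))%:E <= lebn A)%E.
Proof.
move=> ab sub; rewrite -[X in X%:E]mul1r -intn_box //.
apply: intn_mono => x; rewrite mul1r lee_fin !indicE // ler_nat.
by case: (boolP (x \in box a b)) => //; rewrite inE => /sub /mem_set ->.
Qed.

Lemma lebn_le_box n (A : set 'rV[R]_n) (a b : 'rV[R]_n) :
  (forall i, a ord0 i <= b ord0 i) -> A `<=` box a b ->
  (lebn A <= (\prod_i (b ord0 i - a ord0 i))%:E)%E.
Proof.
move=> ab sub; rewrite -[X in (_ <= X%:E)%E]mul1r -intn_box //.
apply: intn_mono => x; rewrite ?mul1r lee_fin !indicE // ler_nat.
by case: (boolP (x \in A)) => //; rewrite inE => /sub /mem_set ->.
Qed.

End Integral2.

(** * Symmetric differences and Kemperman's identity *)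

Section Differences.
Variables (R : realType) (n : nat).
Local Notation V := 'rV[R]_n.
Implicit Types (f g : V -> R) (x h : V).

Lemma diffkSr r h f x :
  diffk r.+1 h f x = diffk r h f (x + 2^-1 *: h) - diffk r h f (x - 2^-1 *: h).
Proof. by elim: r f x => [|r IH] f x //; exact: (IH (diff1 h f) x). Qed.

(** Pascal's rule, summed by parts on an abstract sequence so that the nodes of the differences stay
    out of the calculation. *)
Lemma binomial_diff r (G : nat -> R) :
  \sum_(i < r.+1) (-1) ^+ (r - i) * 'C(r, i)%:R * (G i.+1 - G i) =
  \sum_(i < r.+2) (-1) ^+ (r.+1 - i) * 'C(r.+1, i)%:R * G i.
Proof.
rewrite [RHS]big_ord_recl /= bin0 mulr1 subn0.
under [X in _ = _ + X]eq_bigr => i _ do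
  rewrite /= /bump /= add1n subSS binS natrD mulrDr mulrDl.
under eq_bigr do rewrite mulrBr; rewrite sumrB.
rewrite big_split /= [X in _ = _ + X]addrC addrCA; congr (_ + _).
rewrite [in RHS]big_ord_recr /= bin_small // mulr0 mul0r addr0.
rewrite [in LHS]big_ord_recl /= bin0 mulr1 subn0 opprD exprS mulN1r mulNr; congr (_ + _).
rewrite -sumrN; apply: eq_bigr => i _; rewrite /bump /= add1n -mulNr -mulNr.
by rewrite -[(r - i)%N]prednK ?subn_gt0 // -subnS exprS mulN1r.
Qed.

Lemma diffkE r h f x : diffk r h f x =
  \sum_(i < r.+1) (-1) ^+ (r - i) * 'C(r, i)%:R * f (x + (i%:R - r%:R / 2) *: h).
Proof.
elim: r f => [|r IH] f.
  by rewrite big_ord_recl big_ord0 /= bin0 subnn expr0 !mul1r mul0r subr0 scale0r !addr0.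
rewrite /= IH -(binomial_diff r (fun i => f (x + (i%:R - r.+1%:R / 2) *: h))).
apply: eq_bigr => i _; congr (_ * (f _ - f _)).
  by rewrite -addrA -scalerDl; congr (_ + _ *: _); rewrite -!natr1; field.
by rewrite -addrA -scalerBl; congr (_ + _ *: _); rewrite -natr1; field.
Qed.

Lemma diffkB r h f g x :
  diffk r h (fun x => f x - g x) x = diffk r h f x - diffk r h g x.
Proof. by rewrite !diffkE -sumrB; apply: eq_bigr => i _; rewrite mulrBr. Qed.

Lemma diffk_affine r (a : R) (b : V) h f x :
  diffk r h (fun x => f (a *: x + b)) x = diffk r (a *: h) f (a *: x + b).
Proof.
rewrite !diffkE; apply: eq_bigr => i _; congr (_ * f _).
by rewrite scalerDr addrAC; congr (_ + _ + _); rewrite !scalerA mulrC.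
Qed.

Lemma diffk_cont r h f : continuous f -> continuous (diffk r h f).
Proof.
elim: r f => [|r IH] f cf //=; apply: IH; apply: contB.
  have := @cont_affine R _ f 1 (2^-1 *: h) cf.
  by under eq_fun do rewrite scale1r.
have := @cont_affine R _ f 1 (- (2^-1 *: h)) cf.
by under eq_fun do rewrite scale1r.
Qed.

Lemma diffk_add_bound r m h f (B : R) : (forall x, `|diffk r h f x| <= B) ->
  forall x, `|diffk (m + r) h f x| <= 2 ^+ m * B.
Proof.
move=> H; elim: m => [|m IH] x; first by rewrite expr0 mul1r.
rewrite addSn diffkSr (le_trans (ler_normB _ _)) //.
by rewrite exprS -mulrA mulr_natl mulr2n lerD.
Qed.

Lemma diffk_le_bound r h f (B : R) : (forall x, `|f x| <= B) ->
  forall x, `|diffk r h f x| <= 2 ^+ r * B.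
Proof. by move=> H x; have := @diffk_add_bound 0 r h f B H x; rewrite addn0. Qed.

(** Toggling the membership of [i] is an involution that flips the sign and preserves [F], so the
    sum equals its own negative. *)
Lemma sum_setsgn_eq0 r (i : 'I_r) (F : {set 'I_r} -> R) :
  (forall S, F (i |: S) = F (S :\ i)) -> \sum_(S : {set 'I_r}) (-1) ^+ #|S| * F S = 0.
Proof.
move=> HF; pose t (S : {set 'I_r}) := if i \in S then S :\ i else i |: S.
have tK : involutive t.
  move=> S; rewrite /t; case: (boolP (i \in S)) => iS.
    by rewrite !inE eqxx /= finset.setD1K.
  by rewrite !inE eqxx /= finset.setU1K.
have : \sum_(S : {set 'I_r}) (-1) ^+ #|S| * F S =
       - \sum_(S : {set 'I_r}) (-1) ^+ #|S| * F S.
  rewrite {1}(reindex_inj (inv_inj tK)) -sumrN; apply: eq_bigr => S _ /=.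
  rewrite -mulNr /t; case: (boolP (i \in S)) => iS.
    rewrite -HF (_ : i |: S = S); last by apply/finset.setUidPr; rewrite finset.sub1set.
    rewrite [X in _ = - _ ^+ X * _](cardsD1 i) iS add1n exprS.
    by rewrite mulN1r opprK.
  rewrite HF cardsU1 iS add1n exprS mulN1r (_ : S :\ i = S) //.
  by apply/finset.setP => k; rewrite !inE; case: eqP => // ->; rewrite (negbTE iS).
by move/eqP; rewrite -addr_eq0 -mulr2n mulrn_eq0 /= => /eqP.
Qed.

(* Kemperman's identity: mixed differences of order r are combinations of pure
   ones, because the k-th terms cancel in pairs S, S :|: {k - 1}. *)
Lemma kemperman r (v : 'I_r -> V) f (y : V) :
  (-1) ^+ r * \sum_(S : {set 'I_r}) (-1) ^+ #|S| * f (y + \sum_(i in S) v i) =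
  \sum_(S : {set 'I_r}) (-1) ^+ #|S| *
    (let h := - \sum_(i in S) i.+1%:R^-1 *: v i in
     diffk r h f (y + \sum_(i in S) v i + (r%:R / 2) *: h)).
Proof.
(* The centre of each pure difference is chosen so that its k-th node is y plus the sum of (1 -
   k/(i+1)) v_i over S; the term k = 0 is then the mixed difference. *)
transitivity (\sum_(k < r.+1) \sum_(S : {set 'I_r}) (-1) ^+ #|S| *
   ((-1) ^+ (r - k) * 'C(r, k)%:R *
    f (y + \sum_(i in S) (1 - k%:R / i.+1%:R) *: v i))); last first.
  rewrite exchange_big /=; apply: eq_bigr => S _; rewrite diffkE mulr_sumr.
  apply: eq_bigr => k _; congr (_ * (_ * f _)).
  rewrite -addrA -scalerDl subrKC scalerN scaler_sumr -addrA; congr (_ + _).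
  rewrite -sumrN -big_split /=.
  by apply: eq_bigr => i _; rewrite scalerBl scale1r scalerA.
rewrite big_ord_recl [X in _ = _ + X]big1 ?addr0; last first.
  move=> k _; apply: (sum_setsgn_eq0 (i := k)) => S; congr (_ * f (y + _)).
  rewrite [LHS]big_mkcond [RHS]big_mkcond; apply: eq_bigr => i _ /=.
  rewrite !inE /bump /= add1n; case: eqP => [->|] //=.
  by rewrite divff ?pnatr_eq0 // subrr scale0r.
rewrite mulr_sumr; apply: eq_bigr => S _ /=; rewrite subn0 bin0 mulr1 mulrCA.
congr (_ * (_ * f (y + _))); apply: eq_bigr => i _.
by rewrite mul0r subr0 scale1r.
Qed.

(** The identity is solved for the term of the full set: the right-hand side has 2^r differences
    bounded by [D], and the other terms on the left are values at proper subsets, bounded by [B]. *)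
Lemma kemperman_bound r (v : 'I_r -> V) f (y : V) (D B : R) : 0 <= B ->
  (forall S : {set 'I_r}, let h := - \sum_(i in S) i.+1%:R^-1 *: v i in
     `|diffk r h f (y + \sum_(i in S) v i + (r%:R / 2) *: h)| <= D) ->
  (forall S : {set 'I_r}, (#|S| < r)%N -> `|f (y + \sum_(i in S) v i)| <= B) ->
  `|f (y + \sum_i v i)| <= 2 ^+ r * (D + B).
Proof.
move=> B0 HD HB.
have cardP : #|{set 'I_r}| = (2 ^ r)%N by rewrite -cardsT -powersetT card_powerset cardsT card_ord.
have := kemperman v f y; rewrite (bigD1 (finset.setTfor 'I_r)) //= => /eqP.
rewrite mulrDr eq_sym -subr_eq => /eqP /esym.
have -> : \sum_(i in (finset.setTfor 'I_r)) v i = \sum_i v i by apply: eq_bigl => i; rewrite inE.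
move=> /(congr1 Num.norm); rewrite !normrM !normrX !normrN1 !expr1n !mul1r => ->.
rewrite (le_trans (ler_normB _ _)) // mulrDr lerD //.
  rewrite (le_trans (ler_norm_sum _ _ _)) //.
  rewrite (@le_trans _ _ (\sum_(S : {set 'I_r}) D)) //.
    by apply: ler_sum => S _; rewrite normrM normrX normrN1 expr1n mul1r; exact: HD.
  by rewrite sumr_const cardP -[D *+ _]mulr_natl natrX.
rewrite normrM normrX normrN1 expr1n mul1r (le_trans (ler_norm_sum _ _ _)) //.
rewrite (@le_trans _ _ (\sum_(S : {set 'I_r}) B)) //; last first.
  by rewrite sumr_const cardP -[B *+ _]mulr_natl natrX.
rewrite [leLHS]big_mkcond; apply: ler_sum => S _; case: ifPn => // ST.
rewrite normrM normrX normrN1 expr1n mul1r HB // -[ltnRHS]card_ord -cardsT.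
by apply: proper_card; rewrite properT.
Qed.

End Differences.

(** * Polynomials and Lagrange interpolation on the simplex lattice *)

Section Interpolation.
Variables (R : realType) (n : nat).
Local Notation V := 'rV[R]_n.

(* The index bounds the degree strictly. *)
Inductive polyfun : nat -> (V -> R) -> Prop :=
| polyfun0 d : polyfun d (fun=> 0)
| polyfunC d c : polyfun d.+1 (fun=> c)
| polyfunD d p q : polyfun d p -> polyfun d q -> polyfun d (fun x => p x + q x)
| polyfunX d i p : polyfun d p -> polyfun d.+1 (fun x => x ord0 i * p x).

Lemma polyfun_ext d (p q : V -> R) : p =1 q -> polyfun d p -> polyfun d q.
Proof. by move=> /funext ->. Qed.

Lemma polyfun_le d d' p : (d <= d')%N -> polyfun d p -> polyfun d' p.
Proof.
move=> + pd; elim: pd d' => {d p}.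
- by move=> *; exact: polyfun0.
- by move=> d c [//|d'] _; exact: polyfunC.
- by move=> d p q _ IHp _ IHq d' dd'; apply: polyfunD; [exact: IHp|exact: IHq].
- by move=> d i p _ IHp [//|d'] dd'; apply: polyfunX; exact: IHp.
Qed.

Lemma polyfunZ d (a : R) p : polyfun d p -> polyfun d (fun x => a * p x).
Proof.
elim=> {d p}.
- by move=> d; apply: polyfun_ext (polyfun0 d) => x; rewrite mulr0.
- by move=> *; exact: polyfunC.
- move=> d p q _ IHp _ IHq; apply: polyfun_ext (polyfunD IHp IHq) => x.
  by rewrite mulrDr.
- by move=> d i p _ IHp; apply: polyfun_ext (polyfunX i IHp) => x; rewrite mulrCA.
Qed.

Lemma polyfun_sum d (I : Type) (s : seq I) (P : pred I) (p : I -> V -> R) :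
  (forall i, polyfun d (p i)) -> polyfun d (fun x => \sum_(i <- s | P i) p i x).
Proof.
move=> dp; elim: s => [|i s IH].
  by apply: polyfun_ext (polyfun0 d) => x; rewrite big_nil.
case: (boolP (P i)) => Pi.
  by apply: polyfun_ext (polyfunD (dp i) IH) => x; rewrite big_cons Pi.
by apply: polyfun_ext IH => x; rewrite big_cons (negbTE Pi).
Qed.

Lemma polyfun_affine d (v : 'I_n -> R) (c : R) p : polyfun d p ->
  polyfun d.+1 (fun x => (c + \sum_i v i * x ord0 i) * p x).
Proof.
move=> pd; have pd1 := polyfun_le (leqnSn d) pd.
have H i : polyfun d.+1 (fun x => v i * (x ord0 i * p x)).
  exact: polyfunZ (polyfunX i pd).
apply: polyfun_ext (polyfunD (polyfunZ c pd1)
  (polyfun_sum (index_enum 'I_n) xpredT H)) => x /=.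
by rewrite mulrDl mulr_suml; congr (_ + _); apply: eq_bigr => i _; rewrite mulrA.
Qed.

Lemma polyfun_comp d (a : R) (b : V) p : polyfun d p ->
  polyfun d (fun x => p (a *: x + b)).
Proof.
elim=> {d p}.
- by move=> d; exact: polyfun0.
- by move=> *; exact: polyfunC.
- by move=> d p q _ IHp _ IHq; exact: polyfunD.
- move=> d i p _ IHp.
  apply: polyfun_ext (polyfunD (polyfunZ a (polyfunX i IHp))
    (polyfun_le (leqnSn d) (polyfunZ (b ord0 i) IHp))) => x.
  by rewrite !mxE mulrA mulrDl.
Qed.

Lemma polyfun0_eq p : polyfun 0 p -> p = fun=> 0.
Proof.
suff H d : polyfun d p -> d = 0%N -> p = fun=> 0 by move=> /H; exact.
elim=> {d p} //.
move=> d p q _ IHp _ IHq d0; apply/funext => x.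
by rewrite IHp // IHq // addr0.
Qed.

Lemma polyfun_diff d (h h' : V) p : polyfun d p ->
  polyfun d.-1 (fun x => p (x + h) - p (x + h')).
Proof.
have sh e (k : V) q : polyfun e q -> polyfun e (fun x => q (x + k)).
  move=> eq; apply: polyfun_ext (@polyfun_comp e 1 k q eq) => x.
  by rewrite scale1r.
elim=> {d p}.
- by move=> d; apply: polyfun_ext (polyfun0 _) => x; rewrite subr0.
- by move=> d c; apply: polyfun_ext (polyfun0 _) => x; rewrite subrr.
- move=> d p q _ IHp _ IHq; apply: polyfun_ext (polyfunD IHp IHq) => x.
  by rewrite opprD addrACA.
- move=> [|d] i p pd IHp.
    by rewrite (polyfun0_eq pd); apply: polyfun_ext (polyfun0 _) => x; rewrite !mulr0 subr0.
  apply: polyfun_ext (polyfunD (polyfunX i IHp)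
    (polyfunD (polyfunZ (h ord0 i) (sh _ h _ pd)) (polyfunZ (- h' ord0 i) (sh _ h' _ pd)))) => x.
  by rewrite !mxE; ring.
Qed.

Lemma polyfun_diffk d r (h : V) p : polyfun d p -> polyfun (d - r) (diffk r h p).
Proof.
elim: r d p => [|r IH] d p pd; first by rewrite subn0.
by rewrite subnS predn_sub; apply: IH; exact: polyfun_diff.
Qed.

Lemma diffk_polyfun r (h x : V) p : polyfun r p -> diffk r h p x = 0.
Proof. by move=> /(polyfun_diffk r h); rewrite subnn => /polyfun0_eq ->. Qed.

(** On a line the function is a univariate polynomial, so infinitely many zeros make it vanish
    there. *)
Lemma polyfun_line d p (x : V) i : polyfun d p ->
  exists P : {poly R}, forall t, p (x + t *: ebasis R i) = P.[t].
Proof.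
elim=> {d p}.
- by move=> d; exists 0 => t; rewrite horner0.
- by move=> d c; exists c%:P => t; rewrite hornerC.
- by move=> d p q _ [P HP] _ [Q HQ]; exists (P + Q) => t; rewrite hornerD HP HQ.
- move=> d j p _ [P HP].
  exists (((x ord0 j)%:P + (i == j)%:R *: 'X) * P) => t.
  by rewrite hornerM hornerD hornerC hornerZ hornerX HP !mxE [t * _]mulrC.
Qed.

Lemma polyfun_cont d p : polyfun d p -> continuous p.
Proof.
elim=> {d p}.
- by move=> d; exact: cont_cst.
- by move=> d c; exact: cont_cst.
- by move=> d p q _ cp _ cq; exact: contD.
- by move=> d i p _ cp; apply: contM => //; exact: coord_continuous.
Qed.

Definition natv (b : 'I_n -> nat) : V := \row_i (b i)%:R.

(** Writing a lattice point as a word in the basis vectors lets an induction split off [r] letters,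
    the input of Kemperman's identity. *)
Definition wordv (s : seq 'I_n) : V := \sum_(i <- s) ebasis R i.

Lemma wordv_count s : wordv s = natv (fun i => count_mem i s).
Proof.
apply/rowP => i; rewrite mxE /wordv summxE; elim: s => [|j s IH].
  by rewrite big_nil.
by rewrite big_cons IH /= mxE natrD.
Qed.

Lemma sum_count s : (\sum_(i < n) count_mem i s = size s)%N.
Proof.
elim: s => [|j s IH] /=; first by rewrite big1.
rewrite big_split /= IH (bigD1 j) //= eqxx big1 // => i ij.
by rewrite eq_sym (negbTE ij).
Qed.

Lemma natv_word (b : 'I_n -> nat) :
  exists2 s, natv b = wordv s & size s = (\sum_i b i)%N.
Proof.
exists (flatten [seq nseq (b i) i | i <- enum 'I_n]); last first.
  by rewrite size_flatten /shape -map_comp sumnE big_map big_enum; apply: eq_bigr => i _;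
     rewrite /= size_nseq.
rewrite wordv_count; apply/rowP => j; rewrite !mxE; congr (_%:R).
rewrite count_flatten sumnE -map_comp big_map big_enum /= (bigD1 j) //= count_nseq /= eqxx mul1n.
by rewrite big1 ?addn0 // => i ij; rewrite count_nseq /= (negbTE ij).
Qed.

Lemma norm_ebasis i : `|ebasis R i : V| <= 1.
Proof. by apply/rV_normP => // j; rewrite mxE; case: eqP; rewrite ?normr1 ?normr0. Qed.

Lemma norm_wordv s : `|wordv s| <= (size s)%:R.
Proof.
rewrite /wordv (le_trans (ler_norm_sum _ _ _)) // -sum1_size natr_sum.
by apply: ler_sum => i _; exact: norm_ebasis.
Qed.

(* Induction on the length of the word: Kemperman's identity expresses the value
   at a word through differences and the values at shorter words. *)
Lemma lattice_bound r (G : V -> R) (D : R) (N : nat) : (0 < r)%N -> 0 <= D ->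
  (forall s, (size s < r)%N -> G (wordv s) = 0) ->
  (forall x h, `|x| <= (N + r * r)%:R -> enorm h <= (n * r)%:R -> `|diffk r h G x| <= D) ->
  forall s, (size s <= N)%N -> `|G (wordv s)| <= (2 ^+ r.+1) ^+ size s * D.
Proof.
move=> r0 D0 G0 HD s; move: {2}(size s) (leqnn (size s)) => m.
elim: m s => [|m IH] s sm sN.
  rewrite G0 ?normr0 ?mulr_ge0 ?exprn_ge0 //.
  by move: sm; rewrite leqn0 => /eqP ->.
have [sr|rs] := ltnP (size s) r.
  by rewrite G0 // normr0 mulr_ge0 ?exprn_ge0.
have s1 : (0 < size s)%N by exact: leq_trans rs.
have [i0 _] : exists i0 : 'I_n, i0 \in s by case: s s1 {sm sN rs} => // i s _; exists i; rewrite inE eqxx.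
(* The first [r] letters move and the others form the base point, so proper subsets of the moving
   letters give shorter words. *)
pose v (j : 'I_r) : V := ebasis R (nth i0 s j).
pose y := wordv (drop r s).
have words S : exists2 s', size s' = (#|S : {set 'I_r}| + (size s - r))%N &
    y + \sum_(j in S) v j = wordv s'.
  exists ([seq nth i0 s (j : 'I_r) | j <- enum S] ++ drop r s).
    by rewrite size_cat size_map -cardE size_drop.
  by rewrite /wordv big_cat /= addrC big_map big_enum.
have yv : y + \sum_j v j = wordv s.
  rewrite -[in RHS](cat_take_drop r s) /wordv big_cat /= addrC; congr (_ + _).
  by rewrite (big_nth i0) size_takel // big_mkord; apply: eq_bigr => j _; rewrite nth_take.
rewrite -yv; set B := (2 ^+ r.+1) ^+ (size s).-1 * D.
have B0 : 0 <= B by rewrite mulr_ge0 ?exprn_ge0.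
have hS (S : {set 'I_r}) : `|- \sum_(i in S) i.+1%:R^-1 *: v i| <= r%:R.
  rewrite normrN (le_trans (ler_norm_sum _ _ _)) //.
  rewrite (@le_trans _ _ (\sum_(i < r) 1)) //; last by rewrite sumr_const card_ord.
  rewrite [leLHS]big_mkcond; apply: ler_sum => i _; case: ifP => // _.
  rewrite normrZ mulr_ile1 // ?norm_ebasis //.
  by rewrite ger0_norm ?invr_ge0 // invf_le1 // ler1n.
(* Since D <= B, the sum D + B is at most 2 B; this is the origin of the base 2^(r+1). *)
apply: (@le_trans _ _ (2 ^+ r * (D + B))); last first.
  rewrite -[size s]prednK // exprS -mulrA -/B exprSr -mulrA ler_pM2l ?exprn_gt0 //.
  rewrite mulr_natl mulr2n lerD2r /B ler_peMl //.
  by rewrite exprn_ege1 // exprn_ege1 // ler1n.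
apply: kemperman_bound => // S.
  have [s' s's Es] := words S; apply: HD; last first.
    rewrite (le_trans (enorm_le_norm _)) // natrM ler_wpM2l //.
  rewrite (le_trans (ler_normD _ _)) // natrD lerD //.
    rewrite Es (le_trans (norm_wordv _)) // ler_nat s's.
    by rewrite (leq_trans _ sN) // -[leqRHS](subnKC rs) leq_add2r
       (leq_trans (max_card _)) ?card_ord.
  rewrite normrZ natrM ler_pM //.
  by rewrite ger0_norm ?divr_ge0 // ler_pdivrMr // mulr_natr mulr2n lerDl.
move=> Sr; have [s' s's ->] := words S.
have s'l : (size s' <= (size s).-1)%N by rewrite s's; lia.
apply: le_trans (IH s' _ _) _.
- by rewrite (leq_trans s'l) // -ltnS prednK.
- by rewrite (leq_trans s'l) // (leq_trans (leq_pred _)).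
by rewrite ler_wpM2r // ler_weXn2l // exprn_ege1 // ler1n.
Qed.

(** The binomial coefficient with real upper argument, a polynomial in [x] with zeros 0, ..., m - 1
    and value 1 at [m]. *)
Definition binr (x : R) (m : nat) : R := (\prod_(i < m) (x - i%:R)) / m`!%:R.

Lemma binr_small (k m : nat) : (k < m)%N -> binr k%:R m = 0.
Proof.
by move=> km; rewrite /binr (bigD1 (Ordinal km)) //= subrr !mul0r.
Qed.

Lemma binr_diag m : binr m%:R m = 1.
Proof.
rewrite /binr (_ : \prod_(i < m) _ = m`!%:R) ?divff ?pnatr_eq0 -?lt0n ?fact_gt0 //.
rewrite -ffactnn ffact_prod natr_prod; apply: eq_bigr => i _.
by rewrite natrB // ltnW.
Qed.

Lemma polyfun_binr d m (v : 'I_n -> R) (c : R) p : polyfun d p ->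
  polyfun (d + m) (fun x => binr (c + \sum_i v i * x ord0 i) m * p x).
Proof.
move=> pd.
have : polyfun (d + m) (fun x => (\prod_(j < m) (c + \sum_i v i * x ord0 i - j%:R)) * p x).
  elim: m => [|m IH].
    by rewrite addn0; apply: polyfun_ext pd => x; rewrite big_ord0 mul1r.
  rewrite addnS; apply: polyfun_ext (polyfun_affine v (c - m%:R) IH) => x.
  rewrite big_ord_recr /=; ring.
move=> /(polyfunZ (m`!%:R)^-1); apply: polyfun_ext => x; rewrite /binr; ring.
Qed.

Section Lagrange.
Variable r : nat.
Hypothesis r_gt0 : (0 < r)%N.
Local Notation idx := {ffun 'I_n -> 'I_r}.
Implicit Types a : idx.

Definition in_simplex a := (\sum_i a i < r)%N.

(* The Lagrange basis of the polynomials of total degree < r for the nodes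
   node a with |a| < r. *)
Definition lagr a (t : V) : R :=
  binr (r.-1%:R - \sum_i t ord0 i) (r.-1 - \sum_i a i) * \prod_i binr (t ord0 i) (a i).

Lemma polyfun_lagr a : in_simplex a -> polyfun r (lagr a).
Proof.
move=> ar; pose e (j i : 'I_n) : R := (j == i)%:R.
have coord (x : V) j : 0 + \sum_i e j i * x ord0 i = x ord0 j.
  rewrite add0r (bigD1 j) //= /e eqxx mul1r big1 ?addr0 // => i ij.
  by rewrite eq_sym (negbTE ij) mul0r.
have H (s : seq 'I_n) : polyfun (1 + \sum_(i <- s) a i)
    (fun x => \prod_(i <- s) binr (x ord0 i) (a i)).
  elim: s => [|j s IH].
    by rewrite big_nil addn0; apply: polyfun_ext (polyfunC 0 1) => x; rewrite big_nil.
  rewrite big_cons addnCA addnC.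
  by apply: polyfun_ext (polyfun_binr (a j) (e j) 0 IH) => x; rewrite big_cons coord.
have -> : r = (1 + \sum_i a i + (r.-1 - \sum_i a i))%N.
  by move: ar; rewrite /in_simplex; lia.
apply: polyfun_ext (polyfun_binr _ (fun=> -1) r.-1%:R (H (index_enum 'I_n))) => x.
by rewrite /lagr; congr (binr (_ + _) _ * _); rewrite -mulr_sumr mulN1r.
Qed.

Definition node a : V := natv (fun i => a i : nat).

Definition interp (F : V -> R) (t : V) : R :=
  \sum_(a : idx | in_simplex a) F (node a) * lagr a t.

Lemma polyfun_interp F : polyfun r (interp F).
Proof.
have H a : polyfun r (fun t => (in_simplex a)%:R * (F (node a) * lagr a t)).
  case: (boolP (in_simplex a)) => ar.
    by apply: polyfunZ; apply: polyfunZ; exact: polyfun_lagr.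
  by apply: polyfun_ext (polyfun0 r) => x; rewrite mul0r.
apply: polyfun_ext (polyfun_sum (index_enum _) xpredT H) => x.
rewrite /interp [RHS]big_mkcond; apply: eq_bigr => a _.
by case: ifP; rewrite ?mul1r ?mul0r.
Qed.

(** At a node b the product in [lagr a] vanishes unless a <= b in every coordinate, and its first
    factor vanishes if |a| < |b|. Both survive only for a = b. *)
Lemma interp_node F s : (size s < r)%N -> interp F (wordv s) = F (wordv s).
Proof.
move=> sr; rewrite wordv_count.
have cr i : (count_mem i s < r)%N by rewrite (leq_ltn_trans (count_size _ _)).
pose a0 : idx := [ffun i => Ordinal (cr i)].
have a0r : in_simplex a0.
  rewrite /in_simplex (eq_bigr (fun i => count_mem i s)) ?sum_count //.
  by move=> i _; rewrite ffunE.
have sa : (\sum_i a0 i = size s)%N.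
  by rewrite -[RHS]sum_count; apply: eq_bigr => i _; rewrite ffunE.
have St : \sum_i (natv (fun i => count_mem i s)) ord0 i = (size s)%:R.
  by rewrite -[in RHS]sum_count natr_sum; apply: eq_bigr => i _; rewrite mxE.
have n0 : node a0 = natv (fun i => count_mem i s).
  by apply/rowP => i; rewrite !mxE ffunE.
rewrite /interp (bigD1 a0) //= big1 ?addr0 => [|a /andP[ar aa0]].
  rewrite n0 /lagr St sa -natrB; last by rewrite -ltnS prednK.
  rewrite binr_diag mul1r big1 ?mulr1 // => i _.
  by rewrite mxE /= ffunE /= binr_diag.
rewrite /lagr St -natrB; last by rewrite -ltnS prednK.
case: (boolP [forall i, (a i <= count_mem i s)%N]) => [/forallP le|].
  have lt : (\sum_i a i < size s)%N.
    rewrite -sum_count ltn_neqAle leq_sum ?andbT; last by [].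
    apply: contra aa0 => /eqP E; apply/eqP/ffunP => i; apply/val_inj.
    rewrite ffunE /=; apply/eqP; rewrite eqn_leq le /=.
    rewrite leqNgt; apply/negP => lti; move: E; rewrite (bigD1 i) //= [RHS](bigD1 i) //=.
    by apply/eqP; rewrite neq_ltn -addSn leq_add // leq_sum.
  by rewrite binr_small ?mul0r ?mulr0 //; move: ar; rewrite /in_simplex; lia.
rewrite negb_forall => /existsP[i]; rewrite -ltnNge => lti.
by rewrite [X in _ * (_ * X)](bigD1 i) //= mxE binr_small // mul0r !mulr0.
Qed.

(** The error [q] vanishes at the nodes and has zero r-th differences, so [lattice_bound] with D = 0
    kills it on the natural lattice. It is then killed along one coordinate after another, a
    polynomial with too many zeros being 0. *)
Lemma interp_polyfun p t : polyfun r p -> interp p t = p t.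
Proof.
move=> pr; pose q x := p x - interp p x.
have qr : polyfun r q.
  apply: polyfun_ext (polyfunD pr (polyfunZ (-1) (polyfun_interp p))) => x.
  by rewrite mulN1r.
suff : q t = 0 by move/eqP; rewrite subr_eq0 => /eqP.
have q0 s : q (wordv s) = 0.
  have := @lattice_bound r q 0 (size s) r_gt0 (lexx _) _ _ s (leqnn _).
  rewrite mulr0 normr_le0 => H; apply/eqP/H => [s' s'r|x h _ _].
    by rewrite /q interp_node // subrr.
  by rewrite diffk_polyfun // normr0.
(* The first [m] coordinates are already arbitrary reals and the remaining ones are still natural
   numbers. *)
suff H m : (m <= n)%N -> forall x : V,
    (forall i : 'I_n, (m <= i)%N -> exists k : nat, x ord0 i = k%:R) -> q x = 0.
  by apply: (H n) => // i; rewrite leqNgt ltn_ord.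
elim: m => [|m IH] mn x xk.
  have xk' i : exists k : nat, x ord0 i = k%:R by exact: xk.
  have [k Hk] := choice xk'.
  have -> : x = natv k by apply/rowP => i; rewrite mxE.
  by have [s -> _] := natv_word k; exact: q0.
pose i : 'I_n := Ordinal mn.
have [P HP] := polyfun_line (x - x ord0 i *: ebasis R i) i qr.
have Pnat (k : nat) : root P k%:R.
  rewrite /root -HP IH // ?(ltnW mn) // => j mj.
  case: (eqVneq i j) => [ij|ij].
    by exists k; rewrite !mxE ij eqxx /= !mulr1 subrr add0r.
  have mj' : (m < j)%N by rewrite ltn_neqAle mj andbT; apply: contra ij => /eqP mj'; apply/eqP/val_inj.
  have [k' k'E] := xk j mj'; exists k'.
  by rewrite !mxE (negbTE ij) /= !mulr0 subr0 addr0.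
have P0 : P = 0.
  apply: contraTeq isT => Pn0; rewrite /=.
  have := @max_poly_roots _ P [seq k%:R | k <- iota 0 (size P)] Pn0.
  rewrite size_map size_iota ltnn; apply.
    by apply/allP => _ /mapP[k _ ->].
  by rewrite map_inj_uniq ?iota_uniq // => k k' /eqP; rewrite eqr_nat => /eqP.
by have := HP (x ord0 i); rewrite subrK P0 horner0.
Qed.

Lemma lagr_bound : exists2 C : R, 0 <= C & forall t, `|t| <= 1 ->
  \sum_(a : idx | in_simplex a) `|lagr a t| <= C.
Proof.
have cl : continuous (fun t => \sum_(a : idx | in_simplex a) `|lagr a t|).
  under eq_fun do rewrite big_mkcond; apply: cont_sum => a.
  case: (boolP (in_simplex a)) => [ar|_]; last exact: cont_cst.
  by apply: cont_norm; exact: polyfun_cont (polyfun_lagr ar).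
have [C C0 HC] := continuous_bounded_ball 1 cl.
by exists C => // t t1; apply: le_trans (HC t t1); exact: ler_norm.
Qed.

End Lagrange.
End Interpolation.

(** * The local Whitney theorem *)

Section Whitney.
Variables (R : realType) (n r : nat).
Hypothesis r_gt0 : (0 < r)%N.
Local Notation V := 'rV[R]_n.
Implicit Types (f Q : V -> R).

(** Subtracting the interpolant leaves the r-th differences unchanged and makes the function vanish
    at the nodes, so [lattice_bound] propagates the smallness to the other lattice points. *)
Lemma approx_poly (b : V) (d D : R) (N : nat) f : 0 < d -> 0 <= D ->
  (forall x h, `|x - b| <= d * (N + r * r)%:R -> enorm h <= d * (n * r)%:R ->
    `|diffk r h f x| <= D) ->
  exists2 Q, polyfun r Q & forall k : 'I_n -> nat, (\sum_i k i <= N)%N ->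
    `|f (d *: natv R k + b) - Q (d *: natv R k + b)| <= (2 ^+ r.+1) ^+ N * D.
Proof.
move=> d0 D0 HD; pose F t := f (d *: t + b).
exists (fun x => @interp R n r F (d^-1 *: x + - (d^-1 *: b))).
  exact/polyfun_comp/polyfun_interp.
move=> k kN; rewrite scalerDr addrK scalerA mulVf ?gt_eqF // scale1r.
have [s -> sk] := natv_word R k.
pose G t := F t - @interp R n r F t.
have sN : (size s <= N)%N by rewrite sk.
have -> : f (d *: wordv R s + b) - @interp R n r F (wordv R s) = G (wordv R s) by [].
apply: le_trans (@lattice_bound R n r G D N r_gt0 D0 _ _ s sN) _.
- by move=> s' s'r; rewrite /G interp_node // subrr.
- move=> x h xN hn; rewrite /G diffkB (diffk_polyfun _ _ (polyfun_interp r_gt0 F)) // subr0.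
  rewrite /F diffk_affine; apply: HD.
    by rewrite addrK normrZ gtr0_norm // ler_pM2l.
  by rewrite enormZ gtr0_norm // ler_pM2l.
by rewrite ler_wpM2r // ler_weXn2l // exprn_ege1 // ler1n.
Qed.

(** Interpolation reproduces [Q], so the error is at most the Lebesgue constant [C] times the error
    at the nodes. *)
Lemma interp_near (C d E : R) (b t : V) f Q :
  (forall t, `|t| <= 1 ->
    \sum_(a : {ffun 'I_n -> 'I_r} | in_simplex a) `|lagr a t| <= C) ->
  0 <= E -> polyfun r Q ->
  (forall a : {ffun 'I_n -> 'I_r}, in_simplex a ->
    `|f (d *: node R a + b) - Q (d *: node R a + b)| <= E) ->
  `|t| <= 1 ->
  `|@interp R n r (fun t => f (d *: t + b)) t - Q (d *: t + b)| <= C * E.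
Proof.
move=> HC E0 rQ HE t1.
rewrite -(interp_polyfun r_gt0 t (polyfun_comp d b rQ)) /interp -sumrB.
rewrite (le_trans (ler_norm_sum _ _ _)) //.
rewrite (@le_trans _ _ (\sum_(a : {ffun 'I_n -> 'I_r} | in_simplex a) `|lagr a t| * E)) //.
  apply: ler_sum => a ar; rewrite -mulrBl normrM mulrC ler_wpM2l //; exact: HE.
by rewrite -mulr_suml ler_wpM2r // HC.
Qed.

Lemma powR_half_exp (s : R) m : powR (2^-1 ^+ m) s = (powR 2^-1 s) ^+ m.
Proof.
have h0 : 0 <= (2^-1 : R) by rewrite invr_ge0.
by rewrite -powR_mulrn // -powRrM mulrC powRrM powR_mulrn // powR_ge0.
Qed.

Lemma powR_half_lt1 (s : R) : 0 < s -> 0 < powR 2^-1 s < 1.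
Proof.
move=> s0; rewrite powR_gt0 ?invr_gt0 //=.
have h : 2^-1 < 1 :> R by rewrite invf_lt1 // ltr1n.
by have := gt0_ltr_powR s0 _ _ h; rewrite powR1 !nnegrE invr_ge0; exact.
Qed.

Lemma geometric_sum_le (q : R) m : 0 <= q < 1 -> \sum_(i < m) q ^+ i <= (1 - q)^-1.
Proof.
move=> /andP[q0 q1]; have q1' : 0 < 1 - q by rewrite subr_gt0.
rewrite -(ler_pM2l q1') mulfV ?gt_eqF //.
have -> : (1 - q) * \sum_(i < m) q ^+ i = 1 - q ^+ m.
  by rewrite -[in RHS](expr1n _ m) subrXX; congr (_ * _); apply: eq_bigr => i _; rewrite expr1n mul1r.
by rewrite gerBl exprn_ge0.
Qed.

(* Local Whitney theorem: the interpolants on finer and finer dyadic lattices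
   telescope, and the decay of the differences makes the telescope summable. *)
Lemma whitney_local (s : R) (N0 : nat) : 0 < s ->
  exists2 C : R, 0 <= C & exists2 rho : R, 0 <= rho &
  forall f (K : R), continuous f -> 0 <= K ->
  (forall u h, `|u| <= rho -> enorm h <= 1 ->
     `|diffk r h f u| <= K * powR (enorm h) s) ->
  exists2 P, polyfun r P & forall x, `|x| <= N0%:R -> `|f x - P x| <= C * K.
Proof.
have ar0 (a b c e : nat) : (a + b + c <= c + 1 + a + e + b)%N by lia.
have ar1 (a b c e : nat) : (a + b + (c + 1) <= c + 1 + e + a + b)%N by lia.
have ar2 (a c : nat) : (2 * a < c.+1)%N -> (c < 2 * a + 2)%N -> (2 * a <= c <= 2 * a + 1)%N.
  by lia.
have ar3 (a c e : nat) : (c < a)%N -> (2 * c <= 2 * a + e)%N by lia.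
have ar4 (a b c e : nat) : (a < b)%N -> (c <= e)%N -> (a + c <= 2 * b + e)%N by lia.
have ar5 (a c : nat) : (2 * a <= c <= 2 * a + 1)%N -> (c - 2 * a <= 1)%N by lia.
have ar6 (F : 'I_n -> nat) c : (forall i, F i <= c)%N -> (\sum_i F i <= n * c)%N.
  move=> H; apply: (@leq_trans (\sum_(i < n) c)); first exact: leq_sum.
  by rewrite sum_nat_const card_ord.
move=> s0; pose q := (n * r)%N.
(* The offset q = n r in the mesh gives d_m n r <= 2^-m, so the steps required by [approx_poly] on
   level [m] have length at most 2^-m. *)
pose d m : R := 2^-1 ^+ (q + m).
have d0 m : 0 < d m by rewrite exprn_gt0 // invr_gt0.
have d1 m : d m <= 1 by rewrite exprn_ile1 ?invr_ge0 // invf_le1 // ler1n.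
have dS m : d m = 2 * d m.+1.
  by rewrite /d addnS exprS mulrA mulfV ?mul1r // pnatr_eq0.
have dq m : d m * q%:R <= 2^-1 ^+ m.
  rewrite /d exprD mulrAC ler_piMl ?exprn_ge0 ?invr_ge0 // exprVn.
  by rewrite ler_pdivrMl ?exprn_gt0 // mulr1 -natrX ler_nat ltnW // ltn_expl.
(* [N1] bounds the lattice length from the corner [b] to every node of the coarsest interpolation.
   [N2] does so from [xm m], on the finer lattice, for the nodes of levels [m] (at most 2 r) and m +
   1 (at most r + n). *)
pose N1 := (n * (2 * N0 * 2 ^ q) + r)%N; pose N2 := (2 * r + n)%N.
have [Cl Cl0 HCl] := lagr_bound R n r_gt0.
pose C1 := (2 ^+ r.+1) ^+ N1 : R; pose C2 := (2 ^+ r.+1) ^+ N2 : R.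
have C10 : 0 <= C1 by rewrite exprn_ge0 // exprn_ge0.
have C20 : 0 <= C2 by rewrite exprn_ge0 // exprn_ge0.
pose th := powR (2^-1 : R) s.
have /andP[th0 th1] : 0 < th < 1 := powR_half_lt1 s0.
exists (Cl * C1 + 2 * Cl * C2 / (1 - th)).
  by rewrite addr_ge0 ?mulr_ge0 // invr_ge0 subr_ge0 ltW.
exists (N0 + 1 + N1 + N2 + r * r)%:R => //.
move=> f K cf K0 HK.
(* Starting the lattice at this corner makes all the coordinates natural numbers. *)
pose b : V := const_mx (- N0%:R).
have nb : `|b| <= N0%:R by apply/rV_normP => // i; rewrite mxE normrN normr_nat.
have HD m x h : `|x| <= (N0 + 1 + N1 + N2 + r * r)%:R -> enorm h <= d m * q%:R ->
    `|diffk r h f x| <= K * th ^+ m.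
  move=> xr hd; have h2 := le_trans hd (dq m).
  apply: le_trans (HK _ _ xr _) _.
    by rewrite (le_trans h2) // exprn_ile1 ?invr_ge0 // invf_le1 // ler1n.
  rewrite ler_wpM2l // /th -powR_half_exp ge0_ler_powR ?nnegrE ?enorm_ge0 //.
  exact: ltW.
have [|P rP HP] := @approx_poly b (d 0%N) K N1 f (d0 _) K0.
  move=> x h xb hd; rewrite -[K]mulr1 -(expr0 th); apply: HD => //.
  rewrite -(subrK b x) (le_trans (ler_normD _ _)) //.
  rewrite (@le_trans _ _ ((N1 + r * r)%:R + N0%:R)) //.
    by rewrite lerD // (le_trans xb) // ler_piMl.
  by rewrite -natrD ler_nat ar0.
exists P => // x xN.
have xb i : 0 <= x ord0 i + N0%:R <= 2 * N0%:R.
  have := le_trans (coord_le_norm x i) xN; rewrite ler_norml => /andP[h1 h2].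
  by apply/andP; split; lra.
pose y m i : R := (x ord0 i + N0%:R) * 2 ^+ (q + m).
have y0 m i : 0 <= y m i.
  by rewrite mulr_ge0 ?exprn_ge0 //; have /andP[] := xb i.
pose k m i := Num.truncn (y m i).
have kP m i : (k m i)%:R <= y m i < (k m i).+1%:R by exact: truncn_itv.
have kS m i : (2 * k m i <= k m.+1 i <= 2 * k m i + 1)%N.
  have yS : y m.+1 i = 2 * y m i by rewrite /y addnS exprS mulrCA.
  have /andP[h1 h2] := kP m i; have /andP[] := kP m.+1 i; rewrite yS => h3 h4.
  have h5 : (2 * k m i)%:R < (k m.+1 i).+1%:R :> R by rewrite natrM; lra.
  have h6 : (k m.+1 i)%:R < (2 * k m i + 2)%:R :> R.
    by rewrite natrD natrM; move: h2; rewrite -natr1; lra.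
  by move: h5 h6; rewrite !ltr_nat; exact: ar2.
(* The lattice point of mesh [d m] just below [x]; [t m] is the position of [x] relative to it, in
   units of the mesh. *)
pose xm m : V := d m *: natv R (k m) + b.
pose t m : V := \row_i (y m i - (k m i)%:R).
have yd m i : d m * y m i = x ord0 i + N0%:R.
  by rewrite /d /y mulrCA -exprMn mulVf ?pnatr_eq0 // expr1n mulr1.
have xE m : d m *: t m + xm m = x.
  apply/rowP => i; rewrite !mxE mulrBr addrA subrK yd; lra.
have t1 m : `|t m| <= 1.
  apply/rV_normP => // i; rewrite mxE.
  have /andP[h1 h2] := kP m i; rewrite ger0_norm; last by lra.
  by move: h2; rewrite -natr1; lra.
have nxm m : `|xm m| <= (N0 + 1)%:R.
  have -> : xm m = x - d m *: t m by rewrite -{1}(xE m) addrC addKr.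
  rewrite (le_trans (ler_normB _ _)) // natrD lerD // normrZ gtr0_norm //.
  by rewrite mulr_ile1 // ltW.
pose T m := @interp R n r (fun u => f (d m *: u + xm m)) (t m).
(* Both interpolants are compared with one polynomial [Q] fitted on the finer lattice, which
   contains the nodes of the two levels. *)
have step m : `|T m - T m.+1| <= 2 * Cl * C2 * K * th ^+ m.
  have Kth : 0 <= K * th ^+ m.+1 by rewrite mulr_ge0 // exprn_ge0 // ltW.
  have [|Q rQ HQ] := @approx_poly (xm m) (d m.+1) (K * th ^+ m.+1) N2 f (d0 _) Kth.
    move=> z h zb hd; apply: HD => //.
    rewrite -(subrK (xm m) z) (le_trans (ler_normD _ _)) //.
    rewrite (@le_trans _ _ ((N2 + r * r)%:R + (N0 + 1)%:R)) //.
      by rewrite lerD // (le_trans zb) // ler_piMl.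
    by rewrite -natrD ler_nat ar1.
  have E0 : 0 <= C2 * (K * th ^+ m.+1) by rewrite mulr_ge0.
  have A1 := @interp_near Cl (d m) (C2 * (K * th ^+ m.+1)) (xm m) (t m) f Q HCl E0 rQ.
  have A2 := @interp_near Cl (d m.+1) (C2 * (K * th ^+ m.+1)) (xm m.+1) (t m.+1) f Q HCl E0 rQ.
  have {}A1 : `|T m - Q x| <= Cl * (C2 * (K * th ^+ m.+1)).
    rewrite -[X in Q X](xE m); apply: A1 => // a ar.
    have -> : d m *: node R a = d m.+1 *: natv R (fun i => 2 * a i)%N.
      by apply/rowP => i; rewrite !mxE (dS m) natrM; ring.
    by apply: HQ; rewrite -big_distrr /=; exact: ar3.
  have {}A2 : `|T m.+1 - Q x| <= Cl * (C2 * (K * th ^+ m.+1)).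
    rewrite -[X in Q X](xE m.+1); apply: A2 => // a ar.
    have -> : d m.+1 *: node R a + xm m.+1 =
        d m.+1 *: natv R (fun i => a i + (k m.+1 i - 2 * k m i))%N + xm m.
      apply/rowP => i; rewrite !mxE (dS m) natrD natrB ?natrM; first by ring.
      by have /andP[] := kS m i.
    apply: HQ; rewrite big_split /=; apply: ar4 => //.
    by rewrite -[leqRHS]muln1; apply: ar6 => i; exact: ar5.
  have : `|T m - T m.+1| <= `|T m - Q x| + `|T m.+1 - Q x|.
    by rewrite -[T m - T m.+1](subrKA (Q x)) (le_trans (ler_normD _ _)) // (distrC (Q x)).
  have : K * th ^+ m.+1 <= K * th ^+ m.
    by rewrite ler_wpM2l // exprS ler_piMl ?exprn_ge0 // ltW.
  move=> h1 h2; apply: (le_trans h2).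
  apply: (@le_trans _ _ (2 * Cl * C2 * (K * th ^+ m.+1))); first by lra.
  by rewrite -[leRHS]mulrA ler_wpM2l ?mulr_ge0.
have T0 : `|T 0%N - P x| <= Cl * (C1 * K).
  rewrite -[X in P X](xE 0%N); apply: interp_near => //; first by rewrite mulr_ge0.
  move=> a ar.
  have -> : d 0%N *: node R a + xm 0%N = d 0%N *: natv R (fun i => a i + k 0%N i)%N + b.
    by apply/rowP => i; rewrite !mxE natrD; ring.
  apply: HP; rewrite big_split /= /N1 addnC leq_add //; last first.
    by move: ar; rewrite /in_simplex => /ltnW.
  apply: ar6 => i.
  rewrite -(ler_nat R); have /andP[h _] := kP 0%N i; apply: le_trans h _.
  by rewrite /y addn0 natrM natrX ler_wpM2r ?exprn_ge0 // natrM; have /andP[] := xb i.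
have Tm m : `|T 0%N - T m| <= 2 * Cl * C2 * K * (1 - th)^-1.
  have : `|T 0%N - T m| <= \sum_(i < m) 2 * Cl * C2 * K * th ^+ i.
    elim: m => [|m IH]; first by rewrite subrr normr0 big_ord0.
    rewrite big_ord_recr /= -[T 0%N - _](subrKA (T m)) (le_trans (ler_normD _ _)) //.
    by rewrite lerD.
  move=> h; apply: (le_trans h); rewrite -mulr_sumr ler_wpM2l ?mulr_ge0 //.
  by apply: geometric_sum_le; rewrite ltW.
(* The nodes shrink to [x] and interpolation reproduces the constant f(x), so continuity gives the
   limit. *)
have Tlim e : 0 < e -> exists m, `|T m - f x| <= e.
  move=> e0; have e'0 : 0 < e / (Cl + 1) by rewrite divr_gt0 // ltr_wpDl.
  have [dl dl0 Hdl] := (continuous_epsP f).1 cf x _ e'0.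
  have [m Hm] : exists m, d m * (r.+1%:R) < dl.
    exists (Num.truncn (r.+1%:R / dl)).+1; set m := _.+1.
    have : r.+1%:R / dl < m%:R by exact: truncnS_gt.
    rewrite ltr_pdivrMr // => h; rewrite /d exprVn ltr_pdivrMl ?exprn_gt0 //.
    apply: lt_le_trans h _; rewrite ler_pM2r // -natrX ler_nat.
    by rewrite ltnW // (leq_trans (ltn_expl m (isT : 1 < 2)%N)) // leq_pexp2l // leq_addl.
  exists m; apply: (@le_trans _ _ (Cl * (e / (Cl + 1)))); last first.
    by rewrite mulrA ler_pdivrMr ?ltr_wpDl // mulrC ler_pM2l // lerDl.
  have Qc : polyfun r (fun _ : V => f x) by case: (r) r_gt0 => // r' _; exact: polyfunC.
  apply: (@interp_near Cl (d m) (e / (Cl + 1)) (xm m) (t m) f (fun=> f x)) => //.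
    exact: ltW.
  move=> a ar; rewrite distrC; apply/ltW/Hdl.
  rewrite -{1}(xE m) opprD addrACA subrr addr0 -scalerBr normrZ gtr0_norm //.
  apply: le_lt_trans Hm; rewrite ler_pM2l // (le_trans (ler_normB _ _)) //.
  rewrite -natr1 addrC lerD //; apply/rV_normP => // i.
  by rewrite mxE normr_nat ler_nat ltnW.
apply/ler_addgt0Pr => e /Tlim[m Hm].
have -> : f x - P x = - (T m - f x) + (T m - T 0%N) + (T 0%N - P x) by ring.
rewrite (le_trans (ler_normD _ _)) // (le_trans (lerD (ler_normD _ _) (lexx _))) //.
rewrite normrN (distrC (T m) (T 0%N)); have := Tm m; move: T0 Hm; lra.
Qed.

End Whitney.

(** * Differences of functions of class C^k *)

Section CkBounds.
Variables (R : realType) (n : nat).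
Local Notation V := 'rV[R]_n.
Implicit Types (f g : V -> R).

Lemma is_derive_translate f (x v a : V) (df : R) :
  is_derive (x + a) v f df -> is_derive x v (fun y => f (y + a)) df.
Proof.
have E : (fun h : R => h^-1 *: (((fun y => f (y + a)) \o shift x) (h *: v) - f (x + a))) =
         (fun h : R => h^-1 *: ((f \o shift (x + a)) (h *: v) - f (x + a))).
  by apply/funext => h /=; rewrite addrA.
by case=> dfx Dfx; split; [rewrite /derivable E|rewrite /derive E].
Qed.

Lemma is_derive_diffk f (v h : V) k : (forall x, derivable f x v) ->
  forall x, is_derive x v (diffk k h f) (diffk k h ('D_v f) x).
Proof.
elim: k f => [|k IH] f df x /=; first by split.
have d1 y : is_derive y v (diff1 h f) (diff1 h ('D_v f) y).
  by apply: is_deriveB; apply: is_derive_translate; split.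
have -> : diff1 h ('D_v f) = 'D_v (diff1 h f).
  by apply/funext => y; rewrite (@derive_val _ _ _ _ _ _ _ (d1 y)).
by apply: IH => y; case: (d1 y).
Qed.

Lemma coord_mean_value f i (B : R) : continuous f ->
  (forall x, derivable f x (ebasis R i)) -> (forall x, `|'D_(ebasis R i) f x| <= B) ->
  forall x t, `|f (x + t *: ebasis R i) - f x| <= B * `|t|.
Proof.
move=> cf df HB.
have H (x : V) (t : R) : 0 <= t -> `|f (x + t *: ebasis R i) - f x| <= B * t.
  move=> t0; pose g (u : R) := f (x + u *: ebasis R i).
  have dg (u : R) : is_derive u (1 : R) g ('D_(ebasis R i) f (x + u *: ebasis R i)).
    have E : (fun h : R => h^-1 *: ((g \o shift u) (h *: (1 : R)) - g u)) =
             (fun h : R => h^-1 *: ((f \o shift (x + u *: ebasis R i)) (h *: ebasis R i)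
                                     - f (x + u *: ebasis R i))).
      apply/funext => h /=; rewrite /g; congr (_ *: (f _ - _)).
      by rewrite (_ : h%:A = h) ?scalerDl 1?addrCA // -[RHS]mulr1.
    by split; [rewrite /derivable E; exact: df|rewrite /derive E].
  have cg : continuous g.
    move=> u; apply/differentiable_continuous/derivable1_diffP.
    by case: (dg u).
  have [c _] := MVT_segment t0 (fun u _ => dg u) (continuous_subspaceT cg).
  rewrite /g scale0r addr0 subr0 => ->; rewrite normrM (ger0_norm t0).
  by rewrite ler_wpM2r.
move=> x t; have [t0|t0] := leP 0 t; first by rewrite (ger0_norm t0) H.
rewrite (ltr0_norm t0) distrC.
have := H (x + t *: ebasis R i) (- t).
by rewrite oppr_ge0 scaleNr addrK => /(_ (ltW t0)).
Qed.

Lemma row_sum_ebasis (h : V) : h = \sum_i h ord0 i *: ebasis R i.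
Proof.
apply/rowP => j; rewrite summxE (bigD1 j) //= !mxE eqxx mulr1 big1 ?addr0 // => i ij.
by rewrite !mxE (negbTE ij) mulr0.
Qed.

Lemma lipschitz_of_partials f (B : R) : continuous f -> 0 <= B ->
  (forall i x, derivable f x (ebasis R i)) ->
  (forall i x, `|'D_(ebasis R i) f x| <= B) ->
  forall x h, `|f (x + h) - f x| <= n%:R * B * `|h|.
Proof.
move=> cf B0 df HB x h.
rewrite {1}(row_sum_ebasis h) -[n in n%:R]card_ord.
rewrite -[_ * _ * _]mulrA mulr_natl -sumr_const.
elim: (index_enum 'I_n) x => [|i s IH] x.
  by rewrite !big_nil addr0 subrr normr0.
rewrite !big_cons addrA -[_ - f x](subrKA (f (x + h ord0 i *: ebasis R i))).
rewrite (le_trans (ler_normD _ _)) // [leRHS]addrC lerD ?IH //.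
apply: le_trans (coord_mean_value cf (df i) (HB i) _ _) _.
by rewrite ler_wpM2l // coord_le_norm.
Qed.

Lemma derive_support f (M : R) (v : V) : (forall x, M < `|x| -> f x = 0) ->
  forall x, M < `|x| -> 'D_v f x = 0.
Proof.
move=> f0 x Mx; rewrite (@near_eq_derive _ _ _ f (cst 0)) ?derive_cst //.
apply/nbhs_normP; exists (`|x| - M) => /=; first by rewrite subr_gt0.
move=> y /= xy; apply: f0.
have : `|x| <= `|x - y| + `|y| by rewrite -{1}(subrK y x) ler_normD.
by lra.
Qed.

Lemma Ck_continuous k f : Ck k f -> continuous f.
Proof. by case: k => [|k] []. Qed.

(** A difference of order k + 1 is an increment of the k-th difference over [h], and the partial
    derivatives of the latter are the k-th differences of those of [f]; the Lipschitz bound then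
    gains one more factor |h|. *)
Lemma Ck_diffk_bound k f (M : R) : Ck k f -> (forall x, M < `|x| -> f x = 0) ->
  exists2 C : R, 0 <= C & forall h x, `|diffk k h f x| <= C * `|h| ^+ k.
Proof.
elim: k f => [|k IH] f [cf Hf] f0.
  have [B B0 HB] := @Cc_bounded R n M f (conj cf f0).
  by exists B => // h x; rewrite expr0 mulr1.
have IHi i : exists C : R, 0 <= C /\
    forall h x, `|diffk k h ('D_(ebasis R i) f) x| <= C * `|h| ^+ k.
  have [_ Cki] := Hf i.
  by have [C C0 HC] := IH _ Cki (derive_support _ f0); exists C.
have [C HC] := choice IHi.
have C0 : 0 <= \sum_i C i by apply: sumr_ge0 => i _; case: (HC i).
have CC i : C i <= \sum_i C i.
  by rewrite (bigD1 i) //= lerDl sumr_ge0 // => j _; case: (HC j).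
exists (n%:R * \sum_i C i); first by rewrite mulr_ge0.
move=> h x; rewrite diffkSr.
have dk i y := @is_derive_diffk f (ebasis R i) h k (fun y => (Hf i).1 y) y.
have := @lipschitz_of_partials (diffk k h f) ((\sum_i C i) * `|h| ^+ k)
  (@diffk_cont _ _ k h f cf) _ _ _ (x - 2^-1 *: h) h.
rewrite -addrA [- _ + h](_ : _ = 2^-1 *: h); last first.
  rewrite -{2}[h]scale1r -scaleNr -scalerDl; congr (_ *: _); lra.
rewrite exprSr !mulrA; apply.
- by rewrite mulr_ge0 // exprn_ge0.
- by move=> i y; case: (dk i y).
- move=> i y; rewrite (@derive_val _ _ _ _ _ _ _ (dk i y)).
  apply: le_trans (proj2 (HC i) h y) _.
  by rewrite ler_wpM2r ?exprn_ge0.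
Qed.

Lemma Ck_le k m f : (m <= k)%N -> Ck k f -> Ck m f.
Proof.
elim: k m f => [|k IH] [|m] f //= mk [cf Hf]; split=> // i.
by have [df Ckf] := Hf i; split => //; apply: IH Ckf.
Qed.

Lemma compact_support_Cc k f : CLc k f -> exists M : nat, Cc M%:R f.
Proof.
move=> [ckf [M f0]]; exists (Num.truncn `|M|).+1; split; first exact: Ck_continuous ckf.
move=> x Mx; apply: f0; apply: lt_le_trans (norm_le_enorm x).
apply: lt_trans Mx; apply: (le_lt_trans (ler_norm M)).
by exact: truncnS_gt.
Qed.

End CkBounds.

(** * Vanishing moments against Whitney polynomials *)

Section WaveletMoments.
Variables (R : realType) (n : nat).
Local Notation V := 'rV[R]_n.

Lemma monom_cont (al : 'I_n -> nat) : continuous (@monom R n al).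
Proof.
rewrite /monom; elim: (index_enum 'I_n) => [|i s IH].
  by under eq_fun do rewrite big_nil; exact: cont_cst.
under eq_fun do rewrite big_cons; apply: contM => //.
elim: (al i) => [|m IHm]; first exact: cont_cst.
by under eq_fun do rewrite exprS; apply: contM => //; exact: coord_continuous.
Qed.

(** The monomial factor is carried for the induction: multiplication by a coordinate is absorbed
    into its exponent. Since [d] bounds the degree strictly, the condition is |al| + d <= L + 1. *)
Lemma polyfun_moment (L : nat) (M : R) (psi : V -> R) : 0 <= M -> Cc M psi ->
  (forall al : 'I_n -> nat, (\sum_(i < n) al i <= L)%N ->
     intn (fun x => (monom al x * psi x)%:E) = 0%E) ->
  forall d p, polyfun d p -> forall al : 'I_n -> nat, (\sum_(i < n) al i + d <= L.+1)%N ->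
    rint (fun x => monom al x * (p x * psi x)) = 0.
Proof.
move=> M0 cpsi H d p; elim=> {d p}.
- by move=> d al _; rewrite -[RHS](rint0 R n); apply: rint_ext => x; rewrite mul0r mulr0.
- move=> d c al; rewrite addnS ltnS => ald.
  rewrite (@rint_ext _ _ _ (fun x => c * (monom al x * psi x))); last first.
    by move=> x; rewrite mulrCA.
  rewrite (rintZ _ M0); last by apply: CcMl => //; exact: monom_cont.
  by rewrite /rint H ?mulr0 // (leq_trans _ ald) // leq_addr.
- move=> d p q dp IHp dq IHq al ald.
  rewrite (@rint_ext _ _ _ (fun x => 1 * (monom al x * (p x * psi x)) +
     monom al x * (q x * psi x))); last by move=> x; ring.
  rewrite (rintD _ M0) ?IHp ?IHq // ?mulr0 ?addr0 //.
    by apply: CcMl; [exact: monom_cont|apply: CcMl => //; exact: polyfun_cont dp].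
  by apply: CcMl; [exact: monom_cont|apply: CcMl => //; exact: polyfun_cont dq].
- move=> d i p dp IHp al ald.
  rewrite (@rint_ext _ _ _ (fun x => monom (fun j => al j + (i == j))%N x * (p x * psi x))).
    rewrite IHp // big_split /= (bigD1 i) //=.
    rewrite (leq_trans _ ald) // [X in (X + _ <= _)%N](_ : _ = (\sum_(j < n) al j).+1)%N ?addSnnS //.
    rewrite [in RHS](bigD1 i) //= -addn1 -!addnA; congr (_ + _)%N; congr (_ + _)%N.
    rewrite (bigD1 i) //= eqxx big1 ?addn0 // => j ij.
    by rewrite eq_sym (negbTE ij).
  move=> x; rewrite -!mulrA mulrCA mulrA; congr (_ * _).
  rewrite /monom (bigD1 i) //= [RHS](bigD1 i) //= eqxx addn1 exprS mulrA; congr (_ * _).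
  by apply: eq_bigr => j ij; rewrite eq_sym (negbTE ij) addn0.
Qed.

(** The Whitney polynomial has degree < r <= L + 1, so the wavelet annihilates it and only the error
    of approximation is integrated. *)
Lemma wavelet_whitney (L r : nat) (psi : V -> R) (s : R) : (0 < r)%N -> (r <= L.+1)%N ->
  0 < s -> CLc L psi ->
  (forall al : 'I_n -> nat, (\sum_(i < n) al i <= L)%N ->
     intn (fun x => (monom al x * psi x)%:E) = 0%E) ->
  exists2 C : R, 0 <= C & exists2 rho : R, 0 <= rho &
  forall (f : V -> R) (K : R), continuous f -> 0 <= K ->
  (forall u h, `|u| <= rho -> enorm h <= 1 ->
     `|diffk r h f u| <= K * powR (enorm h) s) ->
  `|rint (fun x => f x * psi x)| <= C * K.
Proof.
move=> r0 rL s0 cpsi H; have [N0 Cpsi] := compact_support_Cc cpsi.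
have N00 : 0 <= N0%:R :> R by [].
have [B B0 HB] := Cc_bounded Cpsi.
have [C C0 [rho rho0 HC]] := @whitney_local R n r r0 s N0 s0.
exists (C * B * (2 * N0%:R) ^+ n); first by rewrite !mulr_ge0 // exprn_ge0 // mulr_ge0.
exists rho => // f K cf K0 HK; have [P rP HP] := HC f K cf K0 HK.
have cP := polyfun_cont rP.
have -> : rint (fun x => f x * psi x) = rint (fun x => (f x - P x) * psi x).
  rewrite [RHS](@rint_ext _ _ _ (fun x => -1 * (P x * psi x) + f x * psi x)); last first.
    by move=> x; ring.
  rewrite (rintD _ N00); [|exact: CcMl|exact: CcMl].
  rewrite (@rint_ext _ _ (fun x => P x * psi x) (fun x => monom (fun=> 0%N) x * (P x * psi x))).
    rewrite (polyfun_moment N00 Cpsi H rP) ?mulr0 ?add0r //.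
    by rewrite big1.
  by move=> x; rewrite /monom big1 ?mul1r.
have -> : C * B * (2 * N0%:R) ^+ n * K = C * K * B * (2 * N0%:R) ^+ n by ring.
apply: rint_bound => //; first by apply: CcMl => //; exact: contB.
move=> x; have [xN|xN] := leP `|x| N0%:R; last first.
  by rewrite (proj2 Cpsi) // mulr0 normr0 !mulr_ge0.
by rewrite normrM ler_pM // HP.
Qed.

End WaveletMoments.

(** * Finite lists of lattice neighbours and geometric series *)

Section IntegerNeighbours.
Variables (R : realType) (n : nat).
Local Notation V := 'rV[R]_n.

Lemma eq_big_support (T : eqType) (s1 s2 : seq T) (F : T -> R) : uniq s1 -> uniq s2 ->
  (forall k, F k != 0 -> (k \in s1) && (k \in s2)) ->
  \sum_(k <- s1) F k = \sum_(k <- s2) F k.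
Proof.
move=> u1 u2 H.
have E s : \sum_(k <- s) F k = \sum_(k <- [seq k <- s | F k != 0]) F k.
  rewrite big_filter [RHS]big_mkcond; apply: eq_bigr => k _.
  by case: eqP => //= ->.
rewrite (E s1) (E s2); apply: perm_big; apply: uniq_perm; rewrite ?filter_uniq //.
move=> k; rewrite !mem_filter; case: (boolP (F k != 0)) => //= /H /andP[-> ->] //.
Qed.

(** An explicit list that contains every integer vector within distance [N] of [y] and whose length
    is independent of [y]; it turns sums over the wavelets active at a point into finite sums. *)
Definition int_near (N : nat) (y : V) : seq 'rV[int]_n :=
  [seq (\row_i (Num.floor (y ord0 i) + (a i : nat)%:Z - N%:Z)) |
     a : {ffun 'I_n -> 'I_(2 * N + 2)} <- enum {ffun 'I_n -> 'I_(2 * N + 2)}].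

Lemma int_near_uniq N y : uniq (int_near N y).
Proof.
rewrite map_inj_uniq ?enum_uniq // => a b /rowP ab; apply/ffunP => i; apply/val_inj.
by have := ab i; rewrite !mxE => /addIr/addrI[].
Qed.

Lemma size_int_near N y : size (int_near N y) = ((2 * N + 2) ^ n)%N.
Proof. by rewrite size_map -cardE card_ffun !card_ord. Qed.

Lemma mem_int_near N (y : V) k : `|y - zvec R k| <= N%:R -> k \in int_near N y.
Proof.
move=> /(rV_normP _ (ler0n R N)) H.
have Hi i : exists a : nat, (a < 2 * N + 2)%N /\
    k ord0 i = Num.floor (y ord0 i) + a%:Z - N%:Z.
  have := H i; rewrite !mxE ler_norml => /andP[h1 h2].
  have /andP[f1 f2] := floor_itv (y ord0 i).
  set fl := Num.floor (y ord0 i) in f1 f2 *; set ki := k ord0 i in h1 h2 *.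
  have l1 : (fl - N%:Z <= ki + 0)%R.
    rewrite addr0 -(ler_int R) intrD intrN; move: f1 h2; lra.
  have l2 : (ki < fl + 1 + N%:Z)%R.
    rewrite -(ltr_int R) [in ltRHS]intrD; move: f2 h1; lra.
  exists (absz (ki - fl + N%:Z)%R); move: l1 l2; clear; move: ki fl => /= ki fl; lia.
have [a Ha] := choice Hi.
have ai i : (a i < 2 * N + 2)%N by case: (Ha i).
apply/mapP; exists [ffun i => Ordinal (ai i)]; first by rewrite mem_enum.
by apply/rowP => i; rewrite mxE ffunE; case: (Ha i).
Qed.

End IntegerNeighbours.

Section Series.
Variable R : realType.

(** The absolute difference: one of the two truncated subtractions is 0. *)
Definition levdist (i j : nat) : nat := ((i - j) + (j - i))%N.

Lemma levdist_ge i j : (j <= i)%N -> levdist i j = (i - j)%N.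
Proof. by move=> ji; rewrite /levdist (eqP ji) addn0. Qed.

Lemma levdist_le i j : (i <= j)%N -> levdist i j = (j - i)%N.
Proof. by move=> ij; rewrite /levdist (eqP ij). Qed.

Lemma sum_levdist (q : R) j0 J : 0 < q < 1 ->
  \sum_(j < J) q ^+ levdist j j0 <= 2 / (1 - q).
Proof.
move=> /andP[q0 q1]; have q1' : 0 < 1 - q by rewrite subr_gt0.
have A m : (m <= j0)%N -> \sum_(0 <= j < m) q ^+ levdist j j0 <= q ^+ (j0 - m) / (1 - q).
  elim: m => [|m IH] mj; first by rewrite big_nil divr_ge0 ?exprn_ge0 ?ltW.
  rewrite big_nat_recr //= (le_trans (lerD (IH (ltnW mj)) (lexx _))) //.
  have -> : levdist m j0 = (j0 - m)%N by rewrite /levdist; lia.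
  have -> : (j0 - m = (j0 - m.+1).+1)%N by lia.
  rewrite -[X in _ + X](mulfK (lt0r_neq0 q1')) -mulrDl ler_pM2r ?invr_gt0 //.
  rewrite exprS; set x := q ^+ _; have x0 : 0 <= x by rewrite exprn_ge0 // ltW.
  by have := mulr_ge0 x0 (sqr_ge0 (1 - q)); rewrite -subr_ge0 expr2; lra.
have B m : \sum_(j0 <= j < j0 + m) q ^+ levdist j j0 <= (1 - q)^-1.
  rewrite -{1}[j0]add0n big_addn addKn big_mkord.
  have -> : \sum_(i < m) q ^+ levdist (i + j0) j0 = \sum_(i < m) q ^+ i.
    by apply: eq_bigr => i _; congr (_ ^+ _); rewrite /levdist; lia.
  by apply: geometric_sum_le; rewrite ltW.
rewrite -(big_mkord xpredT (fun j => q ^+ levdist j j0)) /=.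
have [Jj|jJ] := leqP J j0.
  apply: le_trans (A J Jj) _; rewrite ler_pM2r ?invr_gt0 //.
  by rewrite (@le_trans _ _ 1) ?exprn_ile1 ?ler1n // ltW.
rewrite (big_cat_nat (leq0n j0) (ltnW jJ)) /= [leRHS]mulr_natl mulr2n lerD //.
  by have := A j0 (leqnn _); rewrite subnn expr0 mul1r.
by rewrite -(subnKC (ltnW jJ)).
Qed.

Lemma exists_pow_le (q A e : R) : 0 <= q < 1 -> 0 < e -> exists J : nat, A * q ^+ J <= e.
Proof.
move=> /andP[q0 q1] e0.
have /cvgrPdist_lt/(_ (e / (`|A| + 1))) H : (fun m => q ^+ m) @ \oo --> (0 : R).
  by apply: cvg_expr; rewrite ger0_norm.
have A1 : 0 < `|A| + 1 by rewrite ltr_wpDl.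
have [J _ HJ] := H ltac:(by rewrite divr_gt0).
exists J; have := HJ J (leqnn J); rewrite /= sub0r normrN ger0_norm ?exprn_ge0 //.
rewrite ltr_pdivlMr // => h; apply: le_trans (ltW h); rewrite mulrC.
by rewrite ler_wpM2l ?exprn_ge0 // (le_trans (ler_norm A)) // lerDl.
Qed.

Lemma series_geometric_bound (u : nat -> R) (K q : R) : 0 <= K -> 0 <= q < 1 ->
  (forall j, `|u j| <= K * q ^+ j) ->
  forall J, `|limn (series u) - \sum_(j < J) u j| <= K * q ^+ J / (1 - q).
Proof.
move=> K0 /andP[q0 q1] Hu J; have q1' : 0 < 1 - q by rewrite subr_gt0.
have cu : cvgn (series u).
  apply: normed_cvg; apply: (@series_le_cvg _ _ (geometric K q)) => //.
  - by move=> m /=.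
  - by move=> m; rewrite /geometric /= mulr_ge0 ?exprn_ge0.
  - by apply: is_cvg_geometric_series; rewrite ger0_norm.
have Hm m : `|\sum_(j < J + m) u j - \sum_(j < J) u j| <= K * q ^+ J / (1 - q).
  have -> : \sum_(j < J + m) u j - \sum_(j < J) u j = \sum_(j < m) u (J + j)%N.
    by rewrite big_split_ord /= addrAC subrr add0r.
  rewrite (le_trans (ler_norm_sum _ _ _)) //.
  rewrite (@le_trans _ _ (\sum_(j < m) K * q ^+ J * q ^+ j)) //.
    by apply: ler_sum => j _; rewrite -mulrA -exprD.
  rewrite -mulr_sumr ler_wpM2l ?mulr_ge0 ?exprn_ge0 //.
  by apply: geometric_sum_le; rewrite q0.
apply/ler_addgt0Pr => e e0.
have /cvgrPdist_lt/(_ e e0)[m0 _ Hm0] := cu.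
have := Hm0 (J + m0)%N (leq_addl _ _).
rewrite /= /series /= big_mkord => h.
rewrite -[_ - \sum_(j < J) u j](subrKA (\sum_(j < J + m0) u j)).
by rewrite (le_trans (ler_normD _ _)) // addrC lerD // ltW.
Qed.

End Series.

(** * Wavelet series with decaying coefficients *)

Section Synthesis.
Variables (R : realType) (n : nat) (phi : 'rV[R]_n -> R) (psi : nat -> 'rV[R]_n -> R).
Local Notation V := 'rV[R]_n.
Local Notation windex := (windex n).
Local Notation psiw := (psiw phi psi).
Implicit Types (w : windex) (c : windex -> R).

Definition atom (l : nat) : V -> R := if l == 0%N then phi else psi l.

(** All the quantitative information on the generators used by the estimates, with one radius [N]
    and one constant [B] for the scaling function and all the wavelets. *)
Definition atoms_bounded (N k : nat) (B : R) : Prop :=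
  [/\ 0 <= B,
      forall l, (l < 2 ^ n)%N -> Cc N%:R (atom l),
      forall l x, (l < 2 ^ n)%N -> `|atom l x| <= B,
      forall l x y, (l < 2 ^ n)%N -> `|atom l x - atom l y| <= B * `|x - y| &
      forall l h x, (l < 2 ^ n)%N -> `|diffk k h (atom l) x| <= B * `|h| ^+ k].

Lemma daubechies_atoms (L k : nat) : daubechies L phi psi -> (1 <= L)%N -> (k <= L)%N ->
  exists N B, atoms_bounded N k B.
Proof.
move=> [cphi cpsi _ _ _] L1 kL.
have catom (l : 'I_(2 ^ n)) : CLc L (atom l).
  rewrite /atom; case: eqP => [_//|/eqP l0].
  by apply: cpsi; rewrite lt0n l0 /=.
have Hl (l : 'I_(2 ^ n)) : exists NB : nat * R, [/\ 0 <= NB.2, Cc NB.1%:R (atom l),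
    forall x, `|atom l x| <= NB.2,
    forall x y, `|atom l x - atom l y| <= NB.2 * `|x - y| &
    forall h x, `|diffk k h (atom l) x| <= NB.2 * `|h| ^+ k].
  have [N cN] := compact_support_Cc (catom l).
  have [B B0 HB] := Cc_bounded cN.
  have [B1 B10 HB1] := Ck_diffk_bound (Ck_le L1 (proj1 (catom l))) (proj2 cN).
  have [B2 B20 HB2] := Ck_diffk_bound (Ck_le kL (proj1 (catom l))) (proj2 cN).
  exists (N, B + B1 + B2) => /=; split => //.
  - by rewrite !addr_ge0.
  - by move=> x; apply: (le_trans (HB x)); rewrite -addrA lerDl addr_ge0.
  (* The Lipschitz bound is the bound for the first difference with step x - y, centred at the
     midpoint. *)
  - move=> x y; have := HB1 (x - y) (y + 2^-1 *: (x - y)).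
    rewrite /= /diff1 addrK -addrA -scalerDl (_ : 2^-1 + 2^-1 = 1); last by lra.
    rewrite scale1r subrKC expr1 => /le_trans; apply.
    by rewrite ler_wpM2r // addrAC lerDr addr_ge0.
  - move=> h x; apply: (le_trans (HB2 h x)).
    by rewrite ler_wpM2r ?exprn_ge0 // lerDr addr_ge0.
have [NB HNB] := choice Hl.
have NBs l : (NB l).2 <= \sum_l (NB l).2.
  by rewrite (bigD1 l) //= lerDl sumr_ge0 // => i _; case: (HNB i).
exists (\max_l (NB l).1)%N, (\sum_l (NB l).2); split.
- by apply: sumr_ge0 => l _; case: (HNB l).
- move=> l ll; have [_ h _ _ _] := HNB (Ordinal ll); apply: Cc_le h.
  by rewrite ler_nat (leq_bigmax (Ordinal ll)).
- move=> l x ll; have [_ _ h _ _] := HNB (Ordinal ll).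
  exact: (le_trans (h x)).
- move=> l x y ll; have [_ _ _ h _] := HNB (Ordinal ll).
  by apply: (le_trans (h x y)); rewrite ler_wpM2r.
- move=> l h x ll; have [_ _ _ _ H] := HNB (Ordinal ll).
  by apply: (le_trans (H h x)); rewrite ler_wpM2r ?exprn_ge0.
Qed.

(** The L^2 normalisation 2^(jn/2) of level [j]. *)
Definition sc (j : nat) : R := Num.sqrt (2 ^+ (j * n)).

Lemma sc_gt0 j : 0 < sc j.
Proof. by rewrite sqrtr_gt0 exprn_gt0. Qed.

Lemma psiwE w x : in_Omega w ->
  psiw w x = sc w.2.1 * atom w.1 (2 ^+ w.2.1 *: x - zvec R w.2.2).
Proof.
case: w => l [j k] /= [[/= -> ->]|/andP[/= l0 l1]]; rewrite /Defs.psiw /sc /atom /=.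
  by rewrite mul0n expr0 sqrtr1 mul1r scale1r.
by rewrite gtn_eqF.
Qed.

Lemma Omega_lt w : in_Omega w -> (w.1 < 2 ^ n)%N.
Proof. by case=> [[-> _]|/andP[]] //; rewrite expn_gt0. Qed.

Variables (N k : nat) (B : R).
Hypothesis HA : atoms_bounded N k B.

Let B0 : 0 <= B. Proof. by case: HA. Qed.

Lemma psiw_near w x : in_Omega w -> psiw w x != 0 ->
  `|2 ^+ w.2.1 *: x - zvec R w.2.2| <= N%:R.
Proof.
have [_ HC _ _ _] := HA.
move=> Ow; rewrite psiwE //; apply: contraNT; rewrite -ltNge => h.
by rewrite (proj2 (HC _ (Omega_lt Ow))) // mulr0.
Qed.

Lemma psiw_Cc w : in_Omega w ->
  Cc ((N%:R + `|zvec R w.2.2|) / 2 ^+ w.2.1) (psiw w).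
Proof.
have [_ HC _ _ _] := HA; move=> Ow.
have := @Cc_affine R n _ (2 ^+ w.2.1) (zvec R w.2.2) _ _ _ (HC _ (Omega_lt Ow)).
move=> /(_ (ler0n _ _)) /(_ (exprn_gt0 _ (ltr0Sn _ _))) H.
have -> : psiw w = (fun x => sc w.2.1 * atom w.1 (2 ^+ w.2.1 *: x - zvec R w.2.2)).
  by apply/funext => x; rewrite psiwE.
apply: CcMl H; exact: cont_cst.
Qed.

Lemma psiw_cont w : in_Omega w -> continuous (psiw w).
Proof. by move=> /psiw_Cc[]. Qed.

Definition widx (j : nat) (x : V) : seq windex :=
  [seq (l, (j, m)) | l <- iota 0 (2 ^ n), m <- int_near N (2 ^+ j *: x)].

Lemma widx_uniq j x : uniq (widx j x).
Proof.
apply: allpairs_uniq; rewrite ?iota_uniq ?int_near_uniq //.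
by move=> [l m] [l' m'] _ _ /= [-> ->].
Qed.

Lemma size_widx j x : size (widx j x) = (2 ^ n * (2 * N + 2) ^ n)%N.
Proof. by rewrite size_allpairs size_iota size_int_near. Qed.

Lemma mem_widx w x : in_Omega w -> `|2 ^+ w.2.1 *: x - zvec R w.2.2| <= N%:R ->
  w \in widx w.2.1 x.
Proof.
case: w => l [j m] /= Ow h; apply/allpairsP; exists (l, m); split => //=.
  by rewrite mem_iota /= add0n (Omega_lt Ow).
exact: mem_int_near.
Qed.

Lemma widx_level w j x : w \in widx j x -> w.2.1 = j.
Proof. by move=> /allpairsP[[l m] [_ _ ->]]. Qed.

Definition level c j x : R := \sum_(w <- widx j x) c w * psiw w x.

(** The index type also contains junk, such as l = 0 at positive levels; requiring zero coefficients
    there lets sums run over plain lists. *)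
Definition csupp c := forall w, ~ in_Omega w -> c w = 0.

(** The list in [level] depends on [x]. Any list holding the active indices of level [j] gives the
    same value, so one list can serve several points. *)
Lemma level_sup c j x (s : seq windex) : csupp c -> uniq s ->
  (forall w, w \in s -> w.2.1 = j) ->
  (forall w, in_Omega w -> w.2.1 = j -> `|2 ^+ j *: x - zvec R w.2.2| <= N%:R -> w \in s) ->
  level c j x = \sum_(w <- s) c w * psiw w x.
Proof.
move=> Hc us sj Hs; pose F w := if w.2.1 == j then c w * psiw w x else 0.
have -> : level c j x = \sum_(w <- widx j x) F w.
  by apply: eq_big_seq => w /widx_level wj; rewrite /F wj eqxx.
have -> : \sum_(w <- s) c w * psiw w x = \sum_(w <- s) F w.
  by apply: eq_big_seq => w /sj wj; rewrite /F wj eqxx.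
apply: eq_big_support => //; first exact: widx_uniq.
move=> w; rewrite /F; case: (eqVneq w.2.1 j) => [wj|_]; last by rewrite eqxx.
rewrite mulf_eq0 negb_or => /andP[cw pw].
have Ow : in_Omega w by apply: contrapT => /Hc /eqP; apply/negP.
have nr := psiw_near Ow pw; rewrite -{1}wj mem_widx //= Hs //.
by rewrite -wj.
Qed.

(** A finite combination of point evaluations. Values, increments and differences of any order have
    this form, so a single estimate covers them all. *)
Definition Lam (xs : seq (R * V)) (g : V -> R) : R := \sum_(p <- xs) p.1 * g p.2.

Definition Cnt : R := (2 ^ n * (2 * N + 2) ^ n)%N%:R.

Lemma level_functional c j (xs : seq (R * V)) (b : R) : csupp c -> 0 <= b ->
  (forall w, in_Omega w -> w.2.1 = j -> `|c w * Lam xs (psiw w)| <= b) ->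
  `|Lam xs (level c j)| <= (size xs)%:R * Cnt * b.
Proof.
move=> Hc b0 Hb; pose s := undup (flatten [seq widx j p.2 | p <- xs]).
have us : uniq s by exact: undup_uniq.
have sj w : w \in s -> w.2.1 = j.
  by rewrite mem_undup => /flatten_mapP[p _ /widx_level].
have E : Lam xs (level c j) = \sum_(w <- s) c w * Lam xs (psiw w).
  rewrite /Lam; under [RHS]eq_bigr do rewrite mulr_sumr.
  rewrite exchange_big /=; apply: eq_big_seq => p pxs.
  rewrite (level_sup Hc us sj) ?mulr_sumr; last first.
    move=> w Ow wj; rewrite -wj => nr; rewrite mem_undup; apply/flatten_mapP.
    by exists p => //; rewrite -wj; exact: mem_widx.
  by apply: eq_bigr => w _; rewrite mulrCA.
rewrite E (le_trans (ler_norm_sum _ _ _)) //.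
rewrite (@le_trans _ _ (\sum_(w <- s) b)) //.
  rewrite [leLHS]big_seq_cond [leRHS]big_seq_cond.
  apply: ler_sum => w; rewrite andbT => /sj wj.
  have [Ow|nOw] := pselect (in_Omega w); first exact: Hb.
  by rewrite Hc // mul0r normr0.
rewrite big_const_seq count_predT iter_addr addr0 -[b *+ _]mulr_natl ler_wpM2r //.
rewrite -natrM ler_nat (leq_trans (size_undup _)) // size_flatten /shape -map_comp.
elim: xs {s us sj E Hb} => //= p xs IH; rewrite size_widx mulSn leq_add2l.
exact: IH.
Qed.

(** For th = 2^-s this is the size of the coefficients of a function of [Lambda_s]: |c_w| 2^(jn/2)
    <= A 2^(-js). *)
Definition ncoef c (A th : R) := forall w, in_Omega w ->
  `|c w| * sc w.2.1 <= A * th ^+ w.2.1.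

Lemma level_bound c j x (A th : R) : csupp c -> 0 <= A -> 0 <= th -> ncoef c A th ->
  `|level c j x| <= Cnt * (A * B) * th ^+ j.
Proof.
move=> Hc A0 th0 Hn.
have -> : level c j x = Lam [:: (1, x)] (level c j).
  by rewrite /Lam big_seq1 /= mul1r.
have [_ _ HB _ _] := HA.
apply: le_trans (@level_functional c j [:: (1, x)] (A * B * th ^+ j) Hc _ _) _.
- by rewrite !mulr_ge0 // exprn_ge0.
- move=> w Ow wj; rewrite /Lam big_seq1 /= mul1r psiwE // mulrA normrM.
  have -> : A * B * th ^+ j = A * th ^+ j * B by ring.
  rewrite normrM (gtr0_norm (sc_gt0 _)) ler_pM //.
  + by rewrite mulr_ge0 // ltW // sc_gt0.
  + by rewrite -wj; exact: Hn.
  + exact/HB/Omega_lt.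
- by rewrite mul1r !mulrA.
Qed.

Definition syn c x : R := limn (series (fun j => level c j x)).

Section Syn.
Variables (c : windex -> R) (A th : R).
Hypotheses (Hc : csupp c) (A0 : 0 <= A) (th01 : 0 <= th < 1) (Hn : ncoef c A th).

Let th0 : 0 <= th. Proof. by case/andP: th01. Qed.

Lemma syn_tail x J : `|syn c x - \sum_(j < J) level c j x| <=
  Cnt * (A * B) * th ^+ J / (1 - th).
Proof.
apply: series_geometric_bound => //; first by rewrite !mulr_ge0.
by move=> j; exact: level_bound.
Qed.

Lemma syn_bound x : `|syn c x| <= Cnt * (A * B) / (1 - th).
Proof. by have := syn_tail x 0; rewrite big_ord0 subr0 expr0 mulr1. Qed.

(** [ncoef] provides the convergence and makes the tail negligible. The constant comes from the
    decay in the distance to [j0], whose sum over all levels is at most 2 / (1 - q). *)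
Lemma syn_functional (xs : seq (R * V)) (eta q : R) j0 : 0 <= eta -> 0 < q < 1 ->
  (forall w, in_Omega w -> `|c w * Lam xs (psiw w)| <= eta * q ^+ levdist w.2.1 j0) ->
  `|Lam xs (syn c)| <= (size xs)%:R * Cnt * eta * (2 / (1 - q)).
Proof.
move=> eta0 /andP[q0 q1] H; apply/ler_addgt0Pr => e e0.
pose a : R := \sum_(p <- xs) `|p.1|.
have a0 : 0 <= a by apply: sumr_ge0.
have [J HJ] := exists_pow_le (a * (Cnt * (A * B) / (1 - th))) th01 e0.
pose SJ y := \sum_(j < J) level c j y.
have E : Lam xs (syn c) = Lam xs (fun y => syn c y - SJ y) + \sum_(j < J) Lam xs (level c j).
  rewrite /Lam exchange_big /= -big_split /=; apply: eq_bigr => p _.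
  by rewrite -mulr_sumr -mulrDr subrK.
rewrite E addrC (le_trans (ler_normD _ _)) // lerD //.
  rewrite (le_trans (ler_norm_sum _ _ _)) //.
  rewrite (@le_trans _ _ (\sum_(j < J) (size xs)%:R * Cnt * eta * q ^+ levdist j j0)) //.
    apply: ler_sum => j _; rewrite -[leRHS]mulrA; apply: level_functional => //.
      by rewrite mulr_ge0 // exprn_ge0 // ltW.
    by move=> w Ow wj; rewrite -wj; exact: H.
  rewrite -mulr_sumr ler_wpM2l ?mulr_ge0 //.
  by apply: sum_levdist; rewrite q0.
apply: le_trans HJ; rewrite /Lam (le_trans (ler_norm_sum _ _ _)) //.
rewrite /a !mulr_suml; apply: ler_sum => p _.
rewrite normrM -mulrA ler_wpM2l // (le_trans (syn_tail _ _)) //.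
by rewrite mulrAC.
Qed.

Lemma term_lip w (x y : V) : in_Omega w ->
  `|c w * (psiw w x - psiw w y)| <= A * th ^+ w.2.1 * (B * (2 ^+ w.2.1 * `|x - y|)).
Proof.
move=> Ow; have [_ _ _ HL _] := HA.
rewrite !psiwE // -mulrBr [c w * _]mulrA normrM ler_pM //.
  by rewrite normrM (gtr0_norm (sc_gt0 _)); exact: Hn.
apply: le_trans (HL _ _ _ (Omega_lt Ow)) _.
rewrite opprB addrA subrK -scalerBr normrZ gtr0_norm // exprn_gt0 //.
Qed.

Lemma syn_cont : 0 < th -> continuous (syn c).
Proof.
move=> th_gt0; apply/continuous_epsP => x e e0.
have [_ _ HB _ _] := HA.
(* Of the two factors in th = q q, one makes the levels beyond [J] small and the other sums the
   series; below [J] the terms are Lipschitz. *)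
pose q := Num.sqrt th; have q2 : q ^+ 2 = th by rewrite sqr_sqrtr // ltW.
have q0 : 0 < q by rewrite sqrtr_gt0.
have q1 : q < 1 by rewrite -(@ltr_pXn2r _ 2) ?nnegrE ?ltW // q2 expr1n; case/andP: th01.
have qX a b : (a <= b)%N -> q ^+ b <= q ^+ a by move=> ab; rewrite ler_wiXn2l // ltW.
pose D := 2 * Cnt * (2 / (1 - q)).
have D0 : 0 <= D by rewrite /D !mulr_ge0 // invr_ge0 subr_ge0 ltW.
pose eta := e / (D + 1); have eta0 : 0 < eta by rewrite divr_gt0 // ltr_wpDl.
have [J HJ] := @exists_pow_le R q (2 * (A * B)) eta ltac:(by rewrite ltW) eta0.
pose M := A * (B * 2 ^+ J); have M0 : 0 <= M by rewrite !mulr_ge0 // exprn_ge0.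
have M1 : 0 < M + 1 by rewrite ltr_wpDl.
exists (eta * q ^+ J / (M + 1)).
  by rewrite divr_gt0 // mulr_gt0 // exprn_gt0.
move=> y; rewrite ltr_pdivlMr // => xy.
have -> : syn c x - syn c y = Lam [:: (1, x); (-1, y)] (syn c).
  by rewrite /Lam !big_cons big_nil /= mul1r mulN1r addr0.
apply: (@le_lt_trans _ _ (2 * Cnt * eta * (2 / (1 - q)))); last first.
  rewrite mulrAC -/D /eta mulrA ltr_pdivrMr ?ltr_wpDl // mulrC ltr_pM2l //.
  by rewrite ltrDl.
apply: (@syn_functional [:: (1, x); (-1, y)] eta q 0) => //; [exact: ltW|by rewrite q0|].
move=> w Ow; rewrite /Lam !big_cons big_nil /= mul1r mulN1r addr0 /levdist subn0 addn0.
set j := w.2.1; have [jJ|Jj] := ltnP j J.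
  apply: le_trans (term_lip _ _ Ow) _; rewrite -/j.
  rewrite (@le_trans _ _ (M * `|x - y|)) //.
    rewrite /M -!mulrA ler_wpM2l // mulrCA ler_wpM2l // mulrA ler_wpM2r //.
    rewrite -[leRHS]mul1r ler_pM ?exprn_ge0 // ?exprn_ile1 //; last first.
      by rewrite ler_weXn2l ?ler1n // ltnW.
    by case/andP: th01 => _ /ltW.
  rewrite (@le_trans _ _ (eta * q ^+ J)) //.
    apply: le_trans (ltW xy); rewrite mulrC ler_wpM2l //.
    by rewrite lerDl.
  by rewrite ler_pM2l // qX // ltnW.
rewrite !psiwE // -mulrBr mulrA normrM.
rewrite (@le_trans _ _ (A * th ^+ j * (2 * B))) //.
  rewrite ler_pM //; first by rewrite normrM (gtr0_norm (sc_gt0 _)); exact: Hn.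
  by rewrite (le_trans (ler_normB _ _)) // mulr_natl mulr2n lerD // HB // Omega_lt.
have -> : A * th ^+ j * (2 * B) = 2 * (A * B) * q ^+ j * q ^+ j.
  by rewrite -q2 -exprM mulnC exprM expr2; ring.
rewrite ler_pM2r ?exprn_gt0 //; apply: le_trans HJ.
by rewrite ler_wpM2l ?mulr_ge0 // qX.
Qed.

End Syn.
End Synthesis.

(** * Dyadic scales and two-sided decay *)

Section DyadicScales.
Variable R : realType.

Lemma sideE j : side R j = 2^-1 ^+ j.
Proof. by rewrite /side exprVn. Qed.

Lemma side_gt0 j : 0 < side R j.
Proof. by rewrite sideE exprn_gt0 // invr_gt0. Qed.

Lemma dyadic_level (y : R) : 0 < y <= 1 -> exists j, side R j / 2 < y <= side R j.
Proof.
move=> /andP[y0 y1].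
have h01 : 0 <= (2^-1 : R) < 1 by rewrite invr_ge0 ler0n /= invf_lt1 // ltr1n.
have [J HJ] := @exists_pow_le R 2^-1 1 (y / 2) h01 ltac:(by rewrite divr_gt0).
have ex : exists j, side R j / 2 < y.
  by exists J; move: HJ; rewrite mul1r -sideE; have := side_gt0 J; lra.
exists (ex_minn ex); case: ex_minnP => -[|j] /= jy jmin.
  by rewrite jy /side expr0 invr1.
rewrite jy /= leNgt; apply/negP => yj.
have : (j.+1 <= j)%N; last by rewrite ltnn.
by apply: jmin; move: yj; rewrite !sideE exprS; lra.
Qed.

Section Decay.
Variables (s : R) (k : nat).
Hypotheses (s0 : 0 < s) (sk : s < k%:R).

Definition thS : R := powR 2^-1 s.
(** The worse of two rates: 2^-s on levels finer than the step, from the size of the coefficients,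
    and 2^-(k-s) on coarser ones, from the smoothness of the atoms. *)
Definition qS : R := Num.max thS (powR 2^-1 (k%:R - s)).

Lemma thS_bounds : 0 < thS < 1.
Proof. exact: powR_half_lt1. Qed.

Lemma qS_bounds : 0 < qS < 1.
Proof.
have /andP[t0 t1] := thS_bounds.
have /andP[p0 p1] : 0 < powR 2^-1 (k%:R - s) < 1.
  by apply: powR_half_lt1; rewrite subr_gt0.
by rewrite /qS lt_max t0 /= gt_max t1.
Qed.

Lemma thS_side j : thS ^+ j = powR (side R j) s.
Proof. by rewrite sideE powR_half_exp. Qed.

Lemma thS_mul : thS * powR 2^-1 (k%:R - s) = 2^-1 ^+ k.
Proof.
have h0 : (0 : R) < 2^-1 by rewrite invr_gt0.
have E : s + (k%:R - s) = k%:R by ring.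
rewrite /thS -powRD; last by rewrite (gt_eqF h0) implybT.
by rewrite E powR_mulrn // ltW.
Qed.

(** [b] stands for the difference, with a step of length [y], of an atom of level [j]. The trivial
    bound is used for j >= j0 and the smoothness bound for j < j0. *)
Lemma scale_decay (b Br y : R) j j0 : 0 <= Br -> 0 <= b -> b <= Br ->
  b <= Br * (2 ^+ j * y) ^+ k -> 0 <= y <= side R j0 ->
  thS ^+ j * b <= Br * thS ^+ j0 * qS ^+ levdist j j0.
Proof.
move=> Br0 b0 b1 b2 /andP[y0 yj].
have /andP[t0 t1] := thS_bounds; have /andP[q0 q1] := qS_bounds.
have tq : thS <= qS by rewrite /qS le_max lexx.
have pq : powR 2^-1 (k%:R - s) <= qS by rewrite /qS le_max lexx orbT.
have [jj|jj] := leqP j0 j.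
  rewrite (levdist_ge jj) -{1}(subnKC jj) exprD mulrC mulrA ler_pM //.
  - by rewrite mulr_ge0 // exprn_ge0 // ltW.
  - by rewrite exprn_ge0 // ltW.
  - by rewrite ler_wpM2r // exprn_ge0 // ltW.
  - by apply: lerXn2r => //; rewrite nnegrE ltW.
rewrite (levdist_le (ltnW jj)).
set d := (j0 - j)%N; have j0E : j0 = (j + d)%N by rewrite /d subnKC // ltnW.
have b3 : b <= Br * (2^-1 ^+ k) ^+ d.
  apply: le_trans b2 _; rewrite ler_wpM2l // -exprM mulnC exprM.
  apply: lerXn2r; rewrite ?nnegrE ?exprn_ge0 ?invr_ge0 ?mulr_ge0 //.
  apply: (@le_trans _ _ (2 ^+ j * side R j0)); first by rewrite ler_wpM2l.
  by rewrite sideE j0E exprD mulrA -exprMn mulfV ?pnatr_eq0 // expr1n mul1r.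
apply: (@le_trans _ _ (thS ^+ j * (Br * (2^-1 ^+ k) ^+ d))).
  by rewrite ler_wpM2l // exprn_ge0 // ltW.
rewrite -thS_mul exprMn j0E exprD.
have -> : thS ^+ j * (Br * (thS ^+ d * powR 2^-1 (k%:R - s) ^+ d)) =
  Br * (thS ^+ j * thS ^+ d) * powR 2^-1 (k%:R - s) ^+ d by ring.
rewrite ler_wpM2l ?mulr_ge0 ?exprn_ge0 // ?(ltW t0) //.
by apply: lerXn2r => //; rewrite nnegrE ?powR_ge0 // ltW.
Qed.

End Decay.
End DyadicScales.

(** * Differences of a wavelet series *)

Section SynDifferences.
Variables (R : realType) (n : nat) (phi : 'rV[R]_n -> R) (psi : nat -> 'rV[R]_n -> R).
Local Notation V := 'rV[R]_n.
Local Notation windex := (windex n).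
Local Notation psiw := (psiw phi psi).
Variables (N k : nat) (B : R).
Hypothesis HA : atoms_bounded phi psi N k B.
Implicit Types (w : windex) (c : windex -> R).
Local Notation syn := (syn phi psi N).

Definition dxs (r : nat) (h x : V) : seq (R * V) :=
  [seq ((-1) ^+ (r - i) * 'C(r, i)%:R, x + (i%:R - r%:R / 2) *: h) | i <- iota 0 r.+1].

Lemma Lam_dxs r h x g : Lam (dxs r h x) g = diffk r h g x.
Proof. by rewrite /Lam big_map /= diffkE -(big_mkord xpredT (fun i =>
  (-1) ^+ (r - i) * 'C(r, i)%:R * g (x + (i%:R - r%:R / 2) *: h))). Qed.

Lemma size_dxs r h x : size (dxs r h x) = r.+1.
Proof. by rewrite size_map size_iota. Qed.

Lemma diffk_psiw r h w x : in_Omega w -> diffk r h (psiw w) x =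
  sc R n w.2.1 * diffk r (2 ^+ w.2.1 *: h) (atom phi psi w.1) (2 ^+ w.2.1 *: x - zvec R w.2.2).
Proof.
move=> Ow; have -> : psiw w = (fun y => sc R n w.2.1 *
    (fun z => atom phi psi w.1 (2 ^+ w.2.1 *: z + (- zvec R w.2.2))) y).
  by apply/funext => y; rewrite psiwE.
by rewrite -diffk_affine !diffkE mulr_sumr; apply: eq_bigr => i _; rewrite mulrCA.
Qed.

Lemma atom_diff r l h x : (k <= r)%N -> (l < 2 ^ n)%N ->
  `|diffk r h (atom phi psi l) x| <= 2 ^+ r * B /\
  `|diffk r h (atom phi psi l) x| <= 2 ^+ r * B * `|h| ^+ k.
Proof.
have [B0 _ HB _ Hk] := HA; move=> kr ll; split.
  by apply: diffk_le_bound => y; exact: HB.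
rewrite -{1}(subnK kr); have H y : `|diffk k h (atom phi psi l) y| <= B * `|h| ^+ k.
  exact: Hk.
apply: le_trans (@diffk_add_bound _ _ k (r - k) h _ _ H x) _.
rewrite mulrA ler_wpM2r ?exprn_ge0 // ler_wpM2r // ler_weXn2l ?ler1n //.
exact: leq_subr.
Qed.

Variable s : R.
Hypotheses (s0 : 0 < s) (sk : s < k%:R).
Local Notation th := (thS s).
Local Notation q := (qS s k).

Lemma term_diff c r h x w (a : R) j0 : (k <= r)%N -> in_Omega w -> 0 <= a ->
  `|c w| * sc R n w.2.1 <= a * th ^+ w.2.1 -> enorm h <= side R j0 ->
  `|c w * diffk r h (psiw w) x| <= a * (2 ^+ r * B) * th ^+ j0 * q ^+ levdist w.2.1 j0.
Proof.
have [B0 _ _ _ _] := HA; move=> kr Ow a0 Ha hj.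
rewrite diffk_psiw // mulrA !normrM (gtr0_norm (sc_gt0 _ _ _)).
have [b1 b2] := atom_diff (2 ^+ w.2.1 *: h) (2 ^+ w.2.1 *: x - zvec R w.2.2) kr (Omega_lt Ow).
set b := `|diffk _ _ _ _| in b1 b2 *.
apply: (@le_trans _ _ (a * th ^+ w.2.1 * b)); first by rewrite ler_wpM2r // /b.
have -> : a * (2 ^+ r * B) * th ^+ j0 * q ^+ levdist w.2.1 j0 =
  a * (2 ^+ r * B * th ^+ j0 * q ^+ levdist w.2.1 j0) by ring.
rewrite -mulrA ler_wpM2l //; apply: (@scale_decay R s k s0 sk b _ (enorm h)) => //.
- by rewrite mulr_ge0 // exprn_ge0.
- rewrite /b; exact: normr_ge0.
- apply: le_trans b2 _; rewrite ler_wpM2l ?mulr_ge0 ?exprn_ge0 //.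
  apply: lerXn2r; rewrite ?nnegrE ?mulr_ge0 ?exprn_ge0 ?enorm_ge0 //.
  rewrite normrZ gtr0_norm ?exprn_gt0 // ler_wpM2l ?exprn_ge0 //.
  exact: norm_le_enorm.
- by rewrite enorm_ge0.
Qed.

Lemma Cnt_ge0 : 0 <= Cnt R n N.
Proof. exact: ler0n. Qed.

(** Replacing the side of the strip by [y] loses less than a factor 2, hence at most 2^s = th^-1
    here. *)
Lemma thS_le_powR (y : R) j : side R j / 2 < y -> th ^+ j <= th^-1 * powR y s.
Proof.
move=> jy; have /andP[t0 _] := thS_bounds s0.
rewrite ler_pdivlMl // -exprS thS_side.
have y0 : 0 < y by apply: lt_trans jy; rewrite divr_gt0 // side_gt0.
rewrite ge0_ler_powR ?nnegrE ?(ltW s0) ?(ltW y0) ?(ltW (side_gt0 _ _)) //.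
by rewrite (le_trans _ (ltW jy)) // !sideE exprS; lra.
Qed.

Definition Cdiff (r : nat) : R :=
  r.+1%:R * Cnt R n N * (2 ^+ r * B) * (2 / (1 - q)) * th^-1.

Lemma Cdiff_ge0 r : 0 <= Cdiff r.
Proof.
have [B0 _ _ _ _] := HA.
have /andP[t0 _] := thS_bounds s0; have /andP[_ q1] := qS_bounds s0 sk.
by rewrite /Cdiff !mulr_ge0 // ?exprn_ge0 // invr_ge0 ?subr_ge0 ltW.
Qed.

Lemma syn_diff c (A : R) r h x : csupp c -> 0 <= A -> ncoef c A th -> (k <= r)%N ->
  0 < enorm h <= 1 -> `|diffk r h (syn c) x| <= Cdiff r * A * powR (enorm h) s.
Proof.
move=> Hc A0 Hn kr h01; have [j0 /andP[jh hj]] := dyadic_level h01.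
have [B0 _ _ _ _] := HA.
have /andP[t0 t1] := thS_bounds s0; have /andP[q0 q1] := qS_bounds s0 sk.
have th01 : 0 <= th < 1 by rewrite ltW.
rewrite -Lam_dxs.
have eta0 : 0 <= A * (2 ^+ r * B) * th ^+ j0.
  by rewrite !mulr_ge0 ?exprn_ge0 // ltW.
have := @syn_functional _ _ _ _ _ _ _ HA c A th Hc A0 th01 Hn (dxs r h x) _ q j0 eta0 _ _.
rewrite size_dxs => /(_ (qS_bounds s0 sk)) H.
apply: le_trans (H _) _.
  by move=> w Ow; rewrite Lam_dxs; apply: term_diff => //; exact: Hn.
pose X : R := r.+1%:R * Cnt R n N * (2 ^+ r * B) * (2 / (1 - q)).
have X0 : 0 <= X.
  by rewrite /X !mulr_ge0 ?exprn_ge0 // invr_ge0 subr_ge0 ltW.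
rewrite (_ : _ * _ * _ * _ = X * A * th ^+ j0); last by rewrite /X; ring.
rewrite (_ : Cdiff r * A * _ = X * A * (th^-1 * powR (enorm h) s)).
  by apply: ler_wpM2l; [exact: mulr_ge0|exact: thS_le_powR].
by rewrite /Cdiff -/X; ring.
Qed.

Lemma syn_local c (A eta q' : R) r h x j0 : csupp c -> 0 <= A -> ncoef c A th ->
  0 <= eta -> 0 < q' < 1 ->
  (forall w, in_Omega w ->
    `|c w * diffk r h (psiw w) x| <= eta * q' ^+ levdist w.2.1 j0) ->
  `|diffk r h (syn c) x| <= r.+1%:R * Cnt R n N * eta * (2 / (1 - q')).
Proof.
move=> Hc A0 Hn eta0 q'01 H; have /andP[t0 t1] := thS_bounds s0.
have th01 : 0 <= th < 1 by rewrite ltW.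
rewrite -Lam_dxs -[in r.+1%:R](size_dxs r h x).
apply: (syn_functional HA Hc A0 th01 Hn eta0 q'01) => w Ow.
by rewrite Lam_dxs; exact: H.
Qed.

End SynDifferences.

(** * Integrating a wavelet series term by term *)

Section Pairing.
Variables (R : realType) (n : nat) (phi : 'rV[R]_n -> R) (psi : nat -> 'rV[R]_n -> R).
Local Notation V := 'rV[R]_n.
Local Notation windex := (windex n).
Local Notation psiw := (psiw phi psi).
Variables (N k : nat) (B : R).
Hypothesis HA : atoms_bounded phi psi N k B.
Implicit Types (w : windex).
Local Notation syn := (syn phi psi N).

(** One list for a whole ball, in contrast to [widx]: integrals against a function supported in the
    ball are thereby exchanged with finite sums. *)
Definition wbox (rho : R) (j : nat) : seq windex :=
  [seq (l, (j, m)) | l <- iota 0 (2 ^ n),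
     m <- int_near (N + (Num.truncn (2 ^+ j * rho)).+1) (0 : V)].

Lemma wbox_uniq rho j : uniq (wbox rho j).
Proof.
apply: allpairs_uniq; rewrite ?iota_uniq ?int_near_uniq //.
by move=> [l m] [l' m'] _ _ /= [-> ->].
Qed.

Lemma wbox_level rho j w : w \in wbox rho j -> w.2.1 = j.
Proof. by move=> /allpairsP[[l m] [_ _ ->]]. Qed.

Lemma mem_wbox (rho : R) w (x : V) : in_Omega w -> `|x| <= rho ->
  `|2 ^+ w.2.1 *: x - zvec R w.2.2| <= N%:R -> w \in wbox rho w.2.1.
Proof.
case: w => l [j m] /= Ow xr h; apply/allpairsP; exists (l, m); split => //=.
  by rewrite mem_iota /= add0n (Omega_lt Ow).
apply: mem_int_near; rewrite sub0r normrN natrD.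
have -> : zvec R m = - (2 ^+ j *: x - zvec R m) + 2 ^+ j *: x.
  by rewrite opprB subrK.
rewrite (le_trans (ler_normD _ _)) // normrN lerD // normrZ gtr0_norm ?exprn_gt0 //.
apply: (@le_trans _ _ (2 ^+ j * rho)); first by rewrite ler_wpM2l ?exprn_ge0.
by rewrite ltW // truncnS_gt.
Qed.

Section Pair.
Variables (c : windex -> R) (A th rho : R) (u : V -> R).
Hypotheses (Hc : csupp c) (A0 : 0 <= A) (th01 : 0 < th < 1) (Hn : ncoef c A th).
Hypotheses (rho0 : 0 <= rho) (Cu : Cc rho u).

Let th0 : 0 <= th < 1.
Proof. by case/andP: th01 => /ltW -> ->. Qed.

(** The partial sums converge uniformly and [u] has compact support. As [J] can be taken beyond any
    [J0], [syn_pair_eq] needs the value of the partial sums only eventually. *)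
Lemma syn_pair_approx (e : R) J0 : 0 < e -> exists2 J, (J0 <= J)%N &
  `|rint (fun x => syn c x * u x) -
    \sum_(j < J) \sum_(w <- wbox rho j) c w * rint (fun x => psiw w x * u x)| <= e.
Proof.
move=> e0; have [Bu Bu0 HBu] := Cc_bounded Cu.
have [B0 _ _ _ _] := HA.
have /andP[t0 t1] := th01.
pose K := Cnt R n N * (A * B) / (1 - th) * Bu * (2 * rho) ^+ n.
have [J1 HJ1] := @exists_pow_le R th K e th0 e0.
pose J := maxn J0 J1; exists J; first exact: leq_maxl.
(* Continuity is known for true indices only, so the others are replaced by 0; their coefficients
   vanish anyway. *)
pose g w : V -> R := if pselect (in_Omega w) then psiw w else fun=> 0.
have cg w : Cc rho (fun x => g w x * u x).
  apply: CcMl => //; rewrite /g; case: pselect => // Ow; last exact: cont_cst.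
  exact: (psiw_cont HA).
have cgE w x : c w * psiw w x = c w * g w x.
  by rewrite /g; case: pselect => // nOw; rewrite (Hc nOw) !mul0r.
pose W := [seq w | j <- iota 0 J, w <- wbox rho j].
have E1 x : (\sum_(j < J) level phi psi N c j x) * u x = \sum_(w <- W) c w * (g w x * u x).
  rewrite /W big_allpairs_dep -(big_mkord xpredT (fun j => level phi psi N c j x)) /index_iota subn0.
  rewrite mulr_suml; apply: eq_bigr => j _.
  have [xr|xr] := leP `|x| rho; last first.
    by rewrite (proj2 Cu) // mulr0 big1 // => w _; rewrite !mulr0.
  rewrite (level_sup HA Hc (wbox_uniq rho j)); last first.
  - by move=> w Ow wj; rewrite -wj => nr; exact: mem_wbox nr.
  - by move=> w; exact: wbox_level.
  by rewrite mulr_suml; apply: eq_bigr => w _; rewrite cgE mulrA.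
have [CW EW] := rint_sum W c rho0 cg.
have E2 : \sum_(j < J) \sum_(w <- wbox rho j) c w * rint (fun x => psiw w x * u x) =
    rint (fun x => \sum_(w <- W) c w * (g w x * u x)).
  rewrite EW /W big_allpairs_dep /= -(big_mkord xpredT (fun j =>
    \sum_(w <- wbox rho j) c w * rint (fun x => psiw w x * u x))) /index_iota subn0.
  apply: eq_bigr => j _; apply: eq_bigr => w _.
  by rewrite /g; case: pselect => // nOw; rewrite (Hc nOw) !mul0r.
have Cs : Cc rho (fun x => syn c x * u x).
  by apply: CcMl => //; exact: (syn_cont HA Hc A0 th0 Hn t0).
have -> : rint (fun x => syn c x * u x) -
    \sum_(j < J) \sum_(w <- wbox rho j) c w * rint (fun x => psiw w x * u x) =
  rint (fun x => -1 * (\sum_(w <- W) c w * (g w x * u x)) + syn c x * u x).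
  by rewrite (rintD _ rho0) // -E2 mulN1r addrC.
apply: (@le_trans _ _ (Cnt R n N * (A * B) * th ^+ J / (1 - th) * Bu * (2 * rho) ^+ n)).
  apply: rint_bound => //; first exact: CcD.
  move=> x; rewrite -E1 mulN1r addrC -mulrBl normrM ler_pM //.
  exact: (syn_tail HA Hc A0 th0 Hn).
apply: le_trans HJ1; rewrite /K.
have -> : Cnt R n N * (A * B) * th ^+ J / (1 - th) * Bu * (2 * rho) ^+ n =
  Cnt R n N * (A * B) / (1 - th) * Bu * (2 * rho) ^+ n * th ^+ J by ring.
rewrite ler_wpM2l ?mulr_ge0 ?exprn_ge0 ?mulr_ge0 ?Cnt_ge0 //.
  by rewrite invr_ge0 subr_ge0 ltW.
by rewrite ler_wiXn2l ?leq_maxr // ltW.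
Qed.

Lemma syn_pair_eq (T : R) J0 :
  (forall J, (J0 <= J)%N -> \sum_(j < J) \sum_(w <- wbox rho j)
      c w * rint (fun x => psiw w x * u x) = T) ->
  rint (fun x => syn c x * u x) = T.
Proof.
move=> H; apply/eqP; rewrite -subr_eq0 -normr_eq0 eq_le normr_ge0 andbT.
apply/ler_addgt0Pr => e e0; rewrite add0r.
by have [J J0J] := syn_pair_approx J0 e0; rewrite H.
Qed.

Lemma syn_pair0 :
  (forall w, in_Omega w -> c w * rint (fun x => psiw w x * u x) = 0) ->
  rint (fun x => syn c x * u x) = 0.
Proof.
move=> H; apply: (@syn_pair_eq _ 0) => J _; rewrite big1 // => j _; rewrite big1 // => w _.
have [Ow|nOw] := pselect (in_Omega w); first exact: H.
by rewrite (Hc nOw) mul0r.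
Qed.

End Pair.

Lemma syn_coef c (A th : R) w0 : csupp c -> 0 <= A -> 0 < th < 1 -> ncoef c A th ->
  (forall w w' : windex, in_Omega w -> in_Omega w' ->
     intn (fun x => (psiw w x * psiw w' x)%:E) = (if w == w' then 1 else 0)%:E) ->
  in_Omega w0 -> rint (fun x => syn c x * psiw w0 x) = c w0.
Proof.
move=> Hc A0 th01 Hn ortho Ow0.
have Cw := psiw_Cc HA Ow0; set rho := _ / _ in Cw.
have rho0 : 0 <= rho by rewrite divr_ge0 ?addr_ge0 ?exprn_ge0.
have w0box : w0 \in wbox rho w0.2.1.
  apply: (@mem_wbox rho w0 ((2 ^+ w0.2.1)^-1 *: zvec R w0.2.2)) => //.
    rewrite normrZ gtr0_norm ?invr_gt0 ?exprn_gt0 // mulrC /rho.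
    by rewrite ler_pM2r ?invr_gt0 ?exprn_gt0 // lerDr.
  by rewrite scalerA mulfV ?scale1r ?subrr ?normr0 // expf_neq0 // pnatr_eq0.
have cE w : c w * rint (fun x => psiw w x * psiw w0 x) = if w == w0 then c w else 0.
  have [Ow|nOw] := pselect (in_Omega w); last by rewrite Hc // mul0r if_same.
  by rewrite /rint ortho //=; case: eqP => _; rewrite ?mulr1 ?mulr0.
apply: (@syn_pair_eq c A th rho (psiw w0) Hc A0 th01 Hn rho0 Cw (c w0) w0.2.1.+1).
move=> J jJ; rewrite (bigD1 (Ordinal jJ)) //= [X in _ + X]big1 ?addr0.
  rewrite (bigD1_seq w0) ?wbox_uniq //= cE eqxx big1 ?addr0 // => w ww0.
  by rewrite cE (negbTE ww0).
move=> j jw0; rewrite big1_seq // => w /andP[_ /wbox_level wj]; rewrite cE.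
case: eqP => // ww0; move: jw0; rewrite -val_eqE /= -wj ww0 eqxx //.
Qed.

End Pairing.

(** * Dyadic cubes and measurability *)

Section Cubes.
Variables (R : realType) (n : nat).
Local Notation V := 'rV[R]_n.

Definition cubeidx (j : nat) (x : V) : 'rV[int]_n := \row_i Num.floor (2 ^+ j * x ord0 i).

Lemma cubeP j k (x : V) : cube j k x <-> cubeidx j x = k.
Proof.
have E i (m : int) : (m%:~R / 2 ^+ j <= x ord0 i < (m + 1)%:~R / 2 ^+ j) =
    (Num.floor (2 ^+ j * x ord0 i) == m).
  by rewrite floor_eq ler_pdivrMr ?exprn_gt0 // ltr_pdivlMr ?exprn_gt0 // mulrC.
split=> [H|<- i]; last by rewrite E mxE.
by apply/rowP => i; rewrite mxE; apply/eqP; rewrite -E; exact: H.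
Qed.

Lemma cube_box j k : cube (R := R) j k =
  box (\row_i ((k ord0 i)%:~R / 2 ^+ j)) (\row_i ((k ord0 i + 1)%:~R / 2 ^+ j)) :> set V.
Proof. by apply/seteqP; split => x H i; have := H i; rewrite !mxE. Qed.

Lemma cube_dist j k (x y : V) : cube j k x -> cube j k y -> `|x - y| <= side R j.
Proof.
move=> Hx Hy; apply/rV_normP => [|i]; first exact/ltW/side_gt0.
have := Hx i; have := Hy i; rewrite !mxE intrD mulrDl mul1r -/(side R j).
move=> /andP[h1 h2] /andP[h3 h4]; rewrite ler_norml; apply/andP; split; lra.
Qed.

Lemma rmeasurable_box (a b : V) : rmeasurable (box a b).
Proof.
rewrite /rmeasurable.
have -> : [set t : n.-tuple R | box a b (rowt t)] =
    \bigcap_(i in [set: 'I_n]) ((@tnth n R)^~ i @^-1` `[a ord0 i, b ord0 i[%classic).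
  by apply/seteqP; split => t H i; have := H i; rewrite /= in_itv /= mxE // => /(_ I).
apply: fin_bigcap_measurable => // i _; rewrite -[X in measurable X]setTI.
apply: measurable_tnth => //; exact: measurable_itv.
Qed.

Lemma hmeasurable_prod (A : set V) (D : set R) : rmeasurable A -> measurable D ->
  hmeasurable [set p | A p.1 /\ D p.2].
Proof. by move=> mA mD; exact: (measurableX mA mD). Qed.

Lemma hmeasurable_bigcup (I : countType) (F : I -> set (V * R)) :
  (forall i, hmeasurable (F i)) -> hmeasurable [set p | exists i, F i p].
Proof.
move=> mF; rewrite /hmeasurable.
have -> : [set p : n.-tuple R * R | [set p | exists i, F i p] (rowt p.1, p.2)] =
    \bigcup_i [set p : n.-tuple R * R | F i (rowt p.1, p.2)].
  by apply/seteqP; split => [p [i Fi]|p [i _ Fi]]; exists i.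
exact: countable_bigcupT_measurable.
Qed.

Lemma hmeasurableI (A D : set (V * R)) :
  hmeasurable A -> hmeasurable D -> hmeasurable (A `&` D).
Proof. exact: measurableI. Qed.

Lemma hmeasurableU (A D : set (V * R)) :
  hmeasurable A -> hmeasurable D -> hmeasurable (A `|` D).
Proof. exact: measurableU. Qed.

Lemma hmeasurable0 : hmeasurable (set0 : set (V * R)).
Proof.
by rewrite /hmeasurable (_ : [set p | _] = set0) //; apply/seteqP; split.
Qed.

Lemma exists_side_lt (e : R) : 0 < e -> exists j, side R j < e.
Proof.
move=> e0; have h01 : 0 <= (2^-1 : R) < 1 by rewrite invr_ge0 ler0n /= invf_lt1 // ltr1n.
have [J HJ] := @exists_pow_le R 2^-1 1 (e / 2) h01 ltac:(by rewrite divr_gt0).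
by exists J; rewrite sideE; move: HJ; rewrite mul1r; lra.
Qed.

(** Measurability refers to the sigma-algebra of tuples, so an open set is exhibited as the
    countable union of the dyadic boxes that it contains. *)
Lemma hmeasurable_eopen (U : set (V * R)) :
  (forall p, U p -> exists2 e : R, 0 < e &
     forall q, `|p.1 - q.1| < e -> `|p.2 - q.2| < e -> U q) -> hmeasurable U.
Proof.
move=> HU.
pose Q (i : nat * ('rV[int]_n * int)) : set (V * R) := [set p | cube i.1 i.2.1 p.1 /\
  `[(i.2.2)%:~R / 2 ^+ i.1, (i.2.2 + 1)%:~R / 2 ^+ i.1[%classic p.2].
pose F i := if pselect (Q i `<=` U) then Q i else set0.
have -> : U = [set p | exists i, F i p].
  apply/seteqP; split => [p Up|p [i]]; last first.
    by rewrite /F; case: pselect => // QU /QU.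
  have [e e0 He] := HU p Up; have [j je] := exists_side_lt e0.
  exists (j, (cubeidx j p.1, Num.floor (2 ^+ j * p.2))).
  have Qp : Q (j, (cubeidx j p.1, Num.floor (2 ^+ j * p.2))) p.
    split; first exact/cubeP.
    rewrite /= in_itv /= ler_pdivrMr ?exprn_gt0 // ltr_pdivlMr ?exprn_gt0 //.
    by rewrite mulrC; exact: floor_itv.
  rewrite /F; case: pselect => // -[]; move=> q [/= q1 q2]; apply: He.
    by apply: le_lt_trans je; apply: (cube_dist _ q1); exact/cubeP.
  move: Qp => [_]; move: q2; rewrite /= !in_itv /= intrD mulrDl mul1r -/(side R j).
  move=> /andP[h1 h2] /andP[h3 h4]; rewrite ltr_norml.
  by apply/andP; split; lra.
apply: hmeasurable_bigcup => i; rewrite /F; case: pselect => QU /=; last exact: hmeasurable0.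
apply: hmeasurable_prod; last exact: measurable_itv.
by rewrite cube_box; exact: rmeasurable_box.
Qed.

Lemma rmeasurable_eopen (U : set V) :
  (forall x, U x -> exists2 e : R, 0 < e & forall y, `|x - y| < e -> U y) ->
  rmeasurable U.
Proof.
move=> HU; have mU : hmeasurable [set p : V * R | U p.1].
  apply: hmeasurable_eopen => p /HU[e e0 He]; exists e => // q pq _; exact: He.
have mf : measurable_fun [set: n.-tuple R] (fun t => (t, 0 : R)).
  by apply: measurable_fun_pair => //; exact: measurable_cst.
by have := mf measurableT _ mU; rewrite setTI.
Qed.

Lemma continuous_rmeasurable (f : V -> R) : continuous f -> rmeasurable_rfun f.
Proof.
move=> /continuous_epsP cf.
have mf : measurable_fun [set: n.-tuple R] (fun t => f (rowt t)).
  apply: (measurability _ (RGenOInfty.measurableE R)).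
  move=> _ [_ [a ->] <-]; rewrite setTI.
  have := @rmeasurable_eopen [set x | a < f x] _.
  rewrite /rmeasurable (_ : _ @^-1` _ = [set t | [set x | a < f x] (rowt t)]); last first.
    by apply/seteqP; split => t /=; rewrite in_itv /= andbT.
  apply=> x /= ax; have [d d0 Hd] := cf x (f x - a) ltac:(by rewrite subr_gt0).
  by exists d => // y /Hd; rewrite ltr_norml => /andP[_]; lra.
have mef : measurable_fun [set: n.-tuple R] (fun t => (f (rowt t))%:E).
  by apply/measurable_EFinP.
by move=> D mD; have := mef measurableT D mD; rewrite setTI.
Qed.

Lemma ae_zero_continuous (g : V -> R) : continuous g -> ae (fun x => g x = 0) ->
  forall x, g x = 0.
Proof.
move=> /continuous_epsP cg [D [_ [D0 HD]]] x; apply: contrapT => gx0.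
have gx : 0 < `|g x| by rewrite normr_gt0; apply/eqP.
have [d d0 Hd] := cg x _ gx.
pose a : V := \row_i (x ord0 i - d / 2); pose b : V := \row_i (x ord0 i + d / 2).
have ab i : a ord0 i <= b ord0 i by rewrite !mxE; lra.
have sub : box a b `<=` D.
  move=> y Hy; apply: contrapT => /HD gy; have := Hd y; rewrite gy subr0 ltxx.
  suff xy : `|x - y| < d by move=> /(_ xy).
  apply: (@le_lt_trans _ _ (d / 2)); last by lra.
  apply/rV_normP => [|i]; first by lra.
  have := Hy i; rewrite !mxE => /andP[h1 h2]; rewrite ler_norml; apply/andP; split; lra.
have := lebn_ge_box ab sub; rewrite D0 lee_fin leNgt => /negP; apply.
by apply: prodr_gt0 => i _; rewrite !mxE; lra.
Qed.

End Cubes.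

(** * From completeness in L^2 to continuous functions *)

Section Completeness.
Variables (R : realType) (n L : nat) (phi : 'rV[R]_n -> R) (psi : nat -> 'rV[R]_n -> R).
Local Notation V := 'rV[R]_n.
Local Notation windex := (windex n).
Local Notation psiw := (psiw phi psi).
Variables (N k : nat) (B : R).
Hypothesis HA : atoms_bounded phi psi N k B.
Hypothesis HD : daubechies L phi psi.
Implicit Types (w : windex).
Local Notation syn := (syn phi psi N).

Definition coef (f : V -> R) w : R :=
  if pselect (in_Omega w) then rint (fun x => f x * psiw w x) else 0.

Lemma coef_rint f w : in_Omega w -> coef f w = rint (fun x => f x * psiw w x).
Proof. by rewrite /coef; case: pselect. Qed.

Lemma coef_csupp f : csupp (coef f).
Proof. by move=> w; rewrite /coef; case: pselect. Qed.

(** Substitution y = 2^j x - m: the two factors 2^(jn/2) cancel against the Jacobian 2^(-jn). *)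
Lemma coef_scale f w : continuous f -> in_Omega w ->
  coef f w * sc R n w.2.1 =
  rint (fun y => f ((2 ^+ w.2.1)^-1 *: (y + zvec R w.2.2)) * atom phi psi w.1 y).
Proof.
move=> cf Ow; rewrite coef_rint //; have [_ HC _ _ _] := HA.
set a : R := 2 ^+ w.2.1; have a0 : 0 < a by rewrite exprn_gt0.
pose G y := f (a^-1 *: (y + zvec R w.2.2)) * atom phi psi w.1 y.
have cG : Cc N%:R G.
  apply: CcMl; last exact/HC/Omega_lt.
  have := @cont_affine R _ f a^-1 (a^-1 *: zvec R w.2.2) cf.
  by under eq_fun do rewrite -scalerDr.
have -> : (fun x => f x * psiw w x) = (fun x => sc R n w.2.1 * G (a *: x - zvec R w.2.2)).
  apply/funext => x; rewrite /G subrK scalerA mulVf ?gt_eqF // scale1r psiwE //.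
  by rewrite mulrCA.
rewrite (rintZ _ _ (Cc_affine (zvec R w.2.2) (ler0n R N) a0 cG)); last first.
  by rewrite divr_ge0 ?addr_ge0 // ltW.
rewrite (rint_affine _ (ler0n R N) a0 cG) mulrC mulrA mulrA.
have -> : sc R n w.2.1 * sc R n w.2.1 * a ^- n = 1; last by rewrite mul1r.
by rewrite -expr2 sqr_sqrtr ?exprn_ge0 // exprM mulfV // expf_neq0.
Qed.

Lemma coef_sup_bound f w (M : R) : continuous f -> in_Omega w -> (forall x, `|f x| <= M) ->
  `|coef f w| * sc R n w.2.1 <= M * B * (2 * N%:R) ^+ n.
Proof.
move=> cf Ow HM; rewrite -(gtr0_norm (sc_gt0 R n w.2.1)) -normrM coef_scale //.
have [_ HC HB _ _] := HA; apply: rint_bound => //.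
  apply: CcMl; last exact/HC/Omega_lt.
  have := @cont_affine R _ f (2 ^+ w.2.1)^-1 ((2 ^+ w.2.1)^-1 *: zvec R w.2.2) cf.
  by under eq_fun do rewrite -scalerDr.
by move=> x; rewrite normrM ler_pM // HB // Omega_lt.
Qed.

Lemma atom_mean0 l : (1 <= l < 2 ^ n)%N -> rint (atom phi psi l) = 0.
Proof.
move=> l1; have [_ _ Hm _ _] := HD.
rewrite /atom gtn_eqF; last by case/andP: l1.
rewrite (@rint_ext _ _ _ (fun x => monom (fun=> 0%N) x * psi l x)).
  by rewrite /rint Hm // big1.
by move=> x; rewrite /monom big1 ?mul1r.
Qed.

(** A wavelet has mean zero, so the value of [u] at the centre can be subtracted, which gains 2^-j.
    For the scaling function the level is 0 and the bound by the supremum suffices. *)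
Lemma coef_lip (u : V -> R) (M : R) : continuous u -> (forall x, `|u x| <= M) ->
  (forall x y, `|u x - u y| <= `|x - y|) -> 0 <= M ->
  ncoef (coef u) ((M + N%:R) * B * (2 * N%:R) ^+ n) 2^-1.
Proof.
move=> cu HM Hu M0 w Ow; have [B0 HC HB _ _] := HA.
have n0 : 0 <= (2 * N%:R) ^+ n :> R by rewrite exprn_ge0 // mulr_ge0.
case: (Ow) => [[w1 w2]|w1].
  apply: le_trans (coef_sup_bound cu Ow HM) _; rewrite w2 expr0 mulr1.
  by rewrite ler_wpM2r // ler_wpM2r // lerDl.
have Ow' := Omega_lt Ow.
rewrite -(gtr0_norm (sc_gt0 R n w.2.1)) -normrM coef_scale //.
set a : R := (2 ^+ w.2.1)^-1; have a0 : 0 < a by rewrite invr_gt0 exprn_gt0.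
have cu' : continuous (fun y : V => u (a *: (y + zvec R w.2.2))).
  have := @cont_affine R _ u a (a *: zvec R w.2.2) cu.
  by under eq_fun do rewrite -scalerDr.
have -> : rint (fun y => u (a *: (y + zvec R w.2.2)) * atom phi psi w.1 y) =
  rint (fun y => (u (a *: (y + zvec R w.2.2)) - u (a *: zvec R w.2.2)) * atom phi psi w.1 y).
  rewrite [RHS](@rint_ext _ _ _ (fun y => - u (a *: zvec R w.2.2) * atom phi psi w.1 y +
    u (a *: (y + zvec R w.2.2)) * atom phi psi w.1 y)); last by move=> y; ring.
  rewrite (rintD _ (ler0n R N)); [|exact: HC|apply: CcMl => //; exact: HC].
  by rewrite atom_mean0 // mulr0 add0r.
have -> : (M + N%:R) * B * (2 * N%:R) ^+ n * 2^-1 ^+ w.2.1 =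
  (M + N%:R) * a * B * (2 * N%:R) ^+ n by rewrite /a exprVn; ring.
apply: rint_bound => //.
  apply: CcMl; last exact: HC.
  by apply: contB => //; exact: cont_cst.
move=> y; have [yN|yN] := leP `|y| N%:R; last first.
  by rewrite (proj2 (HC _ Ow')) // mulr0 normr0 !mulr_ge0 // ?addr_ge0 // ltW.
rewrite normrM ler_pM // ?HB // (le_trans (Hu _ _)) //.
rewrite -scalerBr addrK normrZ (gtr0_norm a0) mulrC ler_pM2r //.
by rewrite (le_trans yN) // lerDr.
Qed.

(** A nonzero coefficient forces the wavelet to meet the ball, and two points where it is nonzero
    are at distance at most 2 N. *)
Lemma coef_support (u : V -> R) (rho : R) w x : Cc rho u -> in_Omega w ->
  coef u w != 0 -> psiw w x != 0 -> `|x| <= rho + 2 * N%:R.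
Proof.
move=> Cu Ow cw pw.
have [y yr py] : exists2 y, `|y| <= rho & psiw w y != 0.
  apply: contrapT => H; move: cw; rewrite coef_rint // (@rint_ext _ _ _ (fun=> 0)) ?rint0 ?eqxx //.
  move=> y; have [yr|yr] := leP `|y| rho; last by rewrite (proj2 Cu) // mul0r.
  have [->|py] := eqVneq (psiw w y) 0; first by rewrite mulr0.
  by case: H; exists y.
have h1 := psiw_near HA Ow pw; have h2 := psiw_near HA Ow py.
have a0 : 0 < 2 ^+ w.2.1 :> R by rewrite exprn_gt0.
have h3 : 2 ^+ w.2.1 * `|x - y| <= 2 * N%:R.
  rewrite -(gtr0_norm a0) -normrZ scalerBr.
  rewrite -[_ *: x - _](subrKA (zvec R w.2.2)) (le_trans (ler_normD _ _)) //.
  by rewrite mulr_natl mulr2n lerD // distrC.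
have a1 : 1 <= 2 ^+ w.2.1 :> R by rewrite exprn_ege1 // ler1n.
have h4 : `|x - y| <= 2 * N%:R.
  by apply: le_trans h3; rewrite ler_peMl.
by rewrite -(subrK y x) (le_trans (ler_normD _ _)) // addrC lerD.
Qed.

Lemma clip_lip (a b : R) :
  `|Num.min 1 (Num.max 0 a) - Num.min 1 (Num.max 0 b)| <= `|a - b|.
Proof.
have m10 : Num.min 1 0 = 0 :> R by apply/min_idPr.
have := ler_norm (a - b); have := ler_norm (b - a); rewrite distrC => h1 h2.
by rewrite ler_norml; case: (leP 0 a) => a0; case: (leP 0 b) => b0; rewrite ?m10;
  try (case: (leP 1 a) => a1); try (case: (leP 1 b) => b1); apply/andP; split; lra.
Qed.

Lemma half01 : 0 < (2^-1 : R) < 1.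
Proof. by rewrite invr_gt0 ltr0n /= invf_lt1 // ltr1n. Qed.

(* On compactly supported Lipschitz functions the expansion converges uniformly,
   so completeness in L^2 identifies the sum. *)
Lemma expand_lip (u : V -> R) (rho : R) : 0 <= rho -> Cc rho u ->
  (forall x y, `|u x - u y| <= `|x - y|) -> forall x, syn (coef u) x = u x.
Proof.
move=> rho0 Cu Hu; have [M M0 HM] := Cc_bounded Cu.
have [B0 _ _ _ _] := HA.
have [_ _ _ ortho complete] := HD.
set A := (M + N%:R) * B * (2 * N%:R) ^+ n.
have A0 : 0 <= A by rewrite !mulr_ge0 ?addr_ge0 ?exprn_ge0 // mulr_ge0.
have Hn : ncoef (coef u) A 2^-1 by exact: coef_lip (proj1 Cu) HM Hu M0.
have Hc := coef_csupp u.
have /andP[h0 h1] := half01; have h01 : 0 <= (2^-1 : R) < 1 by rewrite ltW.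
have cs := syn_cont HA Hc A0 h01 Hn h0.
have rho'0 : 0 <= rho + 2 * N%:R by rewrite addr_ge0 ?mulr_ge0.
have Cs : Cc (rho + 2 * N%:R) (syn (coef u)).
  split => // x xr; apply/normr0_eq0/eqP; rewrite eq_le normr_ge0 andbT.
  have -> : syn (coef u) x = Lam [:: (1, x)] (syn (coef u)).
    by rewrite /Lam big_seq1 /= mul1r.
  apply: le_trans (@syn_functional _ _ _ _ _ _ _ HA _ A _ Hc A0 h01 Hn [:: (1, x)] 0 2^-1 0%N (lexx _) half01 _) _; last first.
    by rewrite mulr0 mul0r.
  move=> w Ow; rewrite mul0r /Lam big_seq1 /= mul1r normr_le0 mulf_eq0.
  have [//|cw] := eqVneq (coef u w) 0; rewrite /=.
  apply: contraT => pw; have := coef_support Cu Ow cw pw.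
  by rewrite leNgt xr.
have Cu' : Cc (rho + 2 * N%:R) u by apply: Cc_le Cu; rewrite lerDl mulr_ge0.
pose g x := -1 * syn (coef u) x + u x.
have Cg : Cc (rho + 2 * N%:R) g by exact: CcD.
suff g0 : forall x, g x = 0.
  by move=> x; have := g0 x; rewrite /g mulN1r addrC => /eqP; rewrite subr_eq0 => /eqP ->.
apply: ae_zero_continuous; first by case: Cg.
apply: complete; first by apply: continuous_rmeasurable; case: Cg.
  by rewrite (intn_rint rho'0) ?ltry //; apply: CcMl => //; case: Cg.
move=> w Ow; rewrite (intn_rint rho'0); last first.
  rewrite (_ : (fun x => _) = (fun x => psiw w x * g x)); last by apply/funext => x; rewrite mulrC.
  by apply: CcMl => //; exact: (psiw_cont HA).
congr EFin; rewrite (@rint_ext _ _ _ (fun x => -1 * (syn (coef u) x * psiw w x) + u x * psiw w x)).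
  rewrite (rintD _ rho'0).
  - by rewrite (syn_coef HA Hc A0 half01 Hn ortho Ow) coef_rint // mulN1r addNr.
  - rewrite (_ : (fun x => _) = (fun x => psiw w x * syn (coef u) x)); last by apply/funext => x; rewrite mulrC.
    by apply: CcMl => //; exact: (psiw_cont HA).
  - rewrite (_ : (fun x => _) = (fun x => psiw w x * u x)); last by apply/funext => x; rewrite mulrC.
    by apply: CcMl => //; exact: (psiw_cont HA).
by move=> x; rewrite /g; ring.
Qed.

(** Since [v] may fail to be in L^2, it is tested against a tent [u] at a point where it is nonzero.
    The expansion of [u] converges uniformly, so the integral of v u is a sum of multiples of
    coefficients of [v] and vanishes; near that point the sign of [v] makes it nonzero. *)
Lemma coef_inj0 (v : V -> R) : continuous v ->
  (forall w, in_Omega w -> rint (fun x => v x * psiw w x) = 0) -> forall x, v x = 0.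
Proof.
move=> cv Hv x0; apply: contrapT => vx0.
have vx : 0 < `|v x0| by rewrite normr_gt0; apply/eqP.
have [e e0 He] := (continuous_epsP v).1 cv x0 (`|v x0| / 2) ltac:(by rewrite divr_gt0).
pose u x := Num.max 0 (e - `|x - x0|).
have u_ge0 x : 0 <= u x by rewrite /u le_max lexx.
have Hu x y : `|u x - u y| <= `|x - y|.
  have h : `| `|x - x0| - `|y - x0| | <= `|x - y|.
    by rewrite (le_trans (ler_dist_dist _ _)) // opprB addrA subrK.
  move: h; rewrite !ler_norml /u => /andP[h1 h2].
  by case: (leP 0 (e - `|x - x0|)) => ?; case: (leP 0 (e - `|y - x0|)) => ?;
    apply/andP; split; lra.
have cu : continuous u.
  by apply/continuous_epsP => x d d0; exists d => // y xy; exact: le_lt_trans (Hu x y) xy.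
pose rho := `|x0| + e; have rho0 : 0 <= rho by rewrite addr_ge0 // ltW.
have Cu : Cc rho u.
  split => // x xr; rewrite /u; apply/max_idPl.
  have : `|x| <= `|x - x0| + `|x0| by rewrite -{1}(subrK x0 x) ler_normD.
  by move: xr; rewrite /rho; lra.
have [M M0 HM] := Cc_bounded Cu; have [B0 _ _ _ _] := HA.
set A := (M + N%:R) * B * (2 * N%:R) ^+ n.
have A0 : 0 <= A by rewrite !mulr_ge0 ?addr_ge0 ?exprn_ge0 // mulr_ge0.
have Hn : ncoef (coef u) A 2^-1 by exact: coef_lip cu HM Hu M0.
pose rho2 := rho + 2 * N%:R.
(* A cut-off equal to 1 on every wavelet that meets [u]: v chi has compact support and the same
   pairings with these wavelets. *)
pose chi (x : V) : R := Num.min 1 (Num.max 0 (rho2 + 1 - `|x|)).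
have cchi : continuous chi.
  apply/continuous_epsP => x d d0; exists d => // y xy; apply: le_lt_trans xy.
  rewrite /chi (le_trans (clip_lip _ _)) // opprB addrC addrA subrK distrC.
  exact: ler_dist_dist.
have chi1 x : `|x| <= rho2 -> chi x = 1.
  move=> xr; rewrite /chi; apply/min_idPl; rewrite le_max; apply/orP; right; lra.
have rho20 : 0 <= rho2 by rewrite addr_ge0 ?mulr_ge0.
have Cvc : Cc (rho2 + 1) (fun x => v x * chi x).
  apply: CcMl => //; split => // x xr; rewrite /chi.
  have -> : Num.max 0 (rho2 + 1 - `|x|) = 0 by apply/max_idPl; move: xr; lra.
  by apply/min_idPr.
have I0 : rint (fun x => v x * u x) = 0.
  rewrite (@rint_ext _ _ _ (fun x => syn (coef u) x * (v x * chi x))); last first.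
    move=> x; rewrite (expand_lip rho0 Cu Hu).
    have [xr|xr] := leP `|x| rho2; first by rewrite chi1 // mulr1 mulrC.
    rewrite (proj2 Cu) ?mul0r ?mulr0 //; apply: le_lt_trans xr.
    by rewrite /rho2 lerDl mulr_ge0.
  apply: (syn_pair0 HA (coef_csupp u) A0 half01 Hn _ Cvc); first by rewrite addr_ge0.
  move=> w Ow; have [->|cw] := eqVneq (coef u w) 0; first by rewrite mul0r.
  rewrite (@rint_ext _ _ _ (fun x => v x * psiw w x)) ?Hv ?mulr0 // => x.
  have [->|pw] := eqVneq (psiw w x) 0; first by rewrite mul0r mulr0.
  by rewrite chi1 ?mulr1 1?mulrC //; exact: coef_support Cu Ow cw pw.
pose a : V := \row_i (x0 ord0 i - e / 2); pose b : V := \row_i (x0 ord0 i + e / 2).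
have ab i : a ord0 i <= b ord0 i by rewrite !mxE; lra.
(* On the box of half-side e/2 both v(x0) v(x) >= |v(x0)|^2 / 2 and u(x) >= e/2 hold. *)
pose C := `|v x0| ^+ 2 / 2 * (e / 2).
have C0 : 0 < C by rewrite /C !mulr_gt0 ?invr_gt0 // exprn_gt0.
have Cvu : Cc rho (fun x => v x0 * (v x * u x)).
  by apply: CcMl; [exact: cont_cst|exact: CcMl].
have : (intn (fun x => (C * \1_(box a b) x)%:E) <= intn (fun x => (v x0 * (v x * u x))%:E))%E.
  apply: intn_mono => x; first by rewrite lee_fin mulr_ge0 // ltW.
  have vlow : `|x0 - x| < e -> `|v x0| ^+ 2 / 2 <= v x0 * v x.
    move=> /He; rewrite real_normK ?num_real // => h.
    have := ler_norm (v x0 * (v x0 - v x)); rewrite normrM => h2.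
    have : `|v x0| * `|v x0 - v x| <= `|v x0| * (`|v x0| / 2) by rewrite ler_wpM2l // ltW.
    have : `|v x0| * `|v x0| = v x0 ^+ 2 by rewrite -expr2 real_normK ?num_real.
    by move: h2; rewrite mulrBr -expr2; lra.
  rewrite lee_fin indicE; case: (boolP (x \in box a b)) => [|_]; last first.
    rewrite mulr0; have [xe|xe] := ltP `|x0 - x| e.
      by rewrite mulrA mulr_ge0 // (le_trans _ (vlow xe)) // divr_ge0 // exprn_ge0.
    rewrite (_ : u x = 0) ?mulr0 //; apply/max_idPl.
    by move: xe; rewrite distrC; lra.
  rewrite inE mulr1 => xab.
  have xe : `|x0 - x| <= e / 2.
    apply/rV_normP => [|i]; first by rewrite divr_ge0 // ltW.
    have := xab i; rewrite !mxE => /andP[h1 h2]; rewrite ler_norml; apply/andP; split; lra.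
  rewrite mulrA /C ler_pM //.
  - by rewrite divr_ge0 // ltW.
  - by apply: vlow; move: xe; lra.
  - by rewrite /u le_max distrC; apply/orP; right; move: xe; lra.
rewrite intn_box // (intn_rint rho0 Cvu) (rintZ _ rho0) ?I0; last exact: CcMl.
rewrite mulr0 lee_fin leNgt => /negP; apply.
by rewrite mulr_gt0 //; apply: prodr_gt0 => i _; rewrite !mxE; lra.
Qed.

End Completeness.

(** * The norm of [Lambda_s] in terms of differences *)

Section LambdaNorm.
Variables (R : realType) (n : nat) (s : R).
Hypotheses (n0 : (0 < n)%N).
Local Notation V := 'rV[R]_n.
Local Notation kS := (Num.truncn s).+1.

(** In dimension at least 1 every length is attained, so the suprema in [Delta] range over nonempty
    sets and are not -oo. *)
Lemma exists_enorm (y : R) : 0 <= y -> exists h : V, enorm h = y.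
Proof.
move=> y0; pose i : 'I_n := Ordinal n0.
exists (y *: ebasis R i); rewrite enormZ ger0_norm // (_ : enorm _ = 1) ?mulr1 //.
rewrite /enorm (bigD1 i) //= mxE eqxx expr1n big1 ?addr0 ?sqrtr1 // => j ij.
by rewrite mxE eq_sym (negbTE ij) expr0n.
Qed.

Lemma Delta_gtP r (f : V -> R) x (y e : R) : 0 < y ->
  (e%:E < Delta r f x y * ((powR y s)^-1)%:E)%E <->
  exists2 h, enorm h = y & e * powR y s < `|diffk r h f x|.
Proof.
move=> y0; have p0 : 0 < powR y s by exact: powR_gt0.
rewrite lte_pdivlMr // -EFinM; split.
  by move=> /ereal_sup_gt[_ [h /= hy <-]]; rewrite lte_fin => h2; exists h.
move=> [h hy h2]; apply: (@lt_le_trans _ _ (`|diffk r h f x|)%:E); first by rewrite lte_fin.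
by apply: ereal_sup_ubound; exists h.
Qed.

Lemma Delta_le r (f : V -> R) x (y b : R) :
  (forall h, enorm h = y -> `|diffk r h f x| <= b) -> (Delta r f x y <= b%:E)%E.
Proof. by move=> H; apply: ge_ereal_sup => _ [h /= hy <-]; rewrite lee_fin H. Qed.

Lemma le_Delta r (f : V -> R) x h : ((`|diffk r h f x|)%:E <= Delta r f x (enorm h))%E.
Proof. by apply: ereal_sup_ubound; exists h. Qed.

Lemma Lnorm_le_bounds (f : V -> R) (M : R) : (Lnorm_s s f <= M%:E)%E ->
  (forall x, `|f x| <= M) /\
  (forall h x, 0 < enorm h <= 1 -> `|diffk kS h f x| <= M * powR (enorm h) s).
Proof.
rewrite /Lnorm_s; set S1 := ereal_sup _; set S2 := ereal_sup _ => H.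
have le1 x : ((`|f x|)%:E <= S1)%E by apply: ereal_sup_ubound; exists x.
have le2 h x : 0 < enorm h <= 1 ->
    ((`|diffk kS h f x| * (powR (enorm h) s)^-1)%:E <= S2)%E.
  move=> h01; apply: (@le_trans _ _ (Delta kS f x (enorm h) * ((powR (enorm h) s)^-1)%:E)%E).
    by rewrite EFinM lee_wpmul2r ?le_Delta // lee_fin invr_ge0 powR_ge0.
  by apply: ereal_sup_ubound; exists (x, enorm h).
have S10 : (0 <= S1)%E by apply: le_trans (le1 0); rewrite lee_fin.
have S20 : (0 <= S2)%E.
  have [h h1] := exists_enorm ler01.
  apply: le_trans (le2 h 0 _); last by rewrite h1 ltr01 lexx.
  by rewrite lee_fin mulr_ge0 // invr_ge0 powR_ge0.
split=> [x|h x h01].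
  by rewrite -lee_fin (le_trans (le1 x)) // (le_trans _ H) // leeDl.
have h0 : 0 < powR (enorm h) s by apply: powR_gt0; case/andP: h01.
rewrite -ler_pdivrMr // -lee_fin (le_trans (le2 h x h01)) // (le_trans _ H) //.
by rewrite leeDr.
Qed.

Lemma bounds_Lnorm (f : V -> R) (M1 M2 : R) : 0 <= M2 -> (forall x, `|f x| <= M1) ->
  (forall h x, 0 < enorm h <= 1 -> `|diffk kS h f x| <= M2 * powR (enorm h) s) ->
  (Lnorm_s s f <= (M1 + M2)%:E)%E.
Proof.
move=> M20 H1 H2; rewrite /Lnorm_s EFinD leeD //.
  by apply: ge_ereal_sup => _ [x _ <-]; rewrite lee_fin.
apply: ge_ereal_sup => _ [[x y] /= y01 <-].
have p0 : 0 < powR y s by apply: powR_gt0; case/andP: y01.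
rewrite -[M2%:E]mule1 -(divff (lt0r_neq0 p0)) EFinM muleA.
rewrite lee_wpmul2r ?lee_fin ?invr_ge0 ?(ltW p0) //.
by rewrite -EFinM; apply: Delta_le => h hy; rewrite -hy H2 // hy.
Qed.

Lemma Lnorm_s_ge0 (f : V -> R) : (0 <= Lnorm_s s f)%E.
Proof.
apply: adde_ge0.
  by apply: (@le_trans _ _ (`|f 0|)%:E); [rewrite lee_fin|apply: ereal_sup_ubound; exists 0].
have [h h1] := exists_enorm ler01.
apply: (@le_trans _ _ (Delta kS f 0 1 * ((powR 1 s)^-1)%:E)%E); last first.
  by apply: ereal_sup_ubound; exists (0, 1) => //=; rewrite ltr01 lexx.
apply: mule_ge0; last by rewrite lee_fin invr_ge0 powR_ge0.
by apply: (@le_trans _ _ (`|diffk kS h f 0|)%:E); [rewrite lee_fin|rewrite -h1; exact: le_Delta].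
Qed.

Lemma in_Lambda_bounds (f : V -> R) : in_Lambda s f -> continuous f /\
  exists2 M : R, 0 <= M & (forall x, `|f x| <= M) /\
  (forall h x, 0 < enorm h <= 1 -> `|diffk kS h f x| <= M * powR (enorm h) s).
Proof.
move=> [cf _ fin]; split => //; have L0 := Lnorm_s_ge0 f.
exists (fine (Lnorm_s s f)); first exact: fine_ge0.
by apply: Lnorm_le_bounds; rewrite fineK // ge0_fin_numE.
Qed.

Lemma bounds_in_Lambda (f : V -> R) (M1 M2 : R) : continuous f -> 0 <= M2 ->
  (forall x, `|f x| <= M1) ->
  (forall h x, 0 < enorm h <= 1 -> `|diffk kS h f x| <= M2 * powR (enorm h) s) ->
  in_Lambda s f.
Proof.
move=> cf M20 H1 H2; split => //; first by exists M1.
by apply: le_lt_trans (bounds_Lnorm M20 H1 H2) _; rewrite ltry.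
Qed.

Lemma diffk_higher (f : V -> R) (M : R) k r : (k <= r)%N ->
  (forall h x, 0 < enorm h <= 1 -> `|diffk k h f x| <= M * powR (enorm h) s) ->
  forall h x, 0 < enorm h <= 1 -> `|diffk r h f x| <= 2 ^+ r * M * powR (enorm h) s.
Proof.
move=> kr H h x h01; have p0 : 0 < powR (enorm h) s.
  by apply: powR_gt0; case/andP: h01.
have M0 : 0 <= M.
  by rewrite -(pmulr_lge0 _ p0); apply: le_trans (H h x h01).
rewrite -{1}(subnK kr); apply: le_trans (diffk_add_bound _ _ _) _.
  by move=> y; exact: H.
rewrite mulrA ler_wpM2r ?(ltW p0) // ler_wpM2r // ler_weXn2l ?ler1n //.
exact: leq_subr.
Qed.

End LambdaNorm.

(** * Wavelet coefficients of functions of [Lambda_s] *)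

Section Coefficients.
Variables (R : realType) (n L : nat) (phi : 'rV[R]_n -> R) (psi : nat -> 'rV[R]_n -> R).
Local Notation V := 'rV[R]_n.
Local Notation windex := (windex n).
Local Notation psiw := (psiw phi psi).
Variables (N k : nat) (B : R).
Hypothesis HA : atoms_bounded phi psi N k B.
Hypothesis HD : daubechies L phi psi.
Implicit Types (w : windex).
Local Notation syn := (syn phi psi N).
Local Notation coef := (coef phi psi).
Variables (s : R) (r : nat).
Hypotheses (n_gt0 : (0 < n)%N) (s0 : 0 < s) (r0 : (0 < r)%N) (rL : (r <= L.+1)%N)
  (sk : s < k%:R) (kr : (k <= r)%N).
Local Notation th := (thS s).

(** With exponent s/2 in place of s the [Lambda_s] bound beats the threshold at steps much shorter
    than the side, as [wbad_fin] requires. Summing over the finitely many wavelets gives one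
    constant and one radius. *)
Lemma whitney_atoms : exists2 C : R, 0 <= C & exists2 rho : R, 0 <= rho &
  forall l, (1 <= l < 2 ^ n)%N -> forall (f : V -> R) (K : R), continuous f -> 0 <= K ->
  (forall u h, `|u| <= rho -> enorm h <= 1 ->
     `|diffk r h f u| <= K * powR (enorm h) (s / 2)) ->
  `|rint (fun x => f x * atom phi psi l x)| <= C * K.
Proof.
have [_ cpsi Hm _ _] := HD; have s20 : 0 < s / 2 by rewrite divr_gt0.
have H (l : 'I_(2 ^ n)) : exists Cr : R * R, [/\ 0 <= Cr.1, 0 <= Cr.2 &
  (1 <= l)%N -> forall (f : V -> R) (K : R), continuous f -> 0 <= K ->
  (forall u h, `|u| <= Cr.2 -> enorm h <= 1 ->
     `|diffk r h f u| <= K * powR (enorm h) (s / 2)) ->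
  `|rint (fun x => f x * atom phi psi l x)| <= Cr.1 * K].
  have [l0|l1] := posnP l; first by exists (0, 0); split => //; rewrite l0.
  have l12 : (1 <= l < 2 ^ n)%N by rewrite l1 /=.
  have [C C0 [rho rho0 HC]] := wavelet_whitney r0 rL s20 (cpsi _ l12) (Hm _ l12).
  by exists (C, rho); split => // _ f K; rewrite /atom gtn_eqF //; exact: HC.
have [Cr HCr] := choice H.
exists (\sum_l (Cr l).1); first by apply: sumr_ge0 => l _; case: (HCr l).
exists (\sum_l (Cr l).2); first by apply: sumr_ge0 => l _; case: (HCr l).
move=> l /andP[l1 l2] f K cf K0 Hf; have [_ _ Hl] := HCr (Ordinal l2).
apply: (@le_trans _ _ ((Cr (Ordinal l2)).1 * K)).
  apply: Hl => // u h ul h1; apply: Hf => //; apply: le_trans ul _.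
  by rewrite (bigD1 (Ordinal l2)) //= lerDl sumr_ge0 // => i _; case: (HCr i).
rewrite ler_wpM2r // (bigD1 (Ordinal l2)) //= lerDl sumr_ge0 // => i _.
by case: (HCr i).
Qed.

Lemma diffk0 (f : V -> R) x : diffk r 0 f x = 0.
Proof. by case: (r) r0 => // r' _; rewrite diffkSr scaler0 subr0 addr0 subrr. Qed.

Lemma coef_whitney : exists2 C : R, 0 <= C & exists2 rho : R, 0 <= rho &
  forall w, in_Omega w -> (1 <= w.1)%N -> forall (f : V -> R) (K : R), continuous f -> 0 <= K ->
  (forall u h, `|2 ^+ w.2.1 *: u - zvec R w.2.2| <= rho -> 0 < enorm h <= side R w.2.1 ->
     `|diffk r h f u| <= K * powR (2 ^+ w.2.1 * enorm h) (s / 2)) ->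
  `|coef f w| * sc R n w.2.1 <= C * K.
Proof.
have [C C0 [rho rho0 HC]] := whitney_atoms.
exists C => //; exists rho => // w Ow w1 f K cf K0 H.
rewrite -(gtr0_norm (sc_gt0 R n w.2.1)) -normrM (coef_scale HA) //.
set a : R := (2 ^+ w.2.1)^-1; have a0 : 0 < a by rewrite invr_gt0 exprn_gt0.
have Ea : 2 ^+ w.2.1 * a = 1 by rewrite /a mulfV // expf_neq0 // pnatr_eq0.
have Ef : (fun y => f (a *: (y + zvec R w.2.2))) =
          (fun y => f (a *: y + a *: zvec R w.2.2)).
  by apply/funext => y; rewrite scalerDr.
apply: HC => //; first by rewrite w1 (Omega_lt Ow).
  by rewrite Ef; exact: cont_affine.
move=> u h ul h1; rewrite Ef diffk_affine.
(* The hypothesis concerns steps of positive length; at h = 0 the difference vanishes because r >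
   0. *)
have [h0|h0] := eqVneq (enorm h) 0.
  have -> : h = 0.
    apply/eqP; rewrite -normr_eq0 eq_le normr_ge0 andbT -h0; exact: norm_le_enorm.
  by rewrite scaler0 diffk0 normr0 mulr_ge0 // powR_ge0.
have h_gt0 : 0 < enorm h by rewrite lt_neqAle eq_sym h0 enorm_ge0.
have := H (a *: u + a *: zvec R w.2.2) (a *: h).
rewrite enormZ (gtr0_norm a0) mulrA Ea mul1r; apply.
  by rewrite scalerDr !scalerA Ea !scale1r addrK.
by rewrite mulr_gt0 //= ler_piMr // ltW.
Qed.

Lemma coef_Lambda_bound : exists2 C : R, 0 <= C & forall (f : V -> R) (M : R),
  continuous f -> 0 <= M -> (forall x, `|f x| <= M) ->
  (forall h x, 0 < enorm h <= 1 -> `|diffk k h f x| <= M * powR (enorm h) s) ->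
  ncoef (coef f) (C * M) th.
Proof.
have [B0 _ _ _ _] := HA.
have [C C0 [rho rho0 HC]] := coef_whitney.
have D0 : 0 <= B * (2 * N%:R) ^+ n by rewrite mulr_ge0 // exprn_ge0 // mulr_ge0.
have C20 : 0 <= C * 2 ^+ r by rewrite mulr_ge0 // exprn_ge0.
exists (C * 2 ^+ r + B * (2 * N%:R) ^+ n); first by rewrite addr_ge0.
move=> f M cf M0 H1 H2 w Ow; have /andP[t0 t1] := thS_bounds s0.
have Hr := diffk_higher kr H2.
case: (Ow) => [[w1 w2]|w1].
  apply: le_trans (coef_sup_bound HA cf Ow H1) _; rewrite w2 expr0 mulr1.
  by rewrite -mulrA mulrC ler_wpM2r // lerDr.
apply: (@le_trans _ _ (C * (2 ^+ r * M * th ^+ w.2.1))); last first.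
  have -> : C * (2 ^+ r * M * th ^+ w.2.1) = C * 2 ^+ r * M * th ^+ w.2.1 by ring.
  by rewrite ler_wpM2r ?exprn_ge0 ?(ltW t0) // ler_wpM2r // lerDl.
apply: HC => //; first by case/andP: w1.
  by rewrite !mulr_ge0 // exprn_ge0 // ltW.
move=> u h _ /andP[h0 h1]; have a0 : 0 < side R w.2.1 := side_gt0 R _.
have a1 : side R w.2.1 <= 1.
  by rewrite sideE exprn_ile1 ?invr_ge0 // invf_le1 // ler1n.
have h01 : 0 < enorm h <= 1 by rewrite h0 (le_trans h1).
apply: le_trans (Hr h u h01) _.
rewrite -[leRHS]mulrA ler_wpM2l ?mulr_ge0 ?exprn_ge0 // thS_side.
set y := 2 ^+ w.2.1 * enorm h.
have y0 : 0 < y by rewrite mulr_gt0 // exprn_gt0.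
have hE : enorm h = side R w.2.1 * y.
  by rewrite /y /side mulrA mulVf ?mul1r // expf_neq0 // pnatr_eq0.
have y1 : y <= 1 by rewrite -(ler_pM2l a0) mulr1 -hE.
rewrite {1}hE powRM ?(ltW y0) ?(ltW a0) // ler_wpM2l ?powR_ge0 //.
(* As y = 2^j |h| <= 1, y^s is at most y^(s/2), the power occurring in [coef_whitney]. *)
have sE : s = s / 2 + s / 2 by field.
rewrite {1}sE powRD; last by rewrite (gt_eqF y0) implybT.
rewrite ler_piMr ?powR_ge0 //.
have s20 : 0 <= s / 2 by rewrite divr_ge0 // ltW.
by have := ge0_ler_powR s20 _ _ y1; rewrite powR1 !nnegrE (ltW y0); exact.
Qed.

(** Both sides have the same coefficients by orthonormality, and [coef_inj0] shows that these
    determine a continuous function. *)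
Lemma expand_ncoef (f : V -> R) (A : R) : continuous f -> 0 <= A ->
  ncoef (coef f) A th -> forall x, syn (coef f) x = f x.
Proof.
move=> cf A0 Hn; have Hc := coef_csupp phi psi f.
have th01 := thS_bounds s0; have /andP[t0 t1] := th01.
have th01' : 0 <= th < 1 by rewrite ltW.
have cs := syn_cont HA Hc A0 th01' Hn t0.
have [_ _ _ ortho _] := HD.
pose v x := f x - syn (coef f) x.
suff v0 : forall x, v x = 0.
  by move=> x; have := v0 x => /eqP; rewrite subr_eq0 => /eqP.
apply: (coef_inj0 HA HD); first exact: contB.
move=> w Ow; have Cw := psiw_Cc HA Ow; set M := _ / _ in Cw.
have M0 : 0 <= M by rewrite divr_ge0 ?addr_ge0 // exprn_ge0.
rewrite (@rint_ext _ _ _ (fun x => -1 * (syn (coef f) x * psiw w x) + f x * psiw w x)).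
  rewrite (rintD _ M0); [|exact: CcMl|exact: CcMl].
  by rewrite (syn_coef HA Hc A0 th01 Hn ortho Ow) coef_rint // mulN1r addNr.
by move=> x; rewrite /v; ring.
Qed.

Lemma coef_syn c (A : R) w : csupp c -> 0 <= A -> ncoef c A th -> coef (syn c) w = c w.
Proof.
move=> Hc A0 Hn; have [_ _ _ ortho _] := HD.
have [Ow|nOw] := pselect (in_Omega w); last by rewrite (coef_csupp _ _ _ nOw) Hc.
rewrite coef_rint //; exact: (syn_coef HA Hc A0 (thS_bounds s0) Hn ortho Ow).
Qed.

Lemma wcoefB (f g : V -> R) w : continuous f -> continuous g ->
  coef (f \- g) w = coef f w - coef g w.
Proof.
move=> cf cg.
have [Ow|nOw] := pselect (in_Omega w); last by rewrite !(coef_csupp _ _ _ nOw) subr0.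
have Cw := psiw_Cc HA Ow; set M := _ / _ in Cw.
have M0 : 0 <= M by rewrite divr_ge0 ?addr_ge0 // exprn_ge0.
rewrite !coef_rint // (@rint_ext _ _ _ (fun x => -1 * (g x * psiw w x) + f x * psiw w x)).
  rewrite (rintD _ M0); [|exact: CcMl|exact: CcMl].
  by rewrite mulN1r addrC.
by move=> x /=; ring.
Qed.

Lemma wcoefE (f : V -> R) w : continuous f -> in_Omega w -> wcoef phi psi f w = (coef f w)%:E.
Proof.
move=> cf Ow; have Cw := psiw_Cc HA Ow; set M := _ / _ in Cw.
have M0 : 0 <= M by rewrite divr_ge0 ?addr_ge0 // exprn_ge0.
by rewrite /wcoef (intn_rint M0) ?coef_rint //; exact: CcMl.
Qed.

Lemma syn_Lnorm : k = (Num.truncn s).+1 -> exists2 C : R, 0 <= C &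
  forall c (A : R), csupp c -> 0 <= A -> ncoef c A th ->
  in_Lambda s (syn c) /\ (Lnorm_s s (syn c) <= (C * A)%:E)%E.
Proof.
move=> kE; have [B0 _ _ _ _] := HA.
have th01 := thS_bounds s0; have /andP[t0 t1] := th01.
have th01' : 0 <= th < 1 by rewrite ltW.
have D0 := Cdiff_ge0 HA s0 sk k.
have E0 : 0 <= Cnt R n N * B / (1 - th).
  by rewrite divr_ge0 ?mulr_ge0 ?Cnt_ge0 // subr_ge0 ltW.
exists (Cnt R n N * B / (1 - th) + Cdiff n N k B s k); first by rewrite addr_ge0.
move=> c A Hc A0 Hn.
have H1 x : `|syn c x| <= Cnt R n N * B / (1 - th) * A.
  apply: le_trans (syn_bound HA Hc A0 th01' Hn x) _.
  by rewrite (_ : _ / _ = Cnt R n N * B / (1 - th) * A) //; ring.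
have H2 h x : 0 < enorm h <= 1 ->
    `|diffk (Num.truncn s).+1 h (syn c) x| <= Cdiff n N k B s k * A * powR (enorm h) s.
  by move=> h01; rewrite -kE; exact: (syn_diff HA s0 sk).
split.
  apply: (bounds_in_Lambda _ _ H1 H2); last by rewrite mulr_ge0.
  exact: (syn_cont HA Hc A0 th01' Hn t0).
by rewrite mulrDl; apply: bounds_Lnorm => //; rewrite mulr_ge0.
Qed.

End Coefficients.

(** * Local smallness and continuity of differences of a series *)

Section LocalEstimates.
Variables (R : realType) (n : nat) (phi : 'rV[R]_n -> R) (psi : nat -> 'rV[R]_n -> R).
Local Notation V := 'rV[R]_n.
Local Notation windex := (windex n).
Local Notation psiw := (psiw phi psi).
Variables (N k : nat) (B : R).
Hypothesis HA : atoms_bounded phi psi N k B.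
Implicit Types (w : windex).
Local Notation syn := (syn phi psi N).
Variables (s : R) (r : nat).
Hypotheses (s0 : 0 < s) (sk : s < k%:R) (kr : (k <= r)%N).
Local Notation th := (thS s).
Local Notation q := (qS s k).

Lemma dcoef_le (i : 'I_r.+1) : `|i%:R - r%:R / 2| <= r%:R :> R.
Proof.
have := ltn_ord i; rewrite ltnS -(ler_nat R) => ir.
have := ler0n R i; have := ler0n R r => r0' i0'.
by rewrite ler_norml; apply/andP; split; lra.
Qed.

Lemma diffk_psiw_near w (h x : V) : in_Omega w -> diffk r h (psiw w) x != 0 ->
  `|2 ^+ w.2.1 *: x - zvec R w.2.2| <= N%:R + r%:R * (2 ^+ w.2.1 * enorm h).
Proof.
move=> Ow dw.
have [i pi] : exists i : 'I_r.+1, psiw w (x + (i%:R - r%:R / 2) *: h) != 0.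
  apply: contrapT => H; move: dw; rewrite diffkE big1 ?eqxx // => i _.
  have [->|pi] := eqVneq (psiw w (x + (i%:R - r%:R / 2) *: h)) 0; first by rewrite mulr0.
  by case: H; exists i.
have := psiw_near HA Ow pi; set t := _ - _ in pi *; rewrite scalerDr => h1.
have a0 : 0 < 2 ^+ w.2.1 :> R by rewrite exprn_gt0.
have -> : 2 ^+ w.2.1 *: x - zvec R w.2.2 =
  (2 ^+ w.2.1 *: x + 2 ^+ w.2.1 *: (t *: h) - zvec R w.2.2) - 2 ^+ w.2.1 *: (t *: h).
  by rewrite addrAC addrK.
rewrite (le_trans (ler_normB _ _)) // lerD // !normrZ (gtr0_norm a0) mulrCA.
rewrite ler_pM // ?mulr_ge0 ?(ltW a0) ?dcoef_le //.
by rewrite ler_wpM2l ?(ltW a0) ?norm_le_enorm.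
Qed.

(** Since q^d = q'^d q'^d, one factor makes the levels at distance more than [J] small and the other
    sums over the levels. *)
Let q' : R := Num.sqrt q.

Let q01 := qS_bounds s0 sk.

Let q'2 : q' ^+ 2 = q.
Proof. by rewrite sqr_sqrtr //; case/andP: q01 => /ltW. Qed.

Let q'01 : 0 < q' < 1.
Proof.
have /andP[q0 q1] := q01.
have q'0 : 0 < q' by rewrite sqrtr_gt0.
by rewrite q'0 /= -(@ltr_pXn2r _ 2) ?nnegrE ?(ltW q'0) // q'2 expr1n.
Qed.

Let q'X a b : (a <= b)%N -> q' ^+ b <= q' ^+ a.
Proof. by move=> ab; have /andP[h0 h1] := q'01; rewrite ler_wiXn2l // ltW. Qed.

Let qd d : q ^+ d = q' ^+ d * q' ^+ d.
Proof. by rewrite -q'2 -exprM mulnC exprM expr2. Qed.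

Variables (c : windex -> R) (M : R).
Hypotheses (Hc : csupp c) (M0 : 0 <= M) (Hn : ncoef c M th).

Let B0 : 0 <= B. Proof. by case: HA. Qed.

Let Br : R := 2 ^+ r * B.
Let Br0 : 0 <= Br. Proof. by rewrite mulr_ge0 // exprn_ge0. Qed.

(** Terms that reach [x] from levels within [J] are small by hypothesis; the remote ones because M
    q'^J <= eta'. Both [eta'] and [J] are uniform in [x], [h] and [j0]. *)
Lemma syn_small_local (eta : R) : 0 < eta ->
  exists2 eta' : R, 0 < eta' & exists J : nat, forall (x h : V) j0,
  side R j0 / 2 < enorm h <= side R j0 ->
  (forall w, in_Omega w -> (levdist w.2.1 j0 <= J)%N ->
     `|2 ^+ w.2.1 *: x - zvec R w.2.2| <= N%:R + r%:R * (2 ^+ w.2.1 * enorm h) ->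
     `|c w| * sc R n w.2.1 <= eta' * th ^+ w.2.1) ->
  `|diffk r h (syn c) x| <= eta * powR (enorm h) s.
Proof.
move=> eta0; have /andP[t0 t1] := thS_bounds s0; have /andP[q'0 q'1] := q'01.
pose X := r.+1%:R * Cnt R n N * Br * (2 / (1 - q')) * th^-1.
have X0 : 0 <= X.
  by rewrite /X !mulr_ge0 // invr_ge0 ?subr_ge0 ltW.
have X1 : 0 < X + 1 by rewrite ltr_wpDl.
pose eta' := eta / (X + 1); have eta'0 : 0 < eta' by rewrite divr_gt0.
exists eta' => //.
have [J HJ] := @exists_pow_le R q' M eta' ltac:(by rewrite ltW) eta'0.
exists J => x h j0 /andP[h1 h2] H.
have tj0 : 0 <= th ^+ j0 by rewrite exprn_ge0 // ltW.
have et0 : 0 <= eta' * Br * th ^+ j0 := mulr_ge0 (mulr_ge0 (ltW eta'0) Br0) tj0.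
apply: le_trans (syn_local HA s0 Hc M0 Hn et0 q'01 (j0 := j0) _) _.
  move=> w Ow; set d := levdist w.2.1 j0.
  have [dJ|Jd] := leqP d J.
    have [->|nz] := eqVneq (diffk r h (psiw w) x) 0.
      by rewrite mulr0 normr0 mulr_ge0 // exprn_ge0 // ltW.
    have Hw := H w Ow dJ (diffk_psiw_near Ow nz).
    apply: le_trans (term_diff HA s0 sk x kr Ow (ltW eta'0) Hw h2) _.
    rewrite ler_wpM2l // qd ler_piMl ?exprn_ge0 ?(ltW q'0) //.
    by rewrite exprn_ile1 // ltW.
  apply: le_trans (term_diff HA s0 sk x kr Ow M0 (Hn Ow) h2) _.
  have -> : M * (2 ^+ r * B) * th ^+ j0 * q ^+ levdist w.2.1 j0 =
     M * q' ^+ d * (Br * th ^+ j0 * q' ^+ d) by rewrite qd /Br /d; ring.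
  have -> : eta' * Br * th ^+ j0 * q' ^+ d = eta' * (Br * th ^+ j0 * q' ^+ d) by ring.
  rewrite ler_wpM2r ?mulr_ge0 // ?exprn_ge0 ?(ltW q'0) //.
  by apply: le_trans HJ; rewrite ler_wpM2l // q'X // ltnW.
have -> : r.+1%:R * Cnt R n N * (eta' * Br * th ^+ j0) * (2 / (1 - q')) =
   eta' * X * (th * th ^+ j0).
  by rewrite /X; field; rewrite gt_eqF //= gt_eqF // subr_gt0.
apply: (@le_trans _ _ (eta' * X * powR (enorm h) s)).
  rewrite (ler_wpM2l (mulr_ge0 (ltW eta'0) X0)) //.
  by rewrite -ler_pdivlMl //; exact: thS_le_powR.
rewrite ler_wpM2r ?powR_ge0 // /eta' mulrAC ler_pdivrMr //.
by rewrite ler_wpM2l ?(ltW eta0) // lerDl.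
Qed.

Lemma Lam_cat (xs ys : seq (R * V)) g : Lam (xs ++ ys) g = Lam xs g + Lam ys g.
Proof. by rewrite /Lam big_cat. Qed.

Lemma Lam_opp (xs : seq (R * V)) g : Lam [seq (- p.1, p.2) | p <- xs] g = - Lam xs g.
Proof. by rewrite /Lam big_map -sumrN; apply: eq_bigr => p _; rewrite mulNr. Qed.

Let Sr : R := \sum_(i < r.+1) 'C(r, i)%:R.

Lemma term_diff_lip w (x x0 h h0 : V) (D : R) : in_Omega w ->
  `|x - x0| <= D -> `|h - h0| <= D ->
  `|c w * (diffk r h (psiw w) x - diffk r h0 (psiw w) x0)| <=
  Sr * (M * th ^+ w.2.1 * (B * (2 ^+ w.2.1 * (r.+1%:R * D)))).
Proof.
move=> Ow xD hD; have D0 : 0 <= D by exact: le_trans xD.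
have /andP[t0 t1] := thS_bounds s0; have th01 : 0 <= th < 1 by rewrite ltW.
rewrite !diffkE -sumrB mulr_sumr (le_trans (ler_norm_sum _ _ _)) // /Sr mulr_suml.
apply: ler_sum => i _; rewrite -mulrBr mulrCA 2!normrM normrX normrN1 expr1n mul1r.
rewrite normr_nat ler_wpM2l //.
apply: le_trans (term_lip HA Hn _ _ Ow) _.
rewrite ler_wpM2l ?mulr_ge0 ?exprn_ge0 ?(ltW t0) // ler_wpM2l // ler_wpM2l ?exprn_ge0 //.
rewrite opprD addrACA -scalerBr (le_trans (ler_normD _ _)) // normrZ.
rewrite -[r.+1%:R]natr1 mulrDl mul1r [leRHS]addrC lerD // ler_pM //.
exact: dcoef_le.
Qed.

(** Displacements are measured in units of the scale. On levels within [J] the atoms are Lipschitz,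
    at a cost 2^J th^-J that [dl] compensates; on the others the decay suffices. *)
Lemma syn_diff_continuity (eta : R) : 0 < eta ->
  exists2 dl : R, 0 < dl & forall (x x0 h h0 : V) j0,
  enorm h <= side R j0 -> enorm h0 <= side R j0 ->
  `|x - x0| <= dl * side R j0 -> `|h - h0| <= dl * side R j0 ->
  `|diffk r h (syn c) x - diffk r h0 (syn c) x0| <= eta * th ^+ j0.
Proof.
move=> eta0; have /andP[t0 t1] := thS_bounds s0; have /andP[q'0 q'1] := q'01.
have th01 : 0 <= th < 1 by rewrite ltW.
pose X := (r.+1 + r.+1)%:R * Cnt R n N * (2 / (1 - q')).
have X0 : 0 <= X.
  by rewrite /X !mulr_ge0 // invr_ge0 subr_ge0 ltW.
have X1 : 0 < X + 1 by rewrite ltr_wpDl.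
pose eta' := eta / (X + 1); have eta'0 : 0 < eta' by rewrite divr_gt0.
have [J HJ] := @exists_pow_le R q' (2 * (M * Br)) eta' ltac:(by rewrite ltW) eta'0.
have Sr0 : 0 <= Sr by apply: sumr_ge0.
pose Y := Sr * (M * (B * r.+1%:R)) * (2 ^+ J * th ^- J).
have Y0 : 0 <= Y.
  by rewrite /Y !mulr_ge0 // ?exprn_ge0 // invr_ge0 exprn_ge0 // ltW.
have Y1 : 0 < Y + 1 by rewrite ltr_wpDl.
exists (eta' * q' ^+ J / (Y + 1)).
  by rewrite divr_gt0 // mulr_gt0 // exprn_gt0.
set dl := _ / _ => x x0 h h0 j0 hj h0j xx0 hh0.
have dl0 : 0 <= dl.
  by apply: divr_ge0 (ltW Y1); exact: mulr_ge0 (ltW eta'0) (exprn_ge0 _ (ltW q'0)).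
have tj0 : 0 <= th ^+ j0 by rewrite exprn_ge0 // ltW.
pose xs := dxs r h x ++ [seq (- p.1, p.2) | p <- dxs r h0 x0].
have LE g : Lam xs g = diffk r h g x - diffk r h0 g x0.
  by rewrite /xs Lam_cat Lam_opp !Lam_dxs.
have sxs : size xs = (r.+1 + r.+1)%N by rewrite size_cat size_dxs size_map size_dxs.
have et0 : 0 <= eta' * th ^+ j0 := mulr_ge0 (ltW eta'0) tj0.
rewrite -LE.
apply: le_trans (@syn_functional _ _ _ _ _ _ _ HA c M th Hc M0 th01 Hn xs _ q' j0 et0 q'01 _) _.
  move=> w Ow; rewrite LE; set d := levdist w.2.1 j0.
  have [dJ|Jd] := leqP d J.
    apply: le_trans (term_diff_lip Ow xx0 hh0) _.
    have P2 : 2 ^+ w.2.1 * side R j0 <= 2 ^+ J.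
      rewrite /side ler_pdivrMr ?exprn_gt0 // -exprD ler_weXn2l ?ler1n //.
      by move: dJ; rewrite /d /levdist; clear; lia.
    have Pt : th ^+ w.2.1 <= th ^- J * th ^+ j0.
      rewrite ler_pdivlMl ?exprn_gt0 // -exprD ler_wiXn2l ?(ltW t0) ?(ltW t1) //.
      by move: dJ; rewrite /d /levdist; clear; lia.
    apply: (@le_trans _ _ (Y * dl * th ^+ j0)); last first.
      rewrite [leRHS]mulrAC ler_wpM2r //; apply: (@le_trans _ _ (eta' * q' ^+ J)).
        rewrite /dl mulrA ler_pdivrMr // mulrC; apply: ler_wpM2l; rewrite ?lerDl //.
        exact: mulr_ge0 (ltW eta'0) (exprn_ge0 _ (ltW q'0)).
      by rewrite ler_wpM2l ?(ltW eta'0) // q'X.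
    have -> : Sr * (M * th ^+ w.2.1 * (B * (2 ^+ w.2.1 * (r.+1%:R * (dl * side R j0))))) =
      Sr * (M * (B * r.+1%:R)) * dl * (2 ^+ w.2.1 * side R j0 * th ^+ w.2.1) by ring.
    have -> : Y * dl * th ^+ j0 =
      Sr * (M * (B * r.+1%:R)) * dl * (2 ^+ J * (th ^- J * th ^+ j0)) by rewrite /Y; ring.
    have c0 : 0 <= Sr * (M * (B * r.+1%:R)) * dl.
      by apply: mulr_ge0 dl0; apply: mulr_ge0 Sr0 _; rewrite !mulr_ge0.
    rewrite (ler_wpM2l c0) //; apply: ler_pM => //; last by rewrite exprn_ge0 ?(ltW t0).
    by rewrite mulr_ge0 ?exprn_ge0 // ltW // side_gt0.
  apply: (@le_trans _ _ (2 * (M * Br * th ^+ j0 * q ^+ d))).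
    rewrite mulrBr (le_trans (ler_normB _ _)) // [leRHS]mulr_natl mulr2n lerD //.
      exact: (term_diff HA s0 sk x kr Ow M0 (Hn Ow) hj).
    exact: (term_diff HA s0 sk x0 kr Ow M0 (Hn Ow) h0j).
  have -> : 2 * (M * Br * th ^+ j0 * q ^+ d) =
     2 * (M * Br) * q' ^+ d * (th ^+ j0 * q' ^+ d) by rewrite qd; ring.
  rewrite -[leRHS]mulrA (ler_wpM2r (mulr_ge0 tj0 (exprn_ge0 _ (ltW q'0)))) //.
  by apply: le_trans HJ; rewrite (ler_wpM2l (mulr_ge0 _ (mulr_ge0 M0 Br0))) // q'X // ltnW.
rewrite sxs.
have -> : (r.+1 + r.+1)%:R * Cnt R n N * (eta' * th ^+ j0) * (2 / (1 - q')) =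
  eta' * X * th ^+ j0 by rewrite /X; ring.
rewrite ler_wpM2r // /eta' mulrAC ler_pdivrMr // ler_wpM2l ?(ltW eta0) //.
by rewrite lerDl.
Qed.

End LocalEstimates.

(** * Sequences of functions constant on dyadic cubes *)

Lemma esum_support (R : realType) (T : choiceType) (D : set T) (a : T -> \bar R) (s : seq T) :
  uniq s -> (forall i, D i -> (0 <= a i)%E) -> (forall i, i \in s -> ~ D i -> a i = 0%E) ->
  (forall i, D i -> i \notin s -> a i = 0%E) ->
  (\esum_(i in D) a i = \sum_(i <- s) a i)%E.
Proof.
move=> us a0 sD Ds; rewrite (esumID [set` s]) //.
rewrite [X in (_ + X)%E]esum1 ?adde0; last by move=> i [Di /= /negP]; exact: Ds.
rewrite esum_mkcondl esum_fset //; last first.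
  by move=> i _; case: ifPn => //; rewrite inE => /a0.
rewrite -fsbig_seq //; apply: eq_big_seq => i is_.
by case: ifPn => // /negP iD; rewrite sD // => Di; apply: iD; rewrite inE.
Qed.

Lemma intn_cst0 (R : realType) n : intn (fun _ : 'rV[R]_n => 0%E) = 0%E.
Proof. by elim: n => //= n IH; under eq_integral do rewrite IH; rewrite integral0. Qed.

Section CubeFunctions.
Variables (R : realType) (n : nat).
Local Notation V := 'rV[R]_n.
Local Notation Z := 'rV[int]_n.
Implicit Types u v : nat -> Z -> R.

(** Wavelet sequences and sums of indicators of cubes both have this form, so their norms in [X] are
    compared through their values on cubes. *)
Definition cubefun u : fseq R n := fun j x => (u j (cubeidx j x))%:E.

Lemma ae_all (P : V -> Prop) : (forall x, P x) -> ae P.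
Proof.
move=> HP; exists set0; split.
  by rewrite /rmeasurable (_ : [set t | _] = set0) //; apply/seteqP; split.
split => //; rewrite /lebn -[RHS](intn_cst0 R n); congr intn.
by apply/funext => x; rewrite indicE in_set0.
Qed.

Lemma adm_cubefun u : adm (cubefun u).
Proof.
move=> j; split; last by apply: ae_all.
move=> D mD; rewrite /rmeasurable.
pose F (k : Z) : set (n.-tuple R) :=
  if pselect (D (u j k)%:E) then [set t | cube j k (rowt t)] else set0.
have -> : [set t | (cubefun u j @^-1` D) (rowt t)] = \bigcup_k F k.
  apply/seteqP; split => [t Dt|t [k _]]; last first.
    by rewrite /F; case: pselect => //= Dk /cubeP kE; rewrite /cubefun kE.
  exists (cubeidx j (rowt t)) => //; rewrite /F; case: pselect => // Dk /=.
  exact/cubeP.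
apply: countable_bigcupT_measurable => // k; rewrite /F; case: pselect => Dk /=; last exact: measurable0.
by rewrite cube_box; exact: rmeasurable_box.
Qed.

Lemma indic_cube j k (x : V) : \1_(cube j k) x = (cubeidx j x == k)%:R :> R.
Proof.
rewrite indicE; congr (_%:R); congr nat_of_bool.
by apply/idP/eqP => [|/cubeP]; rewrite inE // => /cubeP.
Qed.

Lemma cube_indicators (cA : set (nat * Z)) :
  (fun j (x : V) => \esum_(k in [set k | cA (j, k)]) (\1_(cube j k) x)%:E)%E =
  cubefun (fun j k => `[< cA (j, k) >]%:R).
Proof.
apply/funext => j; apply/funext => x; rewrite /cubefun.
have [Ax|nA] := asboolP (cA (j, cubeidx j x)); last first.
  rewrite esum1 // => k /= Ak; rewrite indic_cube; case: eqP => // E.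
  by case: nA; rewrite E.
rewrite (@esum_support _ _ _ _ [:: cubeidx j x]) ?big_seq1 //.
- by rewrite indic_cube eqxx.
- by move=> k; rewrite inE => /eqP -> [].
- by move=> k _; rewrite inE indic_cube eq_sym => /negbTE ->.
Qed.

Variable X : fseq R n -> \bar R.
Hypothesis HX : qnormed_lattice X.

Lemma cubefun_mono u v : (forall j k, `|u j k| <= `|v j k|) ->
  (X (cubefun u) <= X (cubefun v))%E.
Proof.
move=> uv; case: HX => _ mono _ _; apply: mono; try exact: adm_cubefun.
by move=> j; apply: ae_all => x; rewrite /cubefun !abse_EFin lee_fin.
Qed.

Lemma cubefun_scale (c : R) u : (X (cubefun u) < +oo)%E ->
  (X (cubefun (fun j k => (c * u j k)%R)) < +oo)%E.
Proof.
case: HX => -[pos _ sca _] _ _ _ Xu.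
have -> : cubefun (fun j k => c * u j k) = (fun j x => c%:E * cubefun u j x)%E.
  by [].
rewrite sca; last exact: adm_cubefun.
have := pos _ (adm_cubefun u); case: (X _) Xu => // a _ _.
by rewrite -EFinM ltry.
Qed.

Lemma cubefun_fin_le (c : R) u v : (X (cubefun v) < +oo)%E ->
  (forall j k, `|u j k| <= c * `|v j k|) -> (X (cubefun u) < +oo)%E.
Proof.
move=> /(@cubefun_scale c) Xv uv; apply: le_lt_trans Xv; apply: cubefun_mono => j k.
by rewrite normrM (le_trans (uv _ _)) // ler_wpM2r // ler_norm.
Qed.

End CubeFunctions.

(** * The wavelet sequence and its large cubes *)

Section WaveletSequence.
Variables (R : realType) (n : nat) (phi : 'rV[R]_n -> R) (psi : nat -> 'rV[R]_n -> R).
Local Notation V := 'rV[R]_n.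
Local Notation Z := 'rV[int]_n.
Local Notation windex := (windex n).
Local Notation psiw := (psiw phi psi).
Local Notation coef := (coef phi psi).
Variables (N k : nat) (B : R).
Hypothesis HA : atoms_bounded phi psi N k B.
Variables (s : R).
Hypotheses (n_gt0 : (0 < n)%N) (s0 : 0 < s).
Local Notation th := (thS s).

(** With |I| = 2^(-jn) the weight is 2^(js) 2^(jn/2), exactly the normalisation used in [ncoef]. *)
Lemma wseq_weight j :
  powR (2 ^+ (j * n))^-1 (- s / n%:R - 2^-1) = th ^- j * sc R n j.
Proof.
have a0 : 0 < 2 ^+ (j * n) :> R by rewrite exprn_gt0.
have n0 : n%:R != 0 :> R by rewrite pnatr_eq0 -lt0n.
rewrite powRD; last by rewrite invr_eq0 (gt_eqF a0) implybT.
rewrite mulNr !powRN; congr (_ * _).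
  congr (_^-1); rewrite -[2 ^- _]exprVn -[2^-1 ^+ _]powR_mulrn ?invr_ge0 // -powRrM.
  rewrite /thS -powR_mulrn ?powR_ge0 // -powRrM natrM; congr powR.
  by field.
by rewrite powR12_sqrt ?invr_ge0 ?(ltW a0) // sqrtrV ?(ltW a0) // invrK.
Qed.

Definition wfun (f : V -> R) j (k : Z) : R :=
  th ^- j * (\sum_(l <- iota 0 (2 ^ n)) `|coef f (l, (j, k))| * sc R n j).

Lemma wseqE (f : V -> R) : continuous f -> wseq s phi psi f = cubefun (wfun f).
Proof.
move=> cf; apply/funext => j; apply/funext => x; rewrite /wseq /cubefun /wfun.
set m := cubeidx j x.
have -> : \sum_(l <- iota 0 (2 ^ n)) `|coef f (l, (j, m))| * sc R n j =
    \sum_(l <- iota 0 (2 ^ n) | `[< in_Omega (l, (j, m)) >]) `|coef f (l, (j, m))| * sc R n j.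
  rewrite [RHS]big_mkcond /=; apply: eq_bigr => l _; case: asboolP => // nO.
  by rewrite (@coef_csupp _ _ _ _ f _ nO) normr0 mul0r.
rewrite (@esum_support _ _ _ _
    [seq (l, (j, m)) | l <- iota 0 (2 ^ n) & `[< in_Omega (l, (j, m)) >]]); first last.
- move=> [l [j' m']] /= [Ow j'j] ni; rewrite indic_cube -/m.
  case: eqP => [E|_]; last by rewrite mule0.
  case/negP: ni; apply/mapP; exists l; last by rewrite E -j'j.
  rewrite mem_filter mem_iota /= add0n (Omega_lt Ow) andbT.
  by apply/asboolP; rewrite -j'j E.
- by move=> w /mapP[l]; rewrite mem_filter => /andP[/asboolP Ow _] -> [].
- by move=> w _; rewrite !mule_ge0 // lee_fin ?powR_ge0 // indic_cube.
- by rewrite map_inj_uniq ?filter_uniq ?iota_uniq // => l l' [].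
rewrite big_map big_filter mulr_sumr -sumEFin; apply: eq_bigr => l /asboolP Ow.
rewrite (wcoefE HA) // abse_EFin indic_cube eqxx mule1 -EFinM wseq_weight; congr EFin.
by rewrite /=; ring.
Qed.

Lemma wfun_ge0 f j m : 0 <= wfun f j m.
Proof.
have /andP[t0 _] := thS_bounds s0; rewrite mulr_ge0 ?invr_ge0 ?exprn_ge0 ?(ltW t0) //.
by apply: sumr_ge0 => l _; rewrite mulr_ge0 // ltW // sc_gt0.
Qed.

Definition large_cubes (c : windex -> R) (eta : R) : set (nat * Z) :=
  [set p | exists2 l, in_Omega (l, p) & eta * th ^+ p.1 < `|c (l, p)| * sc R n p.1].

Variable X : fseq R n -> \bar R.
Hypothesis HX : qnormed_lattice X.

(** Chebyshev's inequality: the indicator of the large cubes is at most eta^-1 times the wavelet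
    sequence. *)
Lemma large_cubes_fin (f : V -> R) (eta : R) : continuous f -> 0 < eta ->
  (X (wseq s phi psi f) < +oo)%E ->
  (X (fun j x => \esum_(k in [set k | large_cubes (coef f) eta (j, k)]) (\1_(cube j k) x)%:E)
    < +oo)%E.
Proof.
move=> cf eta0; rewrite wseqE // cube_indicators => Xf.
apply: (@cubefun_fin_le _ _ _ HX eta^-1 _ _ Xf) => j m.
rewrite (ger0_norm (wfun_ge0 _ _ _)); case: asboolP => [[l Ow Hl]|_]; last first.
  by rewrite normr0 mulr_ge0 ?wfun_ge0 // invr_ge0 ltW.
have /andP[t0 _] := thS_bounds s0.
rewrite normr1 ler_pdivlMl // mulr1 /wfun ler_pdivlMl ?exprn_gt0 // mulrC.
apply: le_trans (ltW Hl) _; rewrite (bigD1_seq l) ?iota_uniq //=; last first.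
  by rewrite mem_iota /= add0n; exact: Omega_lt Ow.
by rewrite lerDl sumr_ge0 // => i _; rewrite mulr_ge0 // ltW // sc_gt0.
Qed.

(** At most 2^n coefficients belong to a cube, so the sequence is bounded by 2^n A times the
    indicator of the cubes in [cA]. *)
Lemma wseq_fin (f : V -> R) (A : R) (cA : set (nat * Z)) : continuous f ->
  ncoef (coef f) A th -> (forall w, in_Omega w -> coef f w != 0 -> cA w.2) ->
  (X (fun j x => \esum_(k in [set k | cA (j, k)]) (\1_(cube j k) x)%:E) < +oo)%E ->
  (X (wseq s phi psi f) < +oo)%E.
Proof.
move=> cf Hn HcA; rewrite wseqE // cube_indicators => XA.
apply: (@cubefun_fin_le _ _ _ HX ((2 ^ n)%:R * A) _ _ XA) => j m.
have /andP[t0 _] := thS_bounds s0.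
rewrite (ger0_norm (wfun_ge0 _ _ _)) /wfun ler_pdivrMl ?exprn_gt0 //.
have cE l : in_Omega (l, (j, m)) \/ coef f (l, (j, m)) = 0.
  by case: (pselect (in_Omega (l, (j, m)))) => [|/coef_csupp->]; [left|right].
case: asboolP => [_|nA]; last first.
  rewrite normr0 !mulr0 big1 // => l _.
  case: (cE l) => [Ow|->]; last by rewrite normr0 mul0r.
  have [->|nz] := eqVneq (coef f (l, (j, m))) 0; first by rewrite normr0 mul0r.
  by case: nA; exact: (HcA _ Ow nz).
rewrite normr1 mulr1.
have -> : th ^+ j * ((2 ^ n)%:R * A) = \sum_(l <- iota 0 (2 ^ n)) A * th ^+ j.
  by rewrite big_const_seq count_predT size_iota iter_addr addr0 -[RHS]mulr_natl; ring.
(* The sign of [A] is read off [ncoef] at an index of the scaling function, where the power of [th]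
   is 1. *)
have A0 : 0 <= A * th ^+ j.
  have Ow : in_Omega ((0%N, (0%N, 0)) : windex) by left.
  have := Hn _ Ow; rewrite /= expr0 mulr1 => cA0; have A0 := le_trans _ cA0.
  by rewrite mulr_ge0 ?exprn_ge0 ?(ltW t0) // A0 // mulr_ge0 // ltW // sc_gt0.
apply: ler_sum => l _; case: (cE l) => [Ow|->]; first exact: Hn Ow.
by rewrite normr0 mul0r.
Qed.

End WaveletSequence.

(** * The hyperbolic metric in Euclidean terms *)

Section HyperbolicGeometry.
Variables (R : realType) (n : nat).
Local Notation V := 'rV[R]_n.
Local Notation H := (V * R)%type.
Implicit Types p q z : H.

Lemma hmeasurable_open (U : set H) : (forall p, U p -> \forall q \near p, U q) -> hmeasurable U.
Proof.
move=> oU; apply: hmeasurable_eopen => p /oU /nbhs_ballP[e /= e0 He].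
by exists e => // q q1 q2; apply: He; split => /=; rewrite -ball_normE.
Qed.

(* This is 2 (cosh t - 1). *)
Definition mrho (t : R) : R := (expR t - 1) ^+ 2 / expR t.

(** The condition is 1 + W < cosh t. With T = exp t and D the square root of (1 + W)^2 - 1 it
    becomes 1 + W + D < T, which is equivalent to 2 W T < (T - 1)^2. *)
Lemma rho_ltP p q (t : R) : 0 < p.2 -> 0 < q.2 -> 0 < t ->
  rho p q < t <-> enorm (p.1 - q.1) ^+ 2 + (p.2 - q.2) ^+ 2 < p.2 * q.2 * mrho t.
Proof.
move=> p0 q0 t0; rewrite /rho /arccosh /mrho.
set E := _ ^+ 2 + _ ^+ 2; set T := expR t.
have E0 : 0 <= E by rewrite addr_ge0 ?sqr_ge0.
have T1 : 1 < T by rewrite expR_gt1.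
have T0 : 0 < T by rewrite expR_gt0.
have pq0 : 0 < p.2 * q.2 by rewrite mulr_gt0.
set W := E / _; have W0 : 0 <= W by rewrite divr_ge0 // -mulrA mulr_ge0 // ltW.
have EW : E = p.2 * q.2 * (2 * W) by rewrite /W; field; rewrite !gt_eqF.
have v0 : 0 <= (1 + W) ^+ 2 - 1 by nra.
set D := Num.sqrt _; have D0 : 0 <= D by exact: sqrtr_ge0.
have D2 : D ^+ 2 = (1 + W) ^+ 2 - 1 by rewrite sqr_sqrtr.
have -> : (ln (1 + W + D) < t) = (1 + W + D < T).
  by rewrite -ltr_expR lnK // posrE; lra.
rewrite EW ltr_pM2l // ltr_pdivlMr //.
clearbody D W T; clear -D2 D0 W0 T1 T0; split=> h.
  have : 0 < (T - (1 + W) - D) * (T - (1 + W) + D) by apply: mulr_gt0; lra.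
  by nra.
have T2 : 1 + W < T.
  rewrite -(ltr_pM2r T0); apply: (@lt_trans _ _ ((T * T + 1) / 2)); first by nra.
  have : 0 < (T - 1) * (T + 1) by apply: mulr_gt0; lra.
  by nra.
rewrite addrC -ltrBrDr -(@ltr_pXn2r _ 2) ?nnegrE ?subr_ge0 ?(ltW T2) // D2.
by nra.
Qed.

Lemma mrho_gt (t : R) : 0 < t -> t - 1 < mrho t.
Proof.
move=> t0; have T0 := expR_gt0 t; have := expR_ge1Dx t => T1.
by rewrite /mrho ltr_pdivlMr //; nra.
Qed.

(** 1/20 is the radius used in the density condition: the lower bound places small boxes inside the
    ball, the upper bound places the ball inside a Euclidean box. *)
Lemma mrho_small : 800^-1 < mrho 20^-1 <= 1.
Proof.
have d0 : (0 : R) < 20^-1 by rewrite invr_gt0.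
have T0 := expR_gt0 (20^-1 : R); have := expR_ge1Dx (20^-1 : R) => T1.
have := expR_ge1Dx (- (20^-1) : R); rewrite expRN => T2.
have T3 : expR 20^-1 <= 2 :> R.
  rewrite -[leLHS]invrK -[leRHS]invrK lef_pV2 ?posrE ?invr_gt0 //.
  by apply: le_trans T2; lra.
by rewrite /mrho ltr_pdivlMr // ler_pdivrMr //; apply/andP; split; nra.
Qed.

Lemma hnbhdP (A : set H) (t : R) p : hnbhd A t p <-> 0 < p.2 /\ exists2 q, A q & rho p q < t.
Proof.
split=> [[p0 ht]|[p0 [q Aq pq]]]; split=> //.
  apply: contrapT => nq; move: ht; apply/negP; rewrite -leNgt.
  apply: le_ereal_inf_tmp => _ [q Aq <-]; rewrite lee_fin leNgt; apply/negP => pq.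
  by apply: nq; exists q.
by apply: le_lt_trans (ereal_inf_lbound _) _; [exists q|].
Qed.

Lemma enorm2 (x : V) : enorm x ^+ 2 = \sum_i x ord0 i ^+ 2.
Proof. by rewrite sqr_sqrtr // sumr_ge0 // => i _; rewrite sqr_ge0. Qed.

Lemma cont_coord (i : 'I_n) : continuous (fun p : H => p.1 ord0 i).
Proof.
move=> p; apply: (@continuous_comp _ _ _ fst (fun x : V => x ord0 i)); first exact: cvg_fst.
exact: coord_continuous.
Qed.

Lemma cont_snd : continuous (fun p : H => p.2).
Proof. by move=> p; exact: cvg_snd. Qed.

Lemma hmeasurable_hnbhd (A : set H) (t : R) : A `<=` @upper R n -> 0 < t ->
  hmeasurable (hnbhd A t).
Proof.
move=> Au t0; apply: hmeasurable_open => p /hnbhdP[p0 [z Az /rho_ltP]].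
have z0 : 0 < z.2 := Au _ Az.
move=> /(_ p0 z0 t0); rewrite -subr_gt0.
pose G q := q.2 * z.2 * mrho t - (enorm (q.1 - z.1) ^+ 2 + (q.2 - z.2) ^+ 2).
rewrite -/(G p) => Gp.
have cG : continuous G.
  have -> : G = fun q => q.2 * z.2 * mrho t -
     ((\sum_i (q.1 ord0 i - z.1 ord0 i) * (q.1 ord0 i - z.1 ord0 i)) +
       (q.2 - z.2) * (q.2 - z.2)).
    apply/funext => q; rewrite /G enorm2 expr2; congr (_ - (_ + _)).
    by apply: eq_bigr => i _; rewrite !mxE expr2.
  have c2 : continuous (fun q : H => q.2 - z.2) by apply: contB; [exact: cont_snd|exact: cont_cst].
  apply: contB; last apply: contD; last exact: contM.
    apply: contM; last exact: cont_cst.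
    by apply: contM; [exact: cont_snd|exact: cont_cst].
  apply: cont_sum => i; apply: contM; apply: contB; try exact: cont_cst; exact: cont_coord.
have n1 : \forall q \near p, 0 < G q by exact: (cvgr_gt (G p) (cG p) _ Gp).
have n2 : \forall q \near p, 0 < q.2 by exact: (cvgr_gt p.2 (@cont_snd p) _ p0).
near=> q; apply/hnbhdP.
have q0 : 0 < q.2 by near: q.
split=> //; exists z => //; apply/rho_ltP => //; rewrite -subr_gt0.
by near: q.
Unshelve. all: by end_near.
Qed.

End HyperbolicGeometry.

(** * A geometric criterion for the density condition *)

Section FatSets.
Variables (R : realType) (n : nat).
Local Notation V := 'rV[R]_n.
Local Notation H := (V * R)%type.
Implicit Types (p q z : H) (A : set H).
Local Notation mu := (@lebesgue_measure R).

Lemma lebh_ge_box A (a b : V) (t0 t1 : R) : t0 <= t1 -> (forall i, a ord0 i <= b ord0 i) ->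
  (forall q, box a b q.1 -> t0 <= q.2 < t1 -> A q) ->
  (((\prod_i (b ord0 i - a ord0 i)) * (t1 - t0))%:E <= lebh A)%E.
Proof.
move=> t01 ab sub; rewrite -integral_indic_itv //; apply: integral_mono => t.
  by rewrite lee_fin mulr_ge0 // prodr_ge0 // => i _; rewrite subr_ge0.
case: (boolP (t0 <= t < t1)) => ht; rewrite ?mulr1 ?mulr0.
  by apply: lebn_ge_box => // x bx; apply: sub.
by apply: intn_ge0 => x; rewrite lee_fin.
Qed.

Lemma lebh_le_box A (a b : V) (t0 t1 : R) : t0 <= t1 -> (forall i, a ord0 i <= b ord0 i) ->
  (forall q, A q -> box a b q.1 /\ t0 <= q.2 < t1) ->
  (lebh A <= ((\prod_i (b ord0 i - a ord0 i)) * (t1 - t0))%:E)%E.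
Proof.
move=> t01 ab sub; rewrite -integral_indic_itv //; apply: integral_mono => t.
  by apply: intn_ge0 => x; rewrite lee_fin.
case: (boolP (t0 <= t < t1)) => ht; rewrite ?mulr1 ?mulr0.
  by apply: lebn_le_box => // x /sub[].
rewrite (_ : [set x | A (x, t)] = set0) //; last first.
  by apply/seteqP; split => // x /sub[_ /=]; rewrite (negbTE ht).
rewrite /lebn (_ : (fun x : V => _) = (fun=> 0%E)) ?intn_cst0 //.
by apply/funext => x; rewrite indicE in_set0.
Qed.

Lemma hball_box z : 0 < z.2 -> (lebh (hball z 20^-1) <= ((4 * z.2) ^+ n * (3 * z.2))%:E)%E.
Proof.
move=> z0; pose a : V := \row_i (z.1 ord0 i - 2 * z.2); pose b : V := \row_i (z.1 ord0 i + 2 * z.2).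
have ab i : a ord0 i <= b ord0 i by rewrite !mxE; lra.
have d0 : (0 : R) < 20^-1 by rewrite invr_gt0.
have E : (4 * z.2) ^+ n = \prod_i (b ord0 i - a ord0 i).
  rewrite -[X in _ ^+ X]card_ord -prodr_const; apply: eq_bigr => i _; rewrite !mxE.
  by ring.
rewrite E -[X in _ * X]subr0; apply: lebh_le_box => // [|q [q0 /(rho_ltP z0 q0 d0)]].
  by rewrite mulr_ge0 // ltW.
have /andP[_ m1] := mrho_small R => hq.
have zq0 : 0 < z.2 * q.2 by exact: mulr_gt0.
have {}hq : enorm (z.1 - q.1) ^+ 2 + (z.2 - q.2) ^+ 2 < z.2 * q.2.
  by apply: lt_le_trans hq _; rewrite ler_piMr // ltW.
have e0 := enorm_ge0 (z.1 - q.1).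
have q3 : q.2 < 3 * z.2.
  rewrite ltNge; apply/negP => q3; move: hq; apply/negP; rewrite -leNgt.
  have h : 0 <= q.2 * (q.2 - 3 * z.2) by rewrite mulr_ge0 ?subr_ge0 // ltW.
  by have := sqr_ge0 (enorm (z.1 - q.1)); nra.
have e2 : enorm (z.1 - q.1) < 2 * z.2.
  rewrite -(@ltr_pXn2r _ 2) ?nnegrE //; last by rewrite mulr_ge0 // ltW.
  have h : z.2 * q.2 < z.2 * (3 * z.2) by rewrite ltr_pM2l.
  by have := sqr_ge0 (z.2 - q.2); nra.
split; last by rewrite q3 (ltW q0).
move=> i; have := coord_le_enorm (z.1 - q.1) i; rewrite !mxE => /le_lt_trans /(_ e2).
by rewrite ltr_norml => /andP[h1 h2]; apply/andP; split; lra.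
Qed.

(** Chosen so that displacements by at most kap l within a strip of scale [l] stay below hyperbolic
    distance 1/20: (n + 1) kap = 1/100 and 1/10000 < 1/3200. *)
Definition kap : R := (100 * n.+1%:R)^-1.

Lemma kap_gt0 : 0 < kap. Proof. by rewrite invr_gt0 mulr_gt0. Qed.

Lemma kap_le : kap <= 100^-1.
Proof.
rewrite /kap lef_pV2 ?posrE ?mulr_gt0 // ler_peMr // ler1n //.
Qed.

(* A sufficient condition for the density hypothesis of Carleson-type measures:
   every point has nearby a box of comparable size inside the set. *)
Definition fat (c l : R) A := forall z, A z -> l / 2 < z.2 <= l /\
  exists a : V, exists b : R, forall q,
    (forall i, a ord0 i <= q.1 ord0 i < a ord0 i + c * l) -> b <= q.2 < b + c * l ->
    [/\ A q, `|q.1 - z.1| <= kap * l & `|q.2 - z.2| <= kap * l].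

Lemma fat_rho (l : R) z q : 0 < l -> l / 2 < z.2 <= l -> l / 2 < q.2 <= l ->
  `|q.1 - z.1| <= kap * l -> `|q.2 - z.2| <= kap * l -> rho z q < 20^-1.
Proof.
move=> l0 /andP[z1 z2] /andP[q1 q2] h1 h2; have /andP[m0 _] := mrho_small R.
have k0 := kap_gt0; have lk0 : 0 <= kap * l by rewrite mulr_ge0 // ltW.
apply/rho_ltP; try lra.
apply: (@le_lt_trans _ _ ((n%:R * (kap * l)) ^+ 2 + (kap * l) ^+ 2)).
  apply: lerD.
    have h : enorm (z.1 - q.1) <= n%:R * (kap * l).
      by rewrite (le_trans (enorm_le_norm _)) // ler_wpM2l // distrC.
    by rewrite ler_pXn2r ?nnegrE ?enorm_ge0 // mulr_ge0.
  by rewrite -[leLHS]real_normK ?num_real // ler_pXn2r ?nnegrE // distrC.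
have nk : n.+1%:R * kap = 100^-1.
  by rewrite /kap invfM mulrCA divff ?mulr1 // pnatr_eq0.
apply: (@le_lt_trans _ _ ((n.+1%:R * kap * l) ^+ 2)).
  rewrite -[n.+1%:R]natr1 -[kap * l]mul1r -!mulrA mulrDl mul1r.
  have := ler0n R n; set N := n%:R; set K := kap * l => N0.
  by have := mulr_ge0 (mulr_ge0 N0 lk0) lk0; rewrite -/K; nra.
rewrite nk; apply: (@lt_le_trans _ _ ((l / 2) * (l / 2) * 800^-1)).
  by have := mulr_gt0 l0 l0; nra.
have l2 : 0 <= l / 2 by rewrite divr_ge0 // ltW.
have e0 : 0 <= 800^-1 :> R by rewrite invr_ge0 ler0n.
move: (800^-1) e0 m0 => e e0 m0.
apply: ler_pM (ltW m0); [exact: mulr_ge0|exact: e0|].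
by apply: ler_pM => //; exact: ltW.
Qed.

(** The box has volume (c l)^(n+1) and the ball at most (4 l)^n 3 l. A further factor 10 keeps the
    ratio below 1/10 in every dimension. *)
Lemma fat_density (c l : R) A z : 0 < c <= 1 -> 0 < l -> fat c l A -> A z ->
  ((c ^+ n.+1 / (4 ^+ n * 30))%:E * lebh (hball z 20^-1) <= lebh (hball z 20^-1 `&` A))%E.
Proof.
move=> /andP[c0 c1] l0 HA Az; have [zl [a [b Hq]]] := HA z Az; have /andP[z1 z2] := zl.
have z0 : 0 < z.2 by lra.
have cl0 : 0 < c * l by rewrite mulr_gt0.
pose a' : V := \row_i (a ord0 i + c * l).
have a'E i : a' ord0 i = a ord0 i + c * l by rewrite mxE.
apply: (@le_trans _ _ ((c * l) ^+ n * (c * l))%:E); last first.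
  have -> : (c * l) ^+ n * (c * l) =
      \prod_i (a' ord0 i - a ord0 i) * ((b + c * l) - b).
    rewrite (addrC b) addrK; congr (_ * _).
    rewrite -[X in _ ^+ X]card_ord -prodr_const; apply: eq_bigr => i _.
    by rewrite a'E addrC addKr.
  apply: lebh_ge_box; first by rewrite lerDl ltW.
    by move=> i; rewrite a'E lerDl ltW.
  move=> q bq tq; have [|Aq q1 q2] := Hq q _ tq.
    by move=> i; rewrite -a'E; exact: bq.
  have [ql _] := HA q Aq; split=> //; split; first by case/andP: ql => h _; rewrite /upper /=; lra.
  exact: (fat_rho l0).
apply: le_trans (lee_wpmul2l _ (hball_box z0)) _.
  by rewrite lee_fin divr_ge0 ?mulr_ge0 ?exprn_ge0 // ltW.
rewrite -EFinM lee_fin.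
apply: (@le_trans _ _ (c ^+ n.+1 / (4 ^+ n * 30) * ((4 * l) ^+ n * (3 * l)))).
  rewrite ler_wpM2l ?divr_ge0 ?mulr_ge0 ?exprn_ge0 ?(ltW c0) //.
  apply: ler_pM; rewrite ?mulr_ge0 ?exprn_ge0 ?mulr_ge0 ?(ltW z0) //; last by rewrite ler_pM2l.
  by apply: lerXn2r; rewrite ?nnegrE ?mulr_ge0 ?(ltW z0) ?(ltW l0) // ler_pM2l.
rewrite !exprMn [c ^+ n.+1]exprS.
have -> : c * c ^+ n / (4 ^+ n * 30) * (4 ^+ n * l ^+ n * (3 * l)) =
   c ^+ n * l ^+ n * (c * l) * 10^-1 by field; rewrite expf_neq0.
rewrite ler_piMr ?mulr_ge0 ?exprn_ge0 ?(ltW c0) ?(ltW l0) //.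
by lra.
Qed.

Variable nu : (nat -> set H) -> \bar R.
Hypothesis Hnu : carleson_type nu.

Lemma fat_hnbhd (c t : R) (F : nat -> set H) : 0 < c <= 1 -> 0 < t -> hseq F ->
  (forall j, fat c (side R j) (F j)) -> (nu F < +oo)%E ->
  (nu (fun j => hnbhd (F j) t) < +oo)%E.
Proof.
move=> c01 t0 HF Ff; have /andP[c0 c1] := c01; case: Hnu => _ _ _ dens _.
have cn0 : 0 < c ^+ n.+1 by rewrite exprn_gt0.
have cn1 : c ^+ n.+1 <= 1 by rewrite exprn_ile1 // ltW.
have den : 0 < 4 ^+ n * 30 :> R by rewrite mulr_gt0 // exprn_gt0.
have d1 : 0 < (20^-1 : R) < 10^-1 by apply/andP; split; lra.
have d2 : 0 < c ^+ n.+1 / (4 ^+ n * 30) < 10^-1.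
  rewrite divr_gt0 //= ltr_pdivrMr //.
  apply: le_lt_trans cn1 _; have : 1 <= 4 ^+ n :> R by rewrite exprn_ege1 // ler1n.
  by lra.
have d3 j z : F j z -> ((c ^+ n.+1 / (4 ^+ n * 30))%:E * lebh (hball z 20^-1) <=
    lebh (hball z 20^-1 `&` F j))%E.
  by move=> Fz; apply: fat_density (side_gt0 _ _) (Ff j) Fz.
by move=> nF; apply/(dens _ _ _ HF d1 d2 d3 t t0).
Qed.

End FatSets.

(** * Finiteness under shifts, tents and thickenings *)

Section CarlesonCalculus.
Variables (R : realType) (n : nat).
Local Notation V := 'rV[R]_n.
Local Notation H := (V * R)%type.
Local Notation Z := 'rV[int]_n.
Implicit Types (p q z : H) (A F G : nat -> set H).

Lemma hseqU F G : hseq F -> hseq G -> hseq (fun j => F j `|` G j).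
Proof.
move=> HF HG j; have [F1 F2] := HF j; have [G1 G2] := HG j; split.
  by move=> z [/F1|/G1].
exact: hmeasurableU.
Qed.

Lemma hseq_cup (I : countType) (F : I -> nat -> set H) :
  (forall i, hseq (F i)) -> hseq (fun j => [set p | exists i, F i j p]).
Proof.
move=> HF j; split; first by move=> p [i]; have [h _] := HF i j; exact: h.
by apply: hmeasurable_bigcup => i; case: (HF i j).
Qed.

Lemma hseq_shiftl F i : hseq F -> hseq (fun j => F (j + i)%N).
Proof. by move=> HF j. Qed.

Lemma hseq_shiftr F i : hseq F -> hseq (fun j => if (i <= j)%N then F (j - i)%N else set0).
Proof.
move=> HF j; case: ifP => // _; split => //; exact: hmeasurable0.
Qed.

Lemma hseq_hnbhd F (t : R) : 0 < t -> hseq F -> hseq (fun j => hnbhd (F j) t).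
Proof.
move=> t0 HF j; have [F1 F2] := HF j; split; last exact: hmeasurable_hnbhd.
by move=> p [].
Qed.

Definition near_levels (J : nat) F : nat -> set H :=
  fun j => [set p | exists2 j', (levdist j' j <= J)%N & F j' p].

Lemma hseq_near_levels J F : hseq F -> hseq (near_levels J F).
Proof.
move=> HF; have := @hseq_cup nat (fun j' j => if (levdist j' j <= J)%N then F j' else set0).
have -> : (fun j => [set p | exists i, (if (levdist i j <= J)%N then F i else set0) p]) =
   near_levels J F.
  apply/funext => j; apply/seteqP; split => p.
    by move=> [i]; case: ifP => // ij Fi; exists i.
  by move=> [i ij Fi]; exists i; rewrite ij.
apply=> i j; case: ifP => // _; split => //; exact: hmeasurable0.
Qed.

Variable nu : (nat -> set H) -> \bar R.
Hypothesis Hnu : carleson_type nu.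

Lemma nu_fin_mono F G : hseq F -> hseq G -> (forall j, F j `<=` G j) ->
  (nu G < +oo)%E -> (nu F < +oo)%E.
Proof. by move=> HF HG FG; apply: le_lt_trans; case: Hnu => _ mono _ _ _; exact: mono. Qed.

Lemma nu_fin_mul (C : R) F G : hseq G -> (nu F <= C%:E * nu G)%E -> (nu G < +oo)%E ->
  (nu F < +oo)%E.
Proof.
case: Hnu => pos _ _ _ _ HG FG G1; apply: le_lt_trans FG _.
by have := pos _ HG; case: (nu G) G1 => // a _ _; rewrite -EFinM ltry.
Qed.

Lemma nu_finU F G : hseq F -> hseq G -> (nu F < +oo)%E -> (nu G < +oo)%E ->
  (nu (fun j => F j `|` G j) < +oo)%E.
Proof.
case: Hnu => pos _ [C [C0 add]] _ _ HF HG F1 G1.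
apply: le_lt_trans (add _ _ HF HG) _.
have := pos _ HF; have := pos _ HG.
case: (nu F) F1 => // a _; case: (nu G) G1 => // b _ _ _.
by rewrite -EFinD -EFinM ltry.
Qed.

Lemma nu_fin_shiftl i F : hseq F -> (nu F < +oo)%E -> (nu (fun j => F (j + i)%N) < +oo)%E.
Proof.
move=> HF F1; elim: i => [|i IH]; first by under [fun _ => _]funext do rewrite addn0.
case: Hnu => _ _ _ _ [C [C0 sh]].
have -> : (fun j => F (j + i.+1)%N) = (fun j => (fun j' => F (j' + i)%N) j.+1).
  by apply/funext => j; rewrite addSnnS.
have Hs := hseq_shiftl i HF.
exact: nu_fin_mul Hs (proj1 (sh _ Hs)) IH.
Qed.

Lemma nu_fin_shiftr i F : hseq F -> (nu F < +oo)%E ->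
  (nu (fun j => if (i <= j)%N then F (j - i)%N else set0) < +oo)%E.
Proof.
move=> HF F1; elim: i => [|i IH].
  by under [fun _ => _]funext do rewrite subn0.
case: Hnu => _ _ _ _ [C [C0 sh]].
have -> : (fun j => if (i.+1 <= j)%N then F (j - i.+1)%N else set0) =
  (fun j => if j is j'.+1 then (fun j => if (i <= j)%N then F (j - i)%N else set0) j' else set0).
  by apply/funext => -[].
have Hs := hseq_shiftr i HF.
exact: nu_fin_mul Hs (proj2 (sh _ Hs)) IH.
Qed.

(** Induction on [J]: the new levels lie exactly J + 1 away, hence in a shift of [F] by J + 1 in one
    of the two directions. *)
Lemma nu_fin_near_levels J F : hseq F -> (nu F < +oo)%E -> (nu (near_levels J F) < +oo)%E.
Proof.
move=> HF F1; elim: J => [|J IH].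
  apply: nu_fin_mono F1 => //; first exact: hseq_near_levels.
  move=> j p [j']; rewrite leqn0 => /eqP d0 Fp; have -> : j = j' by move: d0; rewrite /levdist; lia.
  exact: Fp.
have HL := hseq_shiftl J.+1 HF; have HR := hseq_shiftr J.+1 HF.
have HN := hseq_near_levels J HF.
have HU := hseqU HN (hseqU HL HR).
apply: nu_fin_mono (hseq_near_levels _ HF) HU _ _; last first.
  apply: nu_finU => //; first exact: hseqU.
  by apply: nu_finU => //; [exact: nu_fin_shiftl|exact: nu_fin_shiftr].
move=> j p [j' d Fp].
have [dJ|dJ] := leqP (levdist j' j) J; first by left; exists j'.
right; have [jj|jj] := leqP j j'.
  left; have -> : (j + J.+1 = j')%N by move: d dJ jj; rewrite /levdist; clear; lia.
  exact: Fp.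
right; have -> : (J.+1 <= j)%N by move: d dJ jj; rewrite /levdist; clear; lia.
have -> : (j - J.+1 = j')%N by move: d dJ jj; rewrite /levdist; clear; lia.
exact: Fp.
Qed.

(** The interval extends upwards from [y] in the lower half of the strip and downwards in the upper
    half. *)
Lemma strip_subinterval (c l y : R) : 0 < l -> 0 < c <= 8^-1 -> l / 2 < y <= l ->
  exists b, forall t, b <= t < b + c * l -> l / 2 < t <= l /\ `|t - y| <= c * l.
Proof.
move=> l0 /andP[c0 c1] /andP[y1 y2].
have cl : 0 < c * l by rewrite mulr_gt0.
have cl4 : c * l <= 8^-1 * l by rewrite ler_pM2r.
have [yl|yl] := ltP y (3 / 4 * l).
  exists y => t /andP[h1 h2]; split; first by apply/andP; split; lra.
  by rewrite ler_norml; apply/andP; split; lra.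
exists (y - c * l) => t /andP[h1 h2]; split; first by apply/andP; split; lra.
by rewrite ler_norml; apply/andP; split; lra.
Qed.

Definition tents (cA : set (nat * Z)) : nat -> set H :=
  fun j => \bigcup_(k in [set k | cA (j, k)]) tent j k.

Lemma hseq_tents cA : hseq (tents cA).
Proof.
move=> j; split.
  by move=> p [k _ [_ /andP[h _]]]; apply: lt_trans h; rewrite divr_gt0 // side_gt0.
have -> : tents cA j = [set p | exists k, (if pselect (cA (j, k)) then tent j k else set0) p].
  apply/seteqP; split => p; first by move=> [k Ak Tk]; exists k; case: pselect.
  by move=> [k]; case: pselect => // Ak Tk; exists k.
apply: hmeasurable_bigcup => k; case: pselect => Ak; last exact: hmeasurable0.
have -> : tent j k = [set p : H | cube j k p.1 /\ `]side R j / 2, side R j]%classic p.2].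
  by apply/seteqP; split => p; rewrite /tent /= in_itv.
apply: hmeasurable_prod; last exact: measurable_itv.
by rewrite cube_box; exact: rmeasurable_box.
Qed.

Lemma kap_le4 : 0 < kap R n <= 8^-1.
Proof. by rewrite kap_gt0 /= (le_trans (kap_le R n)) // lef_pV2 ?posrE // ler_nat. Qed.

Lemma fat_tents cA j : fat (kap R n) (side R j) (tents cA j).
Proof.
move=> z [k Ak [Ck zl]]; split => //.
set l := side R j in zl *; have l0 : 0 < l by exact: side_gt0.
have k4 := kap_le4; have [b Hb] := strip_subinterval l0 k4 zl.
have /andP[k0 k1] := k4; have kl0 : 0 < kap R n * l by rewrite mulr_gt0.
have kl4 : kap R n * l <= 8^-1 * l by rewrite ler_pM2r.
pose m i : R := (k ord0 i)%:~R / 2 ^+ j.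
have Em i : (k ord0 i + 1)%:~R / 2 ^+ j = m i + l by rewrite intrD mulrDl mul1r.
(* In each coordinate the box extends from [z] towards the farther face, so it stays in the cube
   even when [z] is close to its boundary. *)
exists (\row_i (if z.1 ord0 i < m i + l / 2 then z.1 ord0 i else z.1 ord0 i - kap R n * l)), b.
move=> q Hq tq; have [ql qz] := Hb _ tq; split=> //.
  exists k => //; split => // i.
  have := Hq i; have := Ck i; rewrite Em mxE -/(m i).
  move: (z.1 ord0 i) (q.1 ord0 i) (m i) (kap R n * l) kl0 kl4 l0 => x y a K K0 K8 l0.
  clear -K0 K8 l0; clearbody l.
  by case: ifPn; rewrite -?leNgt => h /andP[h1 h2] /andP[h3 h4]; apply/andP; split; lra.
apply/rV_normP => [|i]; first exact: ltW.
have := Hq i; rewrite !mxE ler_norml.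
by case: ifP => _ /andP[h3 h4]; apply/andP; split; lra.
Qed.

Lemma nu_fin_tents cA (t : R) : 0 < t -> (nu (tents cA) < +oo)%E ->
  (nu (fun j => hnbhd (tents cA j) t) < +oo)%E.
Proof.
move=> t0; apply: (fat_hnbhd Hnu _ t0 (hseq_tents cA)) => [|j]; last exact: fat_tents.
by have /andP[-> h] := kap_le4; rewrite (le_trans h) // invf_le1 // ler1n.
Qed.

(* A superlevel set itself need not satisfy the density condition of a
   Carleson-type measure; its thickening does. *)
Definition thick (dl : R) F : nat -> set H := fun j => [set z |
  side R j / 2 < z.2 <= side R j /\ exists2 z0, F j z0 /\ side R j / 2 < z0.2 <= side R j &
  `|z.1 - z0.1| < dl * side R j /\ `|z.2 - z0.2| < dl * side R j].

Lemma hseq_thick dl F : hseq (thick dl F).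
Proof.
move=> j; split.
  by move=> z [/andP[h _] _]; apply: lt_trans h; rewrite divr_gt0 // side_gt0.
pose U := [set z : H | exists2 z0, F j z0 /\ side R j / 2 < z0.2 <= side R j &
  `|z.1 - z0.1| < dl * side R j /\ `|z.2 - z0.2| < dl * side R j].
have -> : thick dl F j = [set p : H | [set: V] p.1 /\ `]side R j / 2, side R j]%classic p.2] `&` U.
  apply/seteqP; split => z /=; rewrite in_itv /=; first by move=> [h1 h2].
  by move=> [[_ h1] h2].
apply: hmeasurableI.
  apply: hmeasurable_prod; last exact: measurable_itv.
  by apply: rmeasurable_eopen => x _; exists 1.
apply: hmeasurable_eopen => z [z0 Fz [h1 h2]].
exists (Num.min (dl * side R j - `|z.1 - z0.1|) (dl * side R j - `|z.2 - z0.2|)).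
  by rewrite lt_min !subr_gt0 h1.
move=> q; rewrite !lt_min => /andP[q1 _] /andP[_ q2]; exists z0 => //; split.
  rewrite -(subrK z.1 q.1) -addrA (le_lt_trans (ler_normD _ _)) // distrC.
  by move: q1; lra.
rewrite -(subrK z.2 q.2) -addrA (le_lt_trans (ler_normD _ _)) // distrC.
by move: q2; lra.
Qed.

(** The box is placed at the original point [z0], all of whose close neighbours in the strip belong
    to the thickening. The displacement from [z] is at most dl/2 + dl, which dl <= kap/2 keeps below
    kap. *)
Lemma fat_thick dl F j : 0 < dl <= kap R n / 2 -> fat (dl / 2) (side R j) (thick dl F j).
Proof.
move=> /andP[d0 d1] z [zl [z0 [Fz z0l] [h1 h2]]]; split=> //.
set l := side R j in zl z0l h1 h2 *; have l0 : 0 < l by exact: side_gt0.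
have /andP[k0 k4] := kap_le4.
have c4 : 0 < dl / 2 <= 8^-1 by apply/andP; split; lra.
have [b Hb] := strip_subinterval l0 c4 z0l.
have dl0 : 0 < dl * l by rewrite mulr_gt0.
have dk : dl * l <= kap R n / 2 * l by rewrite ler_pM2r.
exists z0.1, b => q Hq tq; have [ql qz] := Hb _ tq.
have q1 : `|q.1 - z0.1| <= dl / 2 * l.
  apply/rV_normP => [|i]; first by rewrite mulr_ge0 ?divr_ge0 // ltW.
  by have := Hq i; rewrite !mxE ler_norml => /andP[h3 h4]; apply/andP; split; lra.
have E : dl / 2 * l = dl * l / 2 by ring.
have F' : kap R n / 2 * l = kap R n * l / 2 by ring.
rewrite F' in dk; rewrite E in q1 qz.
split.
- rewrite /thick /= -/l; split=> //; exists z0 => //.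
  by split; [apply: le_lt_trans q1 _|apply: le_lt_trans qz _]; lra.
- rewrite -(subrK z0.1 q.1) -addrA (le_trans (ler_normD _ _)) // (distrC z0.1).
  by rewrite (le_trans (lerD q1 (ltW h1))) //; lra.
- rewrite -(subrK z0.2 q.2) -addrA (le_trans (ler_normD _ _)) // (distrC z0.2).
  by rewrite (le_trans (lerD qz (ltW h2))) //; lra.
Qed.

End CarlesonCalculus.

(** * Superlevel sets of differences *)

Section SuperlevelSets.
Variables (R : realType) (n : nat).
Local Notation V := 'rV[R]_n.
Local Notation H := (V * R)%type.

(** Since mrho t > t - 1, the radius t = K + 2 certainly satisfies mrho t > K. *)
Lemma rho_lt_scale (a b c l : R) (p q : H) : 0 <= a -> 0 < c -> 0 < l ->
  0 < p.2 -> 0 < q.2 -> `|p.1 - q.1| <= a * l -> `|p.2 - q.2| <= b * l ->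
  c * l ^+ 2 <= p.2 * q.2 -> rho p q < ((n%:R * a) ^+ 2 + b ^+ 2) / c + 2.
Proof.
move=> a0 c0 l0 p0 q0 h1 h2 h3; set K := _ / c.
have K0 : 0 <= K by rewrite divr_ge0 ?addr_ge0 ?sqr_ge0 // ltW.
have t0 : 0 < K + 2 by lra.
apply/rho_ltP => //; apply: (@le_lt_trans _ _ (p.2 * q.2 * K)); last first.
  rewrite ltr_pM2l ?mulr_gt0 //; apply: le_lt_trans (mrho_gt t0); lra.
apply: (@le_trans _ _ (c * l ^+ 2 * K)); last by rewrite ler_wpM2r.
have -> : c * l ^+ 2 * K = (n%:R * (a * l)) ^+ 2 + (b * l) ^+ 2.
  by rewrite /K; field; rewrite gt_eqF.
apply: lerD.
  have h : enorm (p.1 - q.1) <= n%:R * (a * l).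
    by rewrite (le_trans (enorm_le_norm _)) // ler_wpM2l.
  by rewrite ler_pXn2r ?nnegrE ?enorm_ge0 // !mulr_ge0 // ltW.
rewrite -[leLHS]real_normK ?num_real // ler_pXn2r ?nnegrE //.
exact: le_trans h2.
Qed.

Variables (s : R) (r : nat).

Lemma SrjP j (f : V -> R) (e : R) (p : H) : Srj r j s f e p <->
  side R j / 2 < p.2 <= side R j /\
  exists2 h, enorm h = p.2 & e * powR p.2 s < `|diffk r h f p.1|.
Proof.
have p0 : side R j / 2 < p.2 -> 0 < p.2.
  by apply: lt_trans; rewrite divr_gt0 // side_gt0.
have D0 h := @Delta_gtP R n s r f p.1 p.2 e (p0 h).
by split=> -[h1 h2]; split=> //; apply/D0 => //; [case/andP: h2|case/andP: h1].
Qed.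

Lemma cont_powR (y : R) : 0 < y -> {for y, continuous (fun t => powR t s)}.
Proof.
move=> y0; apply: differentiable_continuous; apply/derivable1_diffP.
by apply: derivable_powR; rewrite in_itv /= y0.
Qed.

Lemma hseq_Srj (f : V -> R) (e : R) : continuous f -> hseq (fun j => Srj r j s f e).
Proof.
move=> cf j; split.
  by move=> p /SrjP[/andP[h _] _]; apply: lt_trans h; rewrite divr_gt0 // side_gt0.
pose U := [set p : H | 0 < p.2 /\
  exists2 h, enorm h = p.2 & e * powR p.2 s < `|diffk r h f p.1|].
have -> : Srj r j s f e =
    [set p : H | [set: V] p.1 /\ `]side R j / 2, side R j]%classic p.2] `&` U.
  apply/seteqP; split => z.
    move=> /SrjP[h1 h2]; split; first by rewrite /= in_itv.
    by split=> //; case/andP: h1 => h _; apply: lt_trans h; rewrite divr_gt0 // side_gt0.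
  by move=> [[_ /=]]; rewrite in_itv /= => h1 [_ h2]; apply/SrjP.
apply: hmeasurableI.
  apply: hmeasurable_prod; last exact: measurable_itv.
  by apply: rmeasurable_eopen => x _; exists 1.
apply: hmeasurable_open => p [p0 [h hp Hp]].
(* The step keeps its direction and is rescaled to length q.2; this witness varies continuously with
   [q], so [U] is open. *)
pose G q := `|diffk r ((q.2 / p.2) *: h) f q.1|.
have c2 : continuous (fun q : H => q.2 / p.2).
  by apply: contM; [exact: cont_snd|exact: cont_cst].
have cG : continuous G.
  apply: cont_norm; under [fun _ => _]funext do rewrite diffkE.
  apply: cont_sum => i; apply: contZ => q.
  apply: (@continuous_comp _ _ _
    (fun q : H => q.1 + (i%:R - r%:R / 2) *: ((q.2 / p.2) *: h)) f); last exact: cf.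
  apply: cvgD; first exact: cvg_fst.
  apply: cvgZl_tmp; apply: cvgZr_tmp; exact: c2.
have Gp : 0 < G p - e * powR p.2 s.
  by rewrite subr_gt0 /G divff ?gt_eqF // scale1r.
have cF : {for p, continuous (fun q : H => G q - e * powR q.2 s)}.
  apply: cvgB; first exact: cG.
  apply: cvgM; first exact: cvg_cst.
  apply: (@continuous_comp _ _ _ snd (fun t => powR t s)).
    exact: cvg_snd.
  exact: cont_powR.
have n1 : \forall q \near p, 0 < G q - e * powR q.2 s by exact: (cvgr_gt _ cF _ Gp).
have n2 : \forall q \near p, 0 < q.2 by exact: (cvgr_gt p.2 (@cont_snd _ _ p) _ p0).
near=> q.
have q0 : 0 < q.2 by near: q.
split=> //; exists ((q.2 / p.2) *: h).
  by rewrite enormZ hp ger0_norm ?divr_ge0 ?(ltW q0) ?(ltW p0) // divfK // gt_eqF.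
by rewrite -subr_gt0; near: q.
Unshelve. all: by end_near.
Qed.

End SuperlevelSets.

(** * Comparison of the distance with the two infima *)

Section Comparison.
Variables (R : realType) (n L : nat) (phi : 'rV[R]_n -> R) (psi : nat -> 'rV[R]_n -> R).
Local Notation V := 'rV[R]_n.
Local Notation H := (V * R)%type.
Local Notation Z := 'rV[int]_n.
Local Notation windex := (windex n).
Local Notation psiw := (psiw phi psi).
Variables (N k : nat) (B : R).
Hypothesis HA : atoms_bounded phi psi N k B.
Hypothesis HD : daubechies L phi psi.
Implicit Types (w : windex) (f g : V -> R).
Local Notation syn := (syn phi psi N).
Local Notation coef := (coef phi psi).
Variables (s : R) (r : nat).
Hypotheses (n_gt0 : (0 < n)%N) (s0 : 0 < s) (r0 : (0 < r)%N) (rL : (r <= L.+1)%N)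
  (kE : k = (Num.truncn s).+1) (kr : (k <= r)%N).
Local Notation th := (thS s).

Let sk : s < k%:R.
Proof. by rewrite kE; exact: truncnS_gt. Qed.

Variable nu : (nat -> set H) -> \bar R.
Hypothesis Hnu : carleson_type nu.

Lemma side_le1 j : side R j <= 1.
Proof. by rewrite sideE exprn_ile1 // ?invr_ge0 // invf_le1 // ler1n. Qed.

Lemma pow_side j : 2 ^+ j * side R j = 1.
Proof. by rewrite /side divff // expf_neq0. Qed.

Lemma side_le_exp i j J : (levdist i j <= J)%N -> side R j <= 2 ^+ J * side R i.
Proof.
move=> ij; rewrite /side ler_pdivlMr ?exprn_gt0 // mulrC ler_pdivrMr ?exprn_gt0 //.
by rewrite -exprD ler_weXn2l ?ler1n //; move: ij; rewrite /levdist; clear; lia.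
Qed.

(* The factor 2 / th = 2 ^ (s + 1) leaves room for moving a point of the
   superlevel set within its strip, by uniform continuity of the differences. *)
Lemma thick_Srj f (e0 : R) : in_Lambda s f -> 0 < e0 ->
  exists2 dl : R, 0 < dl <= kap R n / 2 &
  forall j, thick dl (fun j => Srj r j s f (2 * e0 / th)) j `<=` Srj r j s f e0.
Proof.
move=> /(in_Lambda_bounds n_gt0)[cf [M M0 [fM fL]]] e00.
have /andP[t0 t1] := thS_bounds s0.
have [C C0 HC] := coef_Lambda_bound HA HD s0 r0 rL kr.
have fL' h x : 0 < enorm h <= 1 -> `|diffk k h f x| <= M * powR (enorm h) s.
  by rewrite kE; exact: fL.
have Hn := HC f M cf M0 fM fL'; have CM0 : 0 <= C * M by exact: mulr_ge0.
have fE : syn (coef f) = f by apply/funext; exact: (expand_ncoef HA HD s0 cf CM0 Hn).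
have Hc := @coef_csupp _ _ phi psi f.
have e2 : 0 < e0 / 2 by rewrite divr_gt0.
have [dl dl0 Hdl] := syn_diff_continuity HA s0 sk kr Hc CM0 Hn e2.
rewrite fE in Hdl.
have k0 := kap_gt0 R n; pose d := Num.min dl (kap R n / 2).
exists d; first by rewrite lt_min dl0 divr_gt0 //= ge_min lexx orbT.
have ddl : d <= dl by rewrite ge_min lexx.
move=> j z [zl [z0 [/SrjP[_ [h0 h0E Hz0]] z0l] [h1 h2]]]; apply/SrjP; split=> //.
have l0 := side_gt0 R j; have /andP[zl1 zl2] := zl; have /andP[z0l1 z0l2] := z0l.
have z20 : 0 < z0.2 by lra.
have z2 : 0 < z.2 by lra.
have hE : enorm ((z.2 / z0.2) *: h0) = z.2.
  by rewrite enormZ h0E ger0_norm ?divr_ge0 ?(ltW z20) ?(ltW z2) // divfK // gt_eqF.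
exists ((z.2 / z0.2) *: h0) => //.
have dj : d * side R j <= dl * side R j by rewrite ler_pM2r.
have H1 : `|(z.2 / z0.2) *: h0 - h0| <= dl * side R j.
  rewrite -{2}[h0]scale1r -scalerBl (le_trans (norm_le_enorm _)) // enormZ h0E.
  rewrite -{2}(gtr0_norm z20) -normrM mulrBl mul1r divfK ?gt_eqF //.
  by rewrite (le_trans (ltW h2)).
have H2 : `|z.1 - z0.1| <= dl * side R j by rewrite (le_trans (ltW h1)).
have := Hdl z.1 z0.1 _ h0 j _ _ H2 H1; rewrite hE h0E => /(_ zl2 z0l2).
set a := diffk _ _ _ _; set b := diffk _ _ _ _ in Hz0 * => ab.
have tj : th ^+ j <= th^-1 * powR z0.2 s by exact: thS_le_powR.
have tj' : powR z.2 s <= th ^+ j.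
  by rewrite thS_side ge0_ler_powR ?nnegrE ?(ltW s0) ?(ltW z2) ?(ltW l0).
have tj0 : 0 < th ^+ j by rewrite exprn_gt0.
have ba : `|b| <= `|a| + e0 / 2 * th ^+ j.
  by rewrite -(subrK a b) (le_trans (ler_normD _ _)) // distrC addrC lerD2l.
have q1 : 2 * e0 * th ^+ j <= 2 * e0 / th * powR z0.2 s.
  by rewrite -[leRHS]mulrA ler_pM2l // mulr_gt0.
have q2 : e0 * powR z.2 s <= e0 * th ^+ j by rewrite ler_pM2l.
have q3 : 0 < e0 * th ^+ j by rewrite mulr_gt0.
lra.
Qed.

Definition wbad f (e : R) : set (nat * Z) :=
  [set p | exists2 l, (1 <= l < 2 ^ n)%N & e * th ^+ p.1 < `|coef f (l, p)| * sc R n p.1].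

(* A large coefficient forces, by Whitney's theorem, a large difference at a scale
   that the Lambda_s bound keeps comparable with that of the cube; hence the tent
   is at bounded hyperbolic distance from the superlevel set. *)
Lemma wbad_fin : exists2 C : R, 0 <= C & forall f (e0 : R), in_Lambda s f -> 0 < e0 ->
  (nu (fun j => Srj r j s f e0) < +oo)%E -> (nu (tents (wbad f (C * e0))) < +oo)%E.
Proof.
have [C C0 [rh rh0 HC]] := coef_whitney HA HD s0 r0 rL.
have /andP[t0 t1] := thS_bounds s0.
exists (C * (2 / th)) => [|f e0 Hf e00 nuS]; first by rewrite !mulr_ge0 // invr_ge0 ltW.
have [dl /andP[dl0 dlk] Hdl] := thick_Srj Hf e00.
have [cf [M M0 [fM fL]]] := in_Lambda_bounds n_gt0 Hf.
set e1 := 2 * e0 / th in Hdl; have e10 : 0 < e1 by rewrite divr_gt0 // mulr_gt0.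
set F := thick dl _ in Hdl.
have nuF : (nu F < +oo)%E.
  by apply: nu_fin_mono Hdl nuS => //; [exact: hseq_thick|exact: hseq_Srj].
have kR := kr; rewrite kE in kR.
have fr h x : 0 < enorm h <= 1 -> `|diffk r h f x| <= 2 ^+ r * M * powR (enorm h) s.
  exact: diffk_higher kR fL h x.
have s20 : 0 < s / 2 by rewrite divr_gt0.
have /andP[u0 u1] := thS_bounds s20; set sg := thS (s / 2) in u0 u1.
have u01 : 0 <= sg < 1 by rewrite (ltW u0).
have [J HJ] := @exists_pow_le R sg (2 ^+ r * M) e1 u01 e10.
(* The data of [rho_lt_scale] at l = side j: horizontal distance at most (rh + 1) l, vertical at
   most l, product of the heights at least l^2 / (4 2^J). *)
pose K := ((n%:R * (rh + 1)) ^+ 2 + 1 ^+ 2) / (4 * 2 ^+ J)^-1.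
have J0 : 0 < 2 ^+ J :> R by rewrite exprn_gt0.
have K0 : 0 < K + 2.
  by rewrite ltr_wpDl // /K invrK mulr_ge0 ?addr_ge0 ?sqr_ge0 // mulr_ge0 // ltW.
pose G j := hnbhd (F j) (K + 2).
have HG : hseq G by apply: hseq_hnbhd => //; exact: hseq_thick.
have nuG : (nu G < +oo)%E.
  apply: (fat_hnbhd Hnu _ K0 (hseq_thick _ _) _ nuF); last first.
    by move=> j; apply: fat_thick; rewrite dl0.
  have := kap_le R n; move: dl0 dlk; lra.
apply: nu_fin_mono (nu_fin_near_levels Hnu J HG nuG) => //.
- exact: hseq_tents.
- exact: hseq_near_levels.
move=> j z [m [l l1 /= Hl] [zm zl]].
have Ow : in_Omega ((l, (j, m)) : windex) by right.
have [u [h [uh h0 hj Hh]]] : exists u, exists h, [/\ `|2 ^+ j *: u - zvec R m| <= rh,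
    0 < enorm h, enorm h <= side R j &
    e1 * th ^+ j * powR (2 ^+ j * enorm h) (s / 2) < `|diffk r h f u|].
  apply: contrapT => nu_; move: Hl; apply/negP; rewrite -leNgt.
  have -> : C * (2 / th) * e0 * th ^+ j = C * (e1 * th ^+ j) by rewrite /e1; ring.
  apply: (HC _ Ow) => //=; first by case/andP: l1.
    by rewrite mulr_ge0 ?exprn_ge0 ?(ltW e10) ?(ltW t0).
  move=> u h uh /andP[h0 hj]; rewrite leNgt; apply/negP => Hh; apply: nu_.
  by exists u, h.
set y := enorm h in h0 hj Hh.
have y1 : y <= 1 by exact: le_trans hj (side_le1 j).
have [j' jy] := @dyadic_level R y ltac:(by rewrite h0).
have /andP[jy1 jy2] := jy.
have jj' : (j <= j')%N.
  rewrite leqNgt; apply/negP => j'j.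
  have : side R j <= side R j' / 2.
    rewrite !sideE -exprSr ler_wiXn2l ?invr_ge0 // invf_le1 // ler1n //.
  by move: jy1 hj; lra.
set Y := 2 ^+ j * y in Hh.
have P0 : 0 < 2 ^+ j :> R by rewrite exprn_gt0.
have Y0 : 0 < Y by rewrite mulr_gt0.
have Y1 : Y <= 1 by rewrite -(pow_side j) ler_pM2l.
have yE : powR y s = th ^+ j * powR Y s.
  rewrite thS_side -powRM ?(ltW Y0) ?(ltW (side_gt0 _ _)) // /Y mulrA [side _ _ * _]mulrC.
  by rewrite pow_side mul1r.
have Ys : powR Y s = powR Y (s / 2) * powR Y (s / 2).
  rewrite -powRD; last by rewrite (gt_eqF Y0) implybT.
  by congr powR; rewrite -splitr.
have Z0 : 0 < powR Y (s / 2) by rewrite powR_gt0.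
have Z1 : powR Y (s / 2) <= 1.
  apply: (@le_trans _ _ (powR 1 (s / 2))); last by rewrite powR1.
  by rewrite ge0_ler_powR ?nnegrE ?(ltW s20) ?(ltW Y0).
have tj0 : 0 < th ^+ j by rewrite exprn_gt0.
(* If [h] were much shorter than the side, the bound 2^r M th^j Y^s would fall below the threshold
   e1 th^j Y^(s/2), since the spare factor Y^(s/2) is at most sg^J. *)
have dJ : (levdist j' j <= J)%N.
  rewrite levdist_ge // leqNgt; apply/negP => Jj.
  have YJ : powR Y (s / 2) <= sg ^+ J.
    apply: (@le_trans _ _ (sg ^+ (j' - j))); last first.
      by rewrite ler_wiXn2l ?(ltW u0) ?(ltW u1) // ltnW.
    rewrite /sg thS_side ge0_ler_powR ?nnegrE ?(ltW s20) ?(ltW Y0) ?(ltW (side_gt0 _ _)) //.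
    rewrite /Y -(ler_pM2l (side_gt0 R j)) mulrA [side _ _ * _]mulrC pow_side mul1r.
    by rewrite !sideE -exprD subnKC // -sideE.
  have := fr h u; rewrite -/y h0 y1 yE Ys => /(_ isT) h3.
  have := lt_le_trans Hh h3.
  have -> : 2 ^+ r * M * (th ^+ j * (powR Y (s / 2) * powR Y (s / 2))) =
     2 ^+ r * M * powR Y (s / 2) * th ^+ j * powR Y (s / 2) by ring.
  rewrite !ltr_pM2r // ltNge => /negP; apply; apply: le_trans HJ.
  by rewrite ler_wpM2l // mulr_ge0 // exprn_ge0.
(* As Y <= 1, the level e1 y^s = e1 th^j Y^s lies below the threshold with Y^(s/2). *)
have Suy : Srj r j' s f e1 (u, y).
  apply/SrjP; split=> //; exists h => //=; apply: le_lt_trans Hh.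
  rewrite -mulrA yE Ys ler_pM2l // ler_pM2l //.
  by rewrite -[leRHS]mulr1 ler_pM2l.
have Fuy : F j' (u, y).
  split=> //; exists (u, y) => //=; rewrite !subrr normr0 mulr_gt0 // ?side_gt0 //.
  by split=> //; rewrite normr0 mulr_gt0 // side_gt0.
exists j' => //; apply/hnbhdP.
have l0 := side_gt0 R j; have /andP[zl1 zl2] := zl.
have z0 : 0 < z.2 by move: zl1 l0; lra.
split=> //; exists (u, y) => //; apply: (@rho_lt_scale _ _ (rh + 1) 1 (4 * 2 ^+ J)^-1 (side R j)) => //=.
- by rewrite addr_ge0.
- rewrite -(ler_pM2l P0) -{1}(gtr0_norm P0) -normrZ scalerBr.
  have -> : 2 ^+ j *: z.1 - 2 ^+ j *: u = (2 ^+ j *: z.1 - zvec R m) - (2 ^+ j *: u - zvec R m).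
    by rewrite opprB addrA subrK.
  rewrite (le_trans (ler_normB _ _)) // mulrCA pow_side mulr1 addrC lerD //.
  apply/rV_normP => // i; rewrite !mxE; have := zm i; rewrite intrD.
  rewrite ler_pdivrMr // ltr_pdivlMr // mulrC ler_norml => /andP[h1 h2].
  by apply/andP; split; move: h1 h2; lra.
- rewrite mul1r ler_norml; apply/andP; split; move: zl1 zl2 h0 hj; lra.
have yJ : side R j / (2 * 2 ^+ J) <= y.
  apply: le_trans (ltW jy1); rewrite invfM mulrA mulrAC ler_pM2r ?invr_gt0 //.
  rewrite ler_pdivrMr // mulrC; apply: side_le_exp; exact: dJ.
have -> : (4 * 2 ^+ J)^-1 * side R j ^+ 2 = side R j / 2 * (side R j / (2 * 2 ^+ J)).
  by field; rewrite expf_neq0.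
by rewrite ler_pM ?divr_ge0 ?mulr_ge0 ?(ltW l0) ?(ltW J0) // ltW.
Qed.

Lemma in_LambdaB f g : in_Lambda s f -> in_Lambda s g -> in_Lambda s (f \- g).
Proof.
move=> /(in_Lambda_bounds n_gt0)[cf [M M0 [fM fL]]] /(in_Lambda_bounds n_gt0)[cg [M' M'0 [gM gL]]].
apply: (@bounds_in_Lambda _ _ _ _ (M + M') (M + M')).
- exact: contB.
- by rewrite addr_ge0.
- by move=> x; rewrite (le_trans (ler_normB _ _)) // lerD.
- move=> h x h1; rewrite diffkB (le_trans (ler_normB _ _)) // mulrDl lerD //.
    exact: fL.
  exact: gL.
Qed.

Variable X : fseq R n -> \bar R.
Hypotheses (HX : qnormed_lattice X) (HII : assumptionII X nu).

Lemma sc0 : sc R n 0 = 1.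
Proof. by rewrite /sc mul0n expr0 sqrtr1. Qed.

Lemma V0P f (e : R) m : continuous f ->
  V0 phi psi f e m <-> e < `|coef f (0%N, (0%N, m))|.
Proof. by move=> cf; rewrite /V0 /= (wcoefE HA) //; left. Qed.

Lemma single_tents (D : set Z) :
  single (\bigcup_(m in D) tent (R := R) 0 m) = tents [set p | p.1 = 0%N /\ D p.2].
Proof.
apply/funext => j; rewrite /single /tents; case: eqP => [->|nj].
  by apply/seteqP; split => z [m]; [move=> Dm Tm; exists m|move=> [_ Dm] Tm; exists m].
by apply/seteqP; split => z // [m []].
Qed.

Lemma dist_upper : exists2 C : R, 0 <= C & forall f (e0 e2 : R), in_Lambda s f ->
  0 < e0 -> 0 < e2 -> (nu (fun j => Srj r j s f e0) < +oo)%E ->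
  (nu (single (\bigcup_(m in V0 phi psi f e2) tent 0 m)) < +oo)%E ->
  (distL s f (LambdaX X s phi psi) <= (C * (e0 + e2))%:E)%E.
Proof.
have [C C0 HC] := wbad_fin.
have [C1 C10 HC1] := coef_Lambda_bound HA HD s0 r0 rL kr.
have [C2 C20 HC2] := syn_Lnorm HA s0 sk kE.
exists (C2 * (C + 1)) => [|f e0 e2 Hf e00 e20 nuS nuV].
  by rewrite mulr_ge0 // addr_ge0.
have [cf [M M0 [fM fL]]] := in_Lambda_bounds n_gt0 Hf.
have fL' h x : 0 < enorm h <= 1 -> `|diffk k h f x| <= M * powR (enorm h) s.
  by rewrite kE; exact: fL.
have Hn := HC1 f M cf M0 fM fL'.
(* Scaling functions are judged by [V0] and wavelets by [wbad], because Whitney's theorem needs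
   vanishing moments; this is the origin of the second infimum. *)
pose bad : set windex := [set w | if w.1 == 0%N then V0 phi psi f e2 w.2.2
  else wbad f (C * e0) w.2].
pose c w := if `[< bad w >] then 0 else coef f w.
have cc : csupp c.
  by move=> w nO; rewrite /c; case: asboolP => // _; exact: coef_csupp.
set A := C * e0 + e2; have A0 : 0 <= A by rewrite addr_ge0 ?mulr_ge0 // ltW.
have /andP[t0 t1] := thS_bounds s0.
have cn : ncoef c A th.
  move=> w Ow; have tw : 0 <= th ^+ w.2.1 by rewrite exprn_ge0 // ltW.
  rewrite /c; case: asboolP => [_|nb]; first by rewrite normr0 mul0r mulr_ge0.
  move: nb; rewrite /bad /=; case: eqP => [w0|/eqP w0] nb.
    have j0 : w.2.1 = 0%N by case: Ow => [[]//|]; rewrite w0.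
    move: nb; case: w Ow w0 j0 {tw} => l [j m] /= Ow -> ->.
    move=> nb; rewrite sc0 expr0 !mulr1 leNgt; apply/negP => h; apply: nb.
    by apply/V0P => //; apply: le_lt_trans h; rewrite lerDr mulr_ge0 // ltW.
  apply: (@le_trans _ _ (C * e0 * th ^+ w.2.1)); last first.
    by rewrite ler_wpM2r // lerDl ltW.
  rewrite leNgt; apply/negP => h; apply: nb; exists w.1; last by case: w h {Ow tw w0}.
  by case: Ow => [[h0]|//]; rewrite h0 in w0.
have [Hh Lh] := HC2 c A cc A0 cn.
pose g := f \- syn c.
have Hg : in_Lambda s g by exact: in_LambdaB.
have ch : continuous (syn c) by case: Hh.
have cg : continuous g by case: Hg.
have coefg w : coef g w = coef f w - c w.
  by rewrite (wcoefB HA) // (coef_syn HA HD s0 w cc A0 cn).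
pose cA : set (nat * Z) := wbad f (C * e0) `|` [set p | p.1 = 0%N /\ V0 phi psi f e2 p.2].
have nuA : (nu (tents cA) < +oo)%E.
  apply: (@nu_fin_mono _ _ _ Hnu _ (fun j => tents (wbad f (C * e0)) j `|`
      tents [set p | p.1 = 0%N /\ V0 phi psi f e2 p.2] j)).
  - exact: hseq_tents.
  - by apply: hseqU; exact: hseq_tents.
  - by move=> j z [m [h|h] Tm]; [left|right]; exists m.
  - apply: (nu_finU Hnu); try exact: hseq_tents; first exact: HC.
    by rewrite -single_tents.
have gX : LambdaX X s phi psi g.
  split=> //; apply: (@wseq_fin _ _ _ _ _ _ _ HA s n_gt0 s0 X HX g (C1 * M) cA) => //.
  - move=> w Ow; rewrite coefg /c; case: asboolP => b; first by rewrite subr0; exact: Hn.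
    rewrite subrr normr0 mul0r mulr_ge0 ?mulr_ge0 //.
    by rewrite exprn_ge0 // ltW.
  - move=> w Ow; rewrite coefg /c; case: asboolP => [b _|b]; last by rewrite subrr eqxx.
    move: b; rewrite /bad /=; case: eqP => [w0 h|_ h]; [right|by left].
    by split=> //; case: Ow => [[]//|]; rewrite w0.
  - exact/HII.
apply: le_trans (ereal_inf_lbound _) _; first by exists g; [split|reflexivity].
have -> : f \- g = syn c by apply/funext => x; rewrite /g /= opprB addrC subrK.
apply: le_trans Lh _; rewrite lee_fin -mulrA ler_wpM2l //.
have -> : (C + 1) * (e0 + e2) = A + (C * e2 + e0) by rewrite /A; ring.
by rewrite lerDl addr_ge0 ?mulr_ge0 // ltW.
Qed.

Lemma Srj_fin g (eta : R) : LambdaX X s phi psi g -> 0 < eta ->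
  (nu (fun j => Srj r j s g eta) < +oo)%E.
Proof.
move=> [Hg Xg] eta0; have [cg [M M0 [gM gL]]] := in_Lambda_bounds n_gt0 Hg.
have [C C0 HC] := coef_Lambda_bound HA HD s0 r0 rL kr.
have gL' h x : 0 < enorm h <= 1 -> `|diffk k h g x| <= M * powR (enorm h) s.
  by rewrite kE; exact: gL.
have Hn := HC g M cg M0 gM gL'; have CM0 : 0 <= C * M by exact: mulr_ge0.
have gE : syn (coef g) = g by apply/funext; exact: (expand_ncoef HA HD s0 cg CM0 Hn).
have Hc := @coef_csupp _ _ phi psi g.
have [eta' eta'0 [J HJ]] := syn_small_local HA s0 sk kr Hc CM0 Hn eta0.
rewrite gE in HJ.
have nuT := proj1 (HII _) (large_cubes_fin HA n_gt0 s0 HX cg eta'0 Xg).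
rewrite -/(tents _) in nuT; set cA := large_cubes s (coef g) eta' in nuT.
pose a : R := N%:R + r%:R * 2 ^+ J.
pose K := ((n%:R * a) ^+ 2 + (2 ^+ J) ^+ 2) / (2 * 2 ^+ J)^-1.
have J0 : 0 < 2 ^+ J :> R by rewrite exprn_gt0.
have a0 : 0 <= a by rewrite addr_ge0 // mulr_ge0 // ltW.
have K0 : 0 < K + 2.
  by rewrite ltr_wpDl // /K invrK mulr_ge0 ?addr_ge0 ?sqr_ge0 // mulr_ge0 // ltW.
pose G j := hnbhd (tents cA j) (K + 2).
have HG : hseq G by apply: hseq_hnbhd => //; exact: hseq_tents.
have nuG : (nu G < +oo)%E by exact: nu_fin_tents.
apply: nu_fin_mono (nu_fin_near_levels Hnu J HG nuG) => //.
- exact: hseq_Srj.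
- exact: hseq_near_levels.
move=> j p /SrjP[pl [h hp Hh]]; have /andP[pl1 pl2] := pl.
have l0 := side_gt0 R j; have p0 : 0 < p.2 by lra.
(* By [syn_small_local] a large difference needs a large coefficient on a cube that is close to [p]
   in position and in level. *)
have [w [Ow dw nw cw]] : exists w, [/\ in_Omega w, (levdist w.2.1 j <= J)%N,
    `|2 ^+ w.2.1 *: p.1 - zvec R w.2.2| <= N%:R + r%:R * (2 ^+ w.2.1 * enorm h) &
    eta' * th ^+ w.2.1 < `|coef g w| * sc R n w.2.1].
  apply: contrapT => nw; move: Hh; apply/negP; rewrite -leNgt -hp.
  apply: (HJ _ _ j); first by rewrite hp.
  move=> w Ow dw Hw; rewrite leNgt; apply/negP => cw; apply: nw.
  by exists w.
case: w Ow dw nw cw => l [i m] /= Ow dw nw cw.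
exists i => //; apply/hnbhdP; split=> //.
have i0 := side_gt0 R i; have P0 : 0 < 2 ^+ i :> R by rewrite exprn_gt0.
(* The corner of the cube, taken at the top height of its tent, represents the tent. *)
exists ((side R i) *: zvec R m, side R i).
  exists m; first by exists l.
  split=> /=; last by apply/andP; split; [rewrite ltr_pdivrMr // ltr_pMr // ltr1n|].
  move=> q; rewrite !mxE [side R i * _]mulrC /side lexx /= ltr_pM2r ?invr_gt0 // ltr_int.
  by rewrite ltzD1.
have ij : side R i <= 2 ^+ J * side R j by apply: side_le_exp; move: dw; rewrite /levdist addnC.
have ji : side R j <= 2 ^+ J * side R i by apply: side_le_exp.
apply: (@rho_lt_scale _ _ a (2 ^+ J) (2 * 2 ^+ J)^-1 (side R i)) => //=.
- rewrite -(ler_pM2l P0) -{1}(gtr0_norm P0) -normrZ scalerBr scalerA pow_side scale1r.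
  apply: le_trans nw _; rewrite [leRHS]mulrCA pow_side mulr1 lerD2l ler_wpM2l // hp.
  rewrite -ler_pdivlMl // -/(side R i) mulrC (le_trans pl2) //.
- have J1 : 1 <= 2 ^+ J :> R by rewrite exprn_ege1 // ler1n.
  have : side R i <= 2 ^+ J * side R i by rewrite ler_peMl // ltW.
  have := le_trans pl2 ji.
  by move=> h1 h2; rewrite ler_norml; apply/andP; split; lra.
rewrite expr2 mulrA ler_pM2r // mulrC ler_pdivrMr ?mulr_gt0 //.
by apply: le_trans ij _; rewrite mulrA [leRHS]mulrC ler_pM2l //; lra.
Qed.

(** Finiteness for [g] holds at every positive level [eta], so both infima for [f] are bounded with
    an extra [eta], which is removed at the end. *)
Lemma dist_lower : exists2 C : R, 0 < C & forall f g (dlt : R), in_Lambda s f ->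
  LambdaX X s phi psi g -> (Lnorm_s s (f \- g)%R <= dlt%:E)%E ->
  (eps_Xnu nu r s f + eps_V0 nu phi psi f <= (C * dlt)%:E)%E.
Proof.
have B0 : 0 <= B by case: HA.
pose C1 := B * (2 * N%:R) ^+ n.
have C10 : 0 <= C1 by rewrite mulr_ge0 // exprn_ge0 // mulr_ge0.
exists (2 ^+ r + C1); first by rewrite ltr_pwDl // exprn_gt0.
move=> f g d Hf gX Ld; have [Hg Xg] := gX.
have [cf _ _] := Hf; have [cg _ _] := Hg.
have [bd bL] := Lnorm_le_bounds n_gt0 Ld.
have d0 : 0 <= d by exact: le_trans (bd 0).
have cfg : continuous (f \- g) by exact: contB.
have kR := kr; rewrite kE in kR.
have P1 (eta : R) : 0 < eta -> (eps_Xnu nu r s f <= (2 ^+ r * d + eta)%:E)%E.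
  move=> eta0; apply: ereal_inf_lbound; exists (2 ^+ r * d + eta) => //; split.
    by rewrite ltr_wpDl // mulr_ge0 // exprn_ge0.
  apply: nu_fin_mono (Srj_fin gX eta0) => //; try exact: hseq_Srj.
  move=> j p /SrjP[pl [h hp Hh]]; apply/SrjP; split=> //; exists h => //.
  have /andP[pl1 pl2] := pl.
  have h1 : 0 < enorm h <= 1.
    rewrite hp (le_trans pl2 (side_le1 j)) andbT (lt_trans _ pl1) //.
    by rewrite divr_gt0 // side_gt0.
  have := diffk_higher kR bL p.1 h1; rewrite diffkB hp => h2.
  have h3 := ler_normD (diffk r h f p.1 - diffk r h g p.1) (diffk r h g p.1).
  by rewrite subrK in h3; rewrite mulrDl in Hh; lra.
have P2 (eta : R) : 0 < eta -> (eps_V0 nu phi psi f <= (C1 * d + eta)%:E)%E.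
  move=> eta0; apply: ereal_inf_lbound; exists (C1 * d + eta) => //; split.
    by rewrite ltr_wpDl // mulr_ge0.
  have nuT := proj1 (HII _) (large_cubes_fin HA n_gt0 s0 HX cg eta0 Xg).
  rewrite single_tents; apply: nu_fin_mono nuT => //; try exact: hseq_tents.
  move=> j z [m /= [-> /(V0P _ _ cf) h] Tm]; exists m => //; exists 0%N; first by left.
  rewrite /= expr0 sc0 !mulr1.
  have Ow : in_Omega ((0%N, (0%N, m)) : windex) by left.
  have := coef_sup_bound HA cfg Ow bd; rewrite /= sc0 mulr1 (wcoefB HA) // => h2.
  have h3 := ler_normD (coef f (0%N, (0%N, m)) - coef g (0%N, (0%N, m))) (coef g (0%N, (0%N, m))).
  rewrite subrK in h3; have E : d * B * (2 * N%:R) ^+ n = C1 * d by rewrite /C1; ring.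
  by rewrite E in h2; lra.
apply/lee_addgt0Pr => e e0.
have e2 : 0 < e / 2 by rewrite divr_gt0.
apply: le_trans (leeD (P1 _ e2) (P2 _ e2)) _.
by rewrite -!EFinD lee_fin; lra.
Qed.

End Comparison.
Theorem mainTheorem2 (R : realType) (n : nat)
    (X : fseq R n -> \bar R) (nu : (nat -> set ('rV[R]_n * R)) -> \bar R)
    (s : R) (r L : nat) (phi : 'rV[R]_n -> R) (psi : nat -> 'rV[R]_n -> R) :
  (0 < n)%N ->
  qnormed_lattice X -> carleson_type nu -> assumptionII X nu ->
  0 < s -> (0 < r)%N -> s < r%:R ->
  s < L%:R -> (r - 1 <= L)%N ->
  daubechies L phi psi ->
  exists c C : R, 0 < c /\ 0 < C /\
    forall f : 'rV[R]_n -> R, in_Lambda s f ->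
      let rhs := (eps_Xnu nu r s f + eps_V0 nu phi psi f)%E in
      (c%:E * rhs <= distL s f (LambdaX X s phi psi))%E /\
      (distL s f (LambdaX X s phi psi) <= C%:E * rhs)%E.
Proof.
move=> n0 HX Hnu HII s0 r0 sr sL rL HD.
have /andP[ts _] := truncn_itv (ltW s0).
set k := (Num.truncn s).+1.
have kr : (k <= r)%N by rewrite /k -(ltr_nat R); exact: le_lt_trans sr.
have kL : (k <= L)%N by rewrite /k -(ltr_nat R); exact: le_lt_trans sL.
have L1 : (1 <= L)%N by exact: leq_trans kL.
have rL' : (r <= L.+1)%N by rewrite -add1n -leq_subLR.
have [N [B HA]] := daubechies_atoms HD L1 kL.
have [C1 C10 HU] := dist_upper HA HD n0 s0 r0 rL' (erefl k) kr Hnu HX HII.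
have [C2 C20 HL] := dist_lower HA HD n0 s0 r0 rL' (erefl k) kr Hnu HX HII.
have pos (S : set R) : (forall e, S e -> 0 < e) -> (0 <= ereal_inf [set e%:E | e in S])%E.
  by move=> HS; apply: le_ereal_inf_tmp => _ [e Se <-]; rewrite lee_fin ltW // HS.
have near (S : set R) (a e : R) : ereal_inf [set x%:E | x in S] = a%:E -> 0 < e ->
    exists2 x, S x & x < a + e.
  move=> Sa e0; have : (ereal_inf [set x%:E | x in S] < (a + e)%:E)%E.
    by rewrite Sa lte_fin ltrDl.
  by move=> /ereal_inf_lt[_ [x Sx <-]]; rewrite lte_fin => xa; exists x.
(* [C1] is only known to be nonnegative, hence C1 + 1. *)
exists C2^-1, (C1 + 1); rewrite invr_gt0 ltr_wpDl //; split=> //; split=> // f Hf rhs.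
split.
  apply: le_ereal_inf_tmp => _ [g [gX Hg] <-].
  have := Lnorm_s_ge0 s n0 (f \- g); case E : (Lnorm_s s (f \- g)) => [d| |] // _.
    rewrite -(mulKf (lt0r_neq0 C20) d) EFinM lee_pmul2l //; last first.
      by rewrite lte_fin invr_gt0.
    by apply: HL gX _ => //; rewrite E.
  by rewrite leey.
have := pos [set e | 0 < e /\ (nu (fun j => Srj r j s f e) < +oo)%E] (fun e h => proj1 h).
have := pos [set e | 0 < e /\ (nu (single (\bigcup_(m in V0 phi psi f e) tent 0 m)) < +oo)%E]
  (fun e h => proj1 h).
rewrite -/(eps_V0 nu phi psi f) -/(eps_Xnu nu r s f) /rhs.
have C11 : 0 < C1 + 1 by rewrite ltr_wpDl.
(* If one of the infima is infinite, so is the right-hand side, and the upper bound is trivial. *)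
case EV : (eps_V0 nu phi psi f) => [b| |] // b0; last first.
  by case: (eps_Xnu nu r s f) => [a| |] // _; rewrite gt0_muley ?lte_fin // leey.
case EX : (eps_Xnu nu r s f) => [a| |] // a0; last first.
  by rewrite gt0_muley ?lte_fin // leey.
(* The infima need not be attained; admissible values within e' of each cost 2 (C1 + 1) e' = e
   together. *)
apply/lee_addgt0Pr => e e0; pose e' := e / (2 * (C1 + 1)).
have e'0 : 0 < e' by rewrite divr_gt0 // mulr_gt0.
have [x [x0 Sx] xa] := near _ _ _ EX e'0; have [y [y0 Sy] yb] := near _ _ _ EV e'0.
apply: le_trans (HU f x y Hf x0 y0 Sx Sy) _.
have -> : ((C1 + 1)%:E * (a%:E + b%:E) + e%:E = ((C1 + 1) * (a + b) + e)%R%:E)%E by [].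
rewrite lee_fin.
have -> : (C1 + 1) * (a + b) + e = (C1 + 1) * ((a + e') + (b + e')).
  by rewrite /e'; field; rewrite gt_eqF.
apply: ler_pM; rewrite ?lerDl // ?addr_ge0 ?(ltW x0) ?(ltW y0) //.
by apply: lerD; exact: ltW.
Qed.
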